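(* There exist absolute constants $c_1,C_0,C,c'>0$ and $c_2\in(0,1)$ such that the following holds in the setup of the context. Assume $\|A_l^*\|_2\le\rho_{\max}<1$ for all $l\in[m]$, and put $\Delta=(1-\rho_{\max})^2$. Let $\delta\in(0,c_2)$, $v\ge1$, $\mathcal S\subseteq[|\mathcal E|d^2]$, and $$L_1=\log\Big(\frac{dT}{\delta\Delta}\Big),\quad L_2=\log\Big(\frac{d|\mathcal E|}{\delta}\Big),\quad \Phi_{\mathcal S}=1+\frac{\sqrt{|\mathcal S|}}{\kappa_{\mathcal S}}+\sqrt T\,\|(\widetilde Da^* )_{\mathcal S^c}\|_1,\quad \mathfrak M=\Delta^{-1/2}\max\{d^{3/2}L_1,\ \mu L_2\}.$$ Choose $\lambda=\frac{c_1}{m}\sqrt{\frac T\Delta}\max\{d^{3/2}L_1,\ \mu L_2\}$ and suppose $$T\ge C_0\frac{v}{\Delta^2}\big(1+\mu'\Phi_{\mathcal S}\sqrt{L_2}\big)^2,\quad T\ge C_0\frac{(d+v)^2}{m\Delta^2},\quad T\ge C_0\frac{\mu^2\Phi_{\mathcal S}^2L_2^2d^2}{m\Delta^2},\quad T\ge C_0\frac{\mu}{\sqrt m}\Phi_{\mathcal S}\,d\,\Delta_G .$$ Then with probability at least $1-4e^{-c'\sqrt v}-\delta$, $$\frac1{\sqrt m}\|\widehat a-a^*\|_2\le C\left(\frac{\mathfrak M}{\sqrt{mT}}\Big(1+\frac{\sqrt{|\mathcal S|}}{\kappa_{\mathcal S}}\Big)+\sqrt{\frac{\mathfrak M}{m\sqrt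 T}\,\|(\widetilde Da^* )_{\mathcal S^c}\|_1}\right).$$ In particular: (Smooth regime) for $\mathcal S=\emptyset$ (so $\kappa_\emptyset=1$ and $\Phi_{\mathcal S}=1+\sqrt T\|\widetilde Da^*\|_1$), the bound reads $$\frac1{\sqrt m}\|\widehat a-a^*\|_2\le C\left(\frac{\mathfrak M}{\sqrt{mT}}+\sqrt{\frac{\mathfrak M}{m\sqrt T}\|\widetilde Da^*\|_1}\right);$$ (Few-changes regime) for $\mathcal S=\mathrm{supp}(\widetilde Da^* )$ and $s=\|\widetilde Da^*\|_0=|\mathcal S|$ (so $\Phi_{\mathcal S}=1+\sqrt s/\kappa_{\mathcal S}$), the bound reads $$\frac1{\sqrt m}\|\widehat a-a^*\|_2\le C\,\frac{\mathfrak M}{\sqrt{mT}}\Big(1+\frac{\sqrt s}{\kappa_{\mathcal S}}\Big).$$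
   Context: Setup. Let $d,T\ge1$, $m\ge2$ be integers and $G=([m],\mathcal E)$ an undirected connected graph. Let $A_1^*,\dots,A_m^*\in\mathbb R^{d\times d}$ be deterministic matrices. For each $l\in[m]$, $x_{l,0}=0$ and $x_{l,t+1}=A_l^*x_{l,t}+\eta_{l,t+1}$ for $t=0,\dots,T$, where the $\eta_{l,t}$ are i.i.d. $\mathcal N(0,I_d)$ over all $l,t$. Vectorized model. $\mathrm{vec}$ stacks columns. $X_l=[x_{l,1}\cdots x_{l,T}]$, $\widetilde X_l=[x_{l,2}\cdots x_{l,T+1}]$, both in $\mathbb R^{d\times T}$. $Q=\mathrm{blkdiag}(X_l^\top\otimes I_d)_{l=1}^m$; $a^*\in\mathbb R^{md^2}$ and $\widetilde x\in\mathbb R^{mdT}$ are obtained by stacking over $l$ the vectors $\mathrm{vec}(A_l^* )$ and $\mathrm{vec}(\widetilde X_l)$. Graph quantities. $D\in\{-1,0,1\}^{|\mathcal E|\times m}$ is the incidence matrix of an arbitrary orientation of $G$ (each row has one $+1$ and one $-1$, at the endpoints of the edge), $\widetilde D=D\otimes I_{d^2}$, and $D^\dagger$ is the Moore–Penrose pseudoinverse. $\mu$ is the maximum Euclidean norm of a column of $D^\dagger\in\mathbb R^{m\times|\mathcal E|}$, and $\mu'$ the maximum Euclidean norm of a row of $D^\dagger$. For $\mathcal T\subseteq[d^2|\mathcal E|]$ the compatibility factor is $\kappa_\emptyset=1$ and $\kappa_{\mathcal T}=\inf_{\theta\in\mathbb R^{md^2}}\frac{\sqrt{|\mathcal T|}\,\|\theta\|_2}{\|(\widetilde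 D\theta)_{\mathcal T}\|_1}$ for $\mathcal T\ne\emptyset$ (infimum over $\theta$ with nonzero denominator). $(x)_{\mathcal T}$ denotes restriction of $x$ to coordinates in $\mathcal T$; $\mathcal S^c$ is the complement in $[|\mathcal E|d^2]$; $\|x\|_0$ is the number of nonzero entries. System quantities. $\Gamma_t(A)=\sum_{k=0}^tA^k(A^k)^\top$, $G_l=\sum_{t=1}^T\Gamma_{t-1}(A_l^* )$, $\overline G=\frac1m\sum_{l=1}^mG_l$, and $\Delta_G=\max_{a,b\in[d]}\big(\sum_{l=1}^m[(G_l)_{b,a}-(\overline G)_{b,a}]^2\big)^{1/2}$. $\|\cdot\|_2$ of a matrix is the spectral norm. Estimator. For $\lambda\ge0$, $\widehat a\in\arg\min_{a\in\mathbb R^{md^2}}\big\{\frac1{2m}\|\widetilde x-Qa\|_2^2+\lambda\|\widetilde Da\|_1\big\}$ (any minimizer). *)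

(* Defs.v *)
From HB Require Import structures.
From mathcomp Require Import all_boot all_order all_algebra.
From mathcomp Require Import mxtens.
From mathcomp Require Import all_classical all_reals all_analysis.

Set Implicit Arguments.
Unset Strict Implicit.
Unset Printing Implicit Defensive.

Import Order.TTheory GRing.Theory Num.Theory.
Import numFieldNormedType.Exports.

Local Open Scope classical_set_scope.
Local Open Scope ring_scope.

(* The norm that MathComp-Analysis puts on matrices is the sup norm, hence the
   explicit norms below. *)
Section norms.
Context {R : realType}.

Definition l2norm n (x : 'cV[R]_n) : R := Num.sqrt (\sum_i x i ord0 ^+ 2).

Definition l1norm n (x : 'cV[R]_n) : R := \sum_i `|x i ord0|.

(* The l1 norm of the restriction of x to the coordinates in S. *)
Definition l1norm_on n (S : {set 'I_n}) (x : 'cV[R]_n) : R :=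
  \sum_(i in S) `|x i ord0|.

Definition supp n (x : 'cV[R]_n) : {set 'I_n} :=
  finset (fun i => x i ord0 != 0).

Definition spectral_norm p q (A : 'M[R]_(p, q)) : R :=
  sup [set l2norm (A *m x) | x in [set x : 'cV[R]_q | l2norm x <= 1]].

Definition is_minimizer (U : Type) (f : U -> R) (a : U) : Prop :=
  forall b, f a <= f b.

End norms.

Section pseudoinverse.
Context {R : realType}.

Definition penrose p q (A : 'M[R]_(p, q)) (B : 'M[R]_(q, p)) : Prop :=
  [/\ A *m B *m A = A, B *m A *m B = B,
      (A *m B)^T = A *m B & (B *m A)^T = B *m A].

Lemma penrose_unique p q (A : 'M[R]_(p, q)) (B B' : 'M[R]_(q, p)) :
  penrose A B -> penrose A B' -> B = B'.
Proof.
move=> [h1 h2 h3 h4] [k1 k2 k3 k4].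
have e1 : A *m B = A *m B'.
  by rewrite -h3 -{1}k1 -(mulmxA (A *m B')) trmx_mul h3 k3 mulmxA h1.
have e2 : B *m A = B' *m A.
  rewrite -h4 -{1}k1 -mulmxA mulmxA.
  by rewrite trmx_mul k4 h4 -mulmxA (mulmxA A) h1.
by rewrite -h2 e2 -mulmxA e1 mulmxA k2.
Qed.

Lemma gram_unitmx r q (F : 'M[R]_(r, q)) :
  row_free F -> F *m F^T \in unitmx.
Proof.
move=> Ffree; rewrite -row_free_unit -kermx_eq0; apply/rowV0P => u /sub_kermxP.
move=> /(congr1 (mulmx^~ u^T)); rewrite mul0mx mulmxA -mulmxA -trmx_mul => uF0.
suff : u *m F = 0.
  by move=> /eqP; rewrite mulmx_free_eq0// => /eqP.
apply/rowP => j; rewrite [RHS]mxE.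
move/matrixP: uF0 => /(_ ord0 ord0); rewrite mxE [RHS]mxE.
under eq_bigr do rewrite [_^T _ _]mxE -expr2.
move=> /eqP; rewrite psumr_eq0 => [|? _]; last exact: sqr_ge0.
by move=> /allP /(_ j (mem_index_enum _)) /=; rewrite sqrf_eq0 => /eqP.
Qed.

Lemma penrose_exists p q (A : 'M[R]_(p, q)) : exists B, penrose A B.
Proof.
have [r [C [F [AE CTfree Ffree]]]] : exists r (C : 'M[R]_(p, r)) (F : 'M[R]_(r, q)),
    [/\ A = C *m F, row_free C^T & row_free F].
  exists (\rank A), (col_base A), (row_base A); rewrite mulmx_base; split => //.
    by rewrite /row_free mxrank_tr; exact: col_base_full.
  exact: row_base_free.
have Fu : F *m F^T \in unitmx by exact: gram_unitmx.
have Cu : C^T *m C \in unitmx by have := gram_unitmx CTfree; rewrite trmxK.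
pose B := F^T *m invmx (F *m F^T) *m (invmx (C^T *m C) *m C^T).
have AB : A *m B = C *m invmx (C^T *m C) *m C^T.
  by rewrite AE /B !mulmxA -(mulmxA C F) -(mulmxA C (_ *m _)) mulmxV// mulmx1.
have BA : B *m A = F^T *m invmx (F *m F^T) *m F.
  rewrite AE /B !mulmxA -(mulmxA _ C^T C) -(mulmxA _ (invmx (C^T *m C))).
  by rewrite mulVmx// mulmx1.
exists B; split.
- by rewrite AB AE !mulmxA -(mulmxA _ C^T C) -(mulmxA C) mulVmx// mulmx1.
- by rewrite BA /B !mulmxA -(mulmxA _ F) -(mulmxA _ (F *m _)) mulmxV// mulmx1.
- by rewrite AB !trmx_mul trmxK trmx_inv trmx_mul trmxK mulmxA.
- by rewrite BA !trmx_mul trmxK trmx_inv trmx_mul trmxK mulmxA.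
Qed.

Definition pseudoinverse p q (A : 'M[R]_(p, q)) : 'M[R]_(q, p) :=
  xget 0 [set B | penrose A B].

Lemma pseudoinverseP p q (A : 'M[R]_(p, q)) : penrose A (pseudoinverse A).
Proof. by have [B AB] := penrose_exists A; exact: (xgetPex 0 (ex_intro _ B AB)). Qed.

End pseudoinverse.

(* Stacked and vectorized objects use the index convention of the Kronecker
   product *t: position (i, j) of 'I_m * 'I_n is i * n + j in 'I_(m * n). *)
Section vectorization.
Context {R : realType}.

Definition vec p q (A : 'M[R]_(p, q)) : 'cV[R]_(q * p) :=
  \col_k A (mxtens_unindex k).2 (mxtens_unindex k).1.

Definition stack m n (u : 'I_m -> 'cV[R]_n) : 'cV[R]_(m * n) :=
  \col_k u (mxtens_unindex k).1 (mxtens_unindex k).2 ord0.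

Definition blkdiag m p q (B : 'I_m -> 'M[R]_(p, q)) : 'M[R]_(m * p, m * q) :=
  \matrix_(i, j) if (mxtens_unindex i).1 == (mxtens_unindex j).1
    then B (mxtens_unindex i).1 (mxtens_unindex i).2 (mxtens_unindex j).2
    else 0.

End vectorization.

Section graph.
Context {m : nat}.
Implicit Types E : {set {set 'I_m}}.

Definition simple_graph E : Prop := forall e, e \in E -> #|e| = 2%N.

Definition connected_graph E : Prop :=
  forall i j : 'I_m, connect (fun a b => [set a; b]%SET \in E) i j.

(* The k-th edge is [enum_val k]; it is directed from [src k] to [tgt k]. *)
Definition orientation E (tgt src : 'I_#|E| -> 'I_m) : Prop :=
  forall k, enum_val k = [set tgt k; src k]%SET.

Definition incidence (R : realType) E (tgt src : 'I_#|E| -> 'I_m) :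
    'M[R]_(#|E|, m) :=
  \matrix_(k, i) ((i == tgt k)%:R - (i == src k)%:R).

End graph.

Section graph_quantities.
Context {R : realType}.

Definition max_col_norm p q (A : 'M[R]_(p, q)) : R :=
  \big[Num.max/0]_j l2norm (col j A).

Definition max_row_norm p q (A : 'M[R]_(p, q)) : R :=
  \big[Num.max/0]_i l2norm (row i A)^T.

Definition compatibility n p (Dt : 'M[R]_(p, n)) (S : {set 'I_p}) : R :=
  if S == finset.set0 then 1
  else inf [set Num.sqrt #|S|%:R * l2norm th / l1norm_on S (Dt *m th)
           | th in [set th : 'cV[R]_n | l1norm_on S (Dt *m th) != 0]].

End graph_quantities.

Section system_quantities.
Context {R : realType}.

Definition gramian d (A : 'M[R]_d) (t : nat) : 'M[R]_d :=
  \sum_(0 <= k < t.+1) A ^+ k *m (A ^+ k)^T.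

Definition sum_gramian d (T : nat) (A : 'M[R]_d) : 'M[R]_d :=
  \sum_(1 <= t < T.+1) gramian A t.-1.

Definition gramian_variation d m (T : nat) (A : 'I_m -> 'M[R]_d) : R :=
  let G l := sum_gramian T (A l) in
  let Gbar := m%:R^-1 *: \sum_l G l in
  \big[Num.max/0]_(a < d) \big[Num.max/0]_(b < d)
    Num.sqrt (\sum_l (G l b a - Gbar b a) ^+ 2).

End system_quantities.

Section random_vectors.
Context {disp : measure_display} {Omega : measurableType disp} {R : realType}.
Variable P : probability Omega R.

(* Mutual independence of the finite family X of maps to U, where M is the
   sigma-algebra of U. *)
Definition mutually_independent (I : finType) (U : Type) (M : set (set U))
    (X : I -> Omega -> U) : Prop :=
  forall (J : {set I}) (B : I -> set U), (forall i, i \in J -> M (B i)) ->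
    P (\bigcap_(i in [set` J]) X i @^-1` B i)
    = (\prod_(i in J) P (X i @^-1` B i))%E.

(* The Borel sigma-algebra of R^d, generated by the coordinates. *)
Definition vector_measurable d : set (set 'cV[R]_d) :=
  <<s [set B | exists (j : 'I_d) (A : set R),
         measurable A /\ B = [set u : 'cV[R]_d | A (u j ord0)]] >>.

(* X has law N(0, I_d). *)
Definition standard_gaussian d (X : Omega -> 'cV[R]_d) : Prop :=
  [/\ forall j, measurable_fun setT (fun w => X w j ord0),
      forall j (A : set R), measurable A ->
        P [set w | A (X w j ord0)] = normal_prob 0 1 A
    & mutually_independent measurable (fun (j : 'I_d) w => X w j ord0)].

Definition iid_standard_gaussian d (I : finType) (X : I -> Omega -> 'cV[R]_d) :
    Prop :=
  (forall i, standard_gaussian (X i)) /\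
  mutually_independent (@vector_measurable d) X.

(* [prob_ge p Q]: the property Q holds with probability at least p. As Q need
   not be measurable, it is required on an event of probability at least p. *)
Definition prob_ge (p : R) (Q : Omega -> Prop) : Prop :=
  exists F : set Omega,
    [/\ measurable F, F `<=` [set w | Q w] & (p%:E <= P F)%E].

End random_vectors.

Section linear_systems.
Context {R : realType}.

Definition linear_systems (Omega : Type) d m (T : nat) (A : 'I_m -> 'M[R]_d)
    (eta x : 'I_m -> nat -> Omega -> 'cV[R]_d) : Prop :=
  forall l w, x l 0%N w = 0 /\
    forall t, (t <= T)%N -> x l t.+1 w = A l *m x l t w + eta l t.+1 w.

Variables (d m T : nat) (x : 'I_m -> nat -> 'cV[R]_d).

(* The matrices [x_{l,1} ... x_{l,T}] and [x_{l,2} ... x_{l,T+1}]. *)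
Definition data (l : 'I_m) : 'M[R]_(d, T) := \matrix_(i, t) x l t.+1 i ord0.

Definition data_next (l : 'I_m) : 'M[R]_(d, T) :=
  \matrix_(i, t) x l t.+2 i ord0.

Definition design : 'M[R]_(m * (T * d), m * (d * d)) :=
  blkdiag (fun l => (data l)^T *t (1%:M : 'M[R]_d)).

Definition response : 'cV[R]_(m * (T * d)) := stack (fun l => vec (data_next l)).

(* Dt is the extended incidence matrix. *)
Definition objective p (Dt : 'M[R]_(p, m * (d * d))) (lambda : R)
    (a : 'cV[R]_(m * (d * d))) : R :=
  (2 * m%:R)^-1 * l2norm (response - design *m a) ^+ 2
  + lambda * l1norm (Dt *m a).

End linear_systems.

(* Main.v *)
(* Every state and every noise vector is a fixed linear image of one standard
   Gaussian vector y, so all random quantities are quadratic or bilinear forms in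
   y, with exponential moments controlled by the Gaussian determinant formula.
   Let h be the estimation error and w the image of h under the extended incidence
   matrix. Since the pseudoinverse G of D satisfies G D = 1 - J / m, the blocks of
   h are their mean plus a combination of the columns of G with coefficients w;
   hence the noise term of the basic inequality is at most m lambda (|h|_2 + |w|_1) / 2
   and h lies in a cone |w|_1 <= 4 Phi |h|_2, unless |h|_2 < 1 / sqrt T. On this cone
   the empirical quadratic form is at least (T / 2) |h|_2^2: the mean part is a
   quadratic form in a single row, the part carried by w is a quadratic chaos indexed
   by an l1 ball, and the cross terms are bounded entrywise.
   The chaos is bounded by chaining along dyadic roundings of w. The exponential
   moment of an increment F(w')y - F(w)y is normalized by |F(w + w')y|^2 itself, so
   the supremum of the process is absorbed into the left-hand side, and the entropy
   of the roundings is only logarithmic in the number of coordinates. *)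

Require Import Defs.
From HB Require Import structures.
From mathcomp Require Import all_boot all_order all_algebra.
From mathcomp Require Import mxtens.
From mathcomp Require Import all_classical all_reals all_analysis.
From mathcomp Require Import measurable_realfun ring lra.

Set Implicit Arguments.
Unset Strict Implicit.
Unset Printing Implicit Defensive.

Import Order.TTheory GRing.Theory Num.Theory.
Import numFieldNormedType.Exports.

Local Open Scope classical_set_scope.
Local Open Scope ring_scope.

(** * Gaussian vectors *)

(** The obstacle is the quadratic chaos in [w]. The usual exponential moment of a Gaussian bilinear
    form holds only under a bound on its operator norm, and chaining with it brings in a second
    entropy sum. Subtracting |N y|^2 in the exponent removes the restriction, since the resulting
    quadratic form is positive definite for every N. For an increment, N = s F(w'-w)^T F(w'+w) and
    the subtracted term is at most s^2 |w'-w|^2 |F(w'+w) y|^2: each link is paid for in the l2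
    metric alone, times the unknown supremum. With s inversely proportional to the mesh, the
    supremum returns with a coefficient as small as desired. The l1 norm enters through two sums
    over levels, both linear in |w_j|: the costs of the rounded coordinates times the mesh, and the
    squared rounding errors divided by the mesh. The term in Phi with the factor sqrt T comes from
    the threshold 1 / sqrt T. Above it, the additive constant of the cone is at most a multiple of
    |h|_2; below it, the claimed rate holds at once because M >= 1. *)

Section normal_integral.
Context {R : realType}.
Notation mu := (@lebesgue_measure R).
Notation gamma := (@normal_prob R 0 1).

Import HBNNSimple.

Let integral_normal_prob_nnsfun (f : {nnsfun measurableTypeR R >-> R}) :
  (\int[gamma]_x (f x)%:E = \int[mu]_x ((f x)%:E * (normal_pdf 0 1 x)%:E))%E.
Proof.
under [LHS]eq_integral do rewrite fimfunE -fsumEFin//.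
rewrite [LHS]ge0_integral_fsum//; last 2 first.
  - by move=> r; exact/measurable_EFinP/measurableT_comp.
  - by move=> n x _; rewrite EFinM nnfun_muleindic_ge0.
under [RHS]eq_integral.
  move=> x xD; rewrite fimfunE -fsumEFin// muleC ge0_mule_fsumr; last first.
    by move=> r; rewrite EFinM nnfun_muleindic_ge0.
  over.
have mpdf : measurable_fun setT (fun x => (normal_pdf 0 1 x : R)%:E).
  by apply/measurable_EFinP; exact: measurable_normal_pdf.
rewrite [RHS]ge0_integral_fsum//; last 2 first.
  - move=> r; apply: emeasurable_funM => //.
    by apply/measurable_EFinP; apply/measurableT_comp.
  - move=> n x _; rewrite mule_ge0//; last by rewrite EFinM nnfun_muleindic_ge0.
    by rewrite lee_fin normal_pdf_ge0.
apply: eq_fsbigr => r _.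
under [LHS]eq_integral do rewrite EFinM.
rewrite integralZl_indic_nnsfun//= integral_indic//= setIT.
rewrite /normal_prob integral_mkcond.
have [r0|r0] := leP 0 r; last first.
  rewrite (_ : f @^-1` [set r] = set0); last first.
    by apply/seteqP; split => x //= fxr; move: r0; rewrite -fxr ltNge fun_ge0.
  rewrite (eq_integral (cst 0%E)) ?integral0 ?mule0; last first.
    by move=> x _; rewrite patchE in_set0.
  rewrite (eq_integral (cst 0%E)) ?integral0//.
  by move=> x _; rewrite indic0/= mulr0 mule0.
rewrite -ge0_integralZl//; last 2 first.
  - by apply/(measurable_restrictT _ _).1 => //; exact/measurable_funTS.
  - by move=> x _; rewrite patchE; case: ifPn => // _; rewrite lee_fin normal_pdf_ge0.
apply: eq_integral => x _; rewrite patchE indicE/=.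
by case: ifPn => _; rewrite ?mulr1 ?mulr0 ?mule0 // muleC.
Qed.

(** [gamma] is given by its density on sets; simple functions and monotone convergence carry the
    density over to integrals. *)
Lemma integral_normal_prob (f : measurableTypeR R -> \bar R) :
  measurable_fun setT f -> (forall x, 0 <= f x)%E ->
  (\int[gamma]_x f x = \int[mu]_x (f x * (normal_pdf 0 1 x)%:E))%E.
Proof.
move=> mf f0.
have mpdf : measurable_fun setT (fun x => (normal_pdf 0 1 x : R)%:E).
  by apply/measurable_EFinP; exact: measurable_normal_pdf.
pose f_ := nnsfun_approx measurableT mf.
transitivity (lim (\int[gamma]_x (f_ n x)%:E @[n --> \oo])%E).
  rewrite -monotone_convergence//=.
  - apply: eq_integral => ? /[!inE] xD; apply/esym/cvg_lim => //=.
    exact: cvg_nnsfun_approx.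
  - by move=> n; exact/measurable_EFinP/measurable_funTS.
  - by move=> n ? _; rewrite lee_fin.
  - by move=> ? _ ? ? mn; rewrite lee_fin; exact/lefP/nd_nnsfun_approx.
transitivity (lim (\int[mu]_x ((f_ n x)%:E * (normal_pdf 0 1 x)%:E)
    @[n --> \oo])%E).
  by apply: congr_lim; apply/funext => n; exact: integral_normal_prob_nnsfun.
rewrite -monotone_convergence//=.
- apply: eq_integral => x _; apply/cvg_lim => //=.
  by apply: cvgeZr => //; exact: cvg_nnsfun_approx.
- move=> n; apply: emeasurable_funM => //.
  exact/measurable_EFinP/measurable_funTS.
- by move=> n ? _; rewrite mule_ge0 ?lee_fin ?normal_pdf_ge0.
- move=> x _ a b ab; rewrite lee_wpmul2r ?lee_fin ?normal_pdf_ge0//.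
  exact/lefP/nd_nnsfun_approx.
Qed.

(** Completing the square: the integrand times the standard density is a constant multiple of the
    normal density with mean [- y / a] and variance [a^-1]. In the application [a] is a diagonal
    entry of a positive definite matrix and [y] the coupling with the other coordinates. *)
Lemma normal_exp_quadratic (a y : R) : 0 < a ->
  (\int[gamma]_z (expR (- (a - 1) / 2 * z ^+ 2 - z * y))%:E
   = (Num.sqrt a^-1 * expR (y ^+ 2 / (2 * a)))%:E)%E.
Proof.
move=> a0; rewrite integral_normal_prob; last 2 first.
- apply/measurable_EFinP; apply: measurableT_comp => //.
  apply: measurable_funB; apply: measurable_funM => //.
- by move=> z; rewrite lee_fin expR_ge0.
have sa : Num.sqrt a^-1 != 0 :> R by rewrite gt_eqF// sqrtr_gt0 invr_gt0.
under eq_integral => z _.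
  rewrite (_ : _ * _ = (Num.sqrt a^-1 * expR (y ^+ 2 / (2 * a)))%:E
     * (normal_pdf (- y / a) (Num.sqrt a^-1) z)%:E)%E; last first.
    rewrite -!EFinM; congr EFin.
    rewrite !normal_pdfE ?oner_neq0//.
    rewrite /normal_peak /normal_fun sqr_sqrtr ?invr_ge0 ?ltW//.
    rewrite expr1n subr0 mul1r -[in RHS]mulrnAr sqrtrM ?invr_ge0 ?(ltW a0)//.
    have p0 : Num.sqrt (pi *+ 2) != 0 :> R.
      by rewrite gt_eqF// sqrtr_gt0 mulrn_wgt0// pi_gt0.
    set E1 := expR _; set E2 := expR _; set E3 := expR _; set E4 := expR _.
    have E : E1 * E2 = E3 * E4.
      rewrite /E1 /E2 /E3 /E4 -!expRD; congr expR; field.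
      by rewrite gt_eqF.
    transitivity ((Num.sqrt (pi *+ 2))^-1 * (E1 * E2)); first by ring.
    by rewrite E; field; rewrite p0.
  over.
rewrite ge0_integralZl//; last 2 first.
- by apply/measurable_EFinP; exact: measurable_normal_pdf.
- by move=> z _; rewrite lee_fin normal_pdf_ge0.
by rewrite integral_normal_pdf mule1.
Qed.

End normal_integral.

(** * Independent standard normal coordinates and integration of the first one *)

Section iid_normal.
Context {d : measure_display} {Omega : measurableType d} {R : realType}.
Variable P : probability Omega R.
Notation gamma := (@normal_prob R 0 1).

(** The product formula is asked of full families only: a subfamily is recovered by taking [setT] at
    the other indices. *)
Definition iid_normal n (xi : 'I_n -> Omega -> R) : Prop :=
  [/\ forall i, measurable_fun setT (xi i),
      forall i A, measurable A -> P (xi i @^-1` A) = gamma A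
    & forall B : 'I_n -> set R, (forall i, measurable (B i)) ->
        P (\bigcap_i (xi i @^-1` B i)) = (\prod_i P (xi i @^-1` B i))%E].

(** A pi-system generating the sigma-algebra of the vector [xi], on which measures are compared. *)
Definition cylinders n (xi : 'I_n -> Omega -> R) : set (set Omega) :=
  [set A | exists2 B : 'I_n -> set R, forall i, measurable (B i) &
    A = \bigcap_i (xi i @^-1` B i)].

Lemma cylinders_setI_closed n (xi : 'I_n -> Omega -> R) :
  setI_closed (cylinders xi).
Proof.
move=> _ _ [B mB ->] [C mC ->]; exists (fun i => B i `&` C i).
  by move=> i; exact: measurableI.
by rewrite -bigcapI; apply: eq_bigcapr => i _; rewrite preimage_setI.
Qed.

Lemma cylinders_measurable n (xi : 'I_n -> Omega -> R) :
  (forall i, measurable_fun setT (xi i)) -> cylinders xi `<=` measurable.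
Proof.
move=> mxi _ [B mB ->]; apply: fin_bigcap_measurable => // i _.
by rewrite -[X in measurable X]setTI; exact: mxi.
Qed.

Lemma cylinders_setT n (xi : 'I_n -> Omega -> R) : cylinders xi setT.
Proof. by exists (fun=> setT) => //; rewrite bigcapT. Qed.

Lemma measurable_coord n (xi : 'I_n -> Omega -> R) i :
  measurable_fun setT (xi i : g_sigma_algebraType (cylinders xi) -> R).
Proof.
move=> _ A mA; rewrite setTI; apply: sub_sigma_algebra.
exists (fun j => if j == i then A else setT); first by move=> j; case: ifP.
apply/seteqP; split => w /=.
  by move=> Aw j _ /=; case: eqP => // ->.
by move=> /(_ i Logic.I) /=; rewrite eqxx.
Qed.

Lemma iid_normal_tail n (xi : 'I_n.+1 -> Omega -> R) :
  iid_normal xi -> iid_normal (fun i => xi (lift ord0 i)).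
Proof.
move=> [mxi lxi ixi]; split=> [i|i|B mB]; [exact: mxi|exact: lxi|].
pose C i := if unlift ord0 i is Some j then B j else setT.
have mC i : measurable (C i) by rewrite /C; case: unliftP.
have := ixi C mC; rewrite big_ord_recl.
rewrite {2}/C unlift_none preimage_setT probability_setT mul1e.
under [X in _ = X -> _]eq_bigr do rewrite /C liftK.
move=> <-; congr (P _); apply/seteqP; split => w /= h i _.
  by rewrite /C; case: unliftP => //= j ->; exact: h.
by have := h (lift ord0 i) Logic.I; rewrite /C liftK.
Qed.

Section integrate_head.
Variables (n : nat) (xi : 'I_n.+1 -> Omega -> R).
Hypothesis hxi : iid_normal xi.
Let tl i := xi (lift ord0 i).
Let C := cylinders tl.
Let OC := g_sigma_algebraType C.

Let mtl i : measurable_fun setT (tl i).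
Proof. by case: hxi => h _ _; exact: h. Qed.

Let mid : measurable_fun setT (id : Omega -> OC).
Proof.
move=> _ A mA; rewrite setTI preimage_id.
apply: smallest_sub mA; last exact: cylinders_measurable.
by split; [exact: measurable0|move=> B mB; rewrite setTD; exact: measurableC
  |move=> F mF; exact: bigcupT_measurable].
Qed.

Let idC : {RV P >-> OC} := HB.pack (id : Omega -> OC)
  (isMeasurableFun.Build _ _ _ _ (id : Omega -> OC) mid).

Let mpair : measurable_fun setT (fun w => (xi ord0 w, w) : measurableTypeR R * OC).
Proof. by apply: measurable_fun_pair => //; case: hxi => h _ _; exact: h. Qed.

Let pairC : {RV P >-> (measurableTypeR R * OC)%type} := HB.pack
  (fun w => (xi ord0 w, w) : measurableTypeR R * OC)
  (isMeasurableFun.Build _ _ _ _ (fun w => (xi ord0 w, w) : measurableTypeR R * OC) mpair).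

(** Both sides are measures in [B], namely [P] restricted to an event and a multiple of [P]. They
    agree on the cylinders of the tail, hence on the sigma-algebra these generate. *)
Let head_indep (A : set R) (B : set OC) : measurable A -> measurable B ->
  P (xi ord0 @^-1` A `&` B) = (gamma A * P B)%E.
Proof.
move=> mA mB; have [mxi lxi ixi] := hxi.
have mxA : measurable (xi ord0 @^-1` A).
  by rewrite -[X in measurable X]setTI; exact: mxi.
have gA0 : gamma A \is a fin_num by rewrite fin_num_measure.
pose m1 := mrestr P mxA.
pose k := NngNum (fine_ge0 (measure_ge0 gamma A)).
pose m2 : {measure set Omega -> \bar R} := mscale k P.
suff : m1 B = m2 B by rewrite /m1 /m2 /mrestr/= /mscale/= setIC => ->; rewrite fineK.
apply: (@g_sigma_algebra_measure_unique _ _ _ C _ (fun=> setT)) => //.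
- exact: cylinders_measurable.
- by move=> _; exact: cylinders_setT.
- by rewrite bigcup_const.
- exact: cylinders_setI_closed.
- move=> _ [D mD ->]; rewrite /m1 /m2 /mrestr/= /mscale/= fineK//.
  have [_ _ itl] := iid_normal_tail hxi; rewrite itl//.
  pose F i := if unlift ord0 i is Some j then D j else A.
  have mF i : measurable (F i) by rewrite /F; case: unliftP.
  have := ixi F mF; rewrite big_ord_recl.
  rewrite {2}/F unlift_none lxi//.
  under [X in _ = (_ * X)%E -> _]eq_bigr do rewrite /F liftK.
  move=> <-; congr (P _); apply/seteqP; split => w /=.
    by move=> [h Aw] i _; rewrite /F; case: unliftP => [j ->|->] //=; exact: h.
  move=> h; split; last by have := h ord0 Logic.I; rewrite /F unlift_none.
  by move=> i _; have := h (lift ord0 i) Logic.I; rewrite /F liftK.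
- move=> _; change (P (setT `&` xi ord0 @^-1` A) < +oo)%E.
  by rewrite -ge0_fin_numE// fin_num_measure// setTI.
Qed.

(** The tail is represented by the identity of [Omega], equipped with the sigma-algebra generated by
    the tail coordinates, instead of by a point of a product space. The law of the head paired with
    this identity is a product measure, and Tonelli's theorem integrates the head out. *)
Lemma integrate_head (f : measurableTypeR R * g_sigma_algebraType
    (cylinders (fun i => xi (lift ord0 i))) -> \bar R) :
  measurable_fun setT f -> (forall z, 0 <= f z)%E ->
  (\int[P]_w f (xi ord0 w, w) = \int[P]_w \int[gamma]_z f (z, w))%E.
Proof.
move=> mf f0.
transitivity (\int[distribution P pairC]_z f z)%E.
  by rewrite ge0_integral_distribution.
transitivity (\int[gamma \x distribution P idC]_z f z)%E.
  apply: (@eq_measure_integral _ _ _ setT (gamma \x distribution P idC)%E) => A mA _.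
  apply/esym.
  apply: product_measure_unique => // U V mU mV.
rewrite fubini_tonelli2// ge0_integral_distribution//.
  exact: measurable_fun_fubini_tonelli_G.
by move=> w; apply: integral_ge0 => z _; exact: f0.
Qed.

End integrate_head.

End iid_normal.

(** * Frobenius norms and quadratic forms written as traces *)

Section quadratic_forms.
Context {R : realType}.

(** The squared Frobenius norm; on a column, the squared Euclidean norm. The trace form, shared with
    [qform] and [mdot], leaves the algebra to cyclicity and transposition. *)
Definition fro2 p q (A : 'M[R]_(p, q)) : R := \tr (A^T *m A).

Definition qform n (N : 'M[R]_n) (y : 'cV[R]_n) : R := \tr (y^T *m N *m y).

Lemma fro2E p q (A : 'M[R]_(p, q)) : fro2 A = \sum_i \sum_j A i j ^+ 2.
Proof.
rewrite /fro2 /mxtrace exchange_big/=; apply: eq_bigr => j _.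
by rewrite mxE; apply: eq_bigr => i _; rewrite mxE expr2.
Qed.

Lemma fro2_ge0 p q (A : 'M[R]_(p, q)) : 0 <= fro2 A.
Proof. by rewrite fro2E; do 2!apply: sumr_ge0 => ? _; exact: sqr_ge0. Qed.

Lemma fro2_eq0 p q (A : 'M[R]_(p, q)) : (fro2 A == 0) = (A == 0).
Proof.
apply/idP/eqP => [|->]; last by rewrite /fro2 mulmx0 mxtrace0.
rewrite fro2E psumr_eq0; last by move=> i _; apply: sumr_ge0 => ? _; exact: sqr_ge0.
move=> /allP h; apply/matrixP => i j; rewrite mxE.
have := h i (mem_index_enum _); rewrite psumr_eq0/=; last by move=> ? _; exact: sqr_ge0.
by move=> /allP /(_ j (mem_index_enum _)) /=; rewrite sqrf_eq0 => /eqP.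
Qed.

Lemma fro2_tr p q (A : 'M[R]_(p, q)) : fro2 A^T = fro2 A.
Proof. by rewrite /fro2 trmxK mxtrace_mulC. Qed.

Lemma qformE n (N : 'M[R]_n) y :
  qform N y = \sum_i \sum_j N i j * (y i 0 * y j 0).
Proof.
rewrite /qform /mxtrace big_ord1 -mulmxA mxE; apply: eq_bigr => i _.
rewrite !mxE mulr_sumr; apply: eq_bigr => j _.
by rewrite mulrCA.
Qed.

Lemma qform1 n (y : 'cV[R]_n) : qform 1%:M y = fro2 y.
Proof. by rewrite /qform mulmx1. Qed.

Lemma qformD n (M N : 'M[R]_n) y : qform (M + N) y = qform M y + qform N y.
Proof. by rewrite /qform mulmxDr mulmxDl mxtraceD. Qed.

Lemma qformN n (N : 'M[R]_n) y : qform (- N) y = - qform N y.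
Proof. by rewrite /qform mulmxN mulNmx raddfN. Qed.

Lemma qformZ n a (N : 'M[R]_n) y : qform (a *: N) y = a * qform N y.
Proof. by rewrite /qform -scalemxAr -scalemxAl mxtraceZ. Qed.

Lemma qform_tr n (N : 'M[R]_n) y : qform N^T y = qform N y.
Proof.
by rewrite /qform -[RHS]mxtrace_tr; congr (\tr _); rewrite !trmx_mul trmxK mulmxA.
Qed.

Lemma qform_gram p n (N : 'M[R]_(p, n)) y : qform (N^T *m N) y = fro2 (N *m y).
Proof. by rewrite /qform /fro2 trmx_mul !mulmxA. Qed.

Lemma qform_sandwich p n (S : 'M[R]_p) (N : 'M[R]_(p, n)) y :
  qform (N^T *m S *m N) y = qform S (N *m y).
Proof. by rewrite /qform trmx_mul !mulmxA. Qed.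

Lemma qform_block p q A B C D (x : 'cV[R]_p) (y : 'cV[R]_q) :
  qform (block_mx A B C D) (col_mx x y) =
  qform A x + \tr (x^T *m B *m y) + (\tr (y^T *m C *m x) + qform D y).
Proof.
rewrite /qform tr_col_mx -!mulmxA mul_block_col mul_row_col !mxtraceD.
by rewrite !mulmxDr !mxtraceD.
Qed.

Lemma fro2_col_mx p q r (A : 'M[R]_(p, r)) (B : 'M[R]_(q, r)) :
  fro2 (col_mx A B) = fro2 A + fro2 B.
Proof. by rewrite /fro2 tr_col_mx mul_row_col mxtraceD. Qed.

Definition mdot p q (A B : 'M[R]_(p, q)) : R := \tr (A^T *m B).

Lemma mxtraceB n (A B : 'M[R]_n) : \tr (A - B) = \tr A - \tr B.
Proof. by rewrite mxtraceD raddfN. Qed.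

Lemma mdotC p q (A B : 'M[R]_(p, q)) : mdot A B = mdot B A.
Proof. by rewrite /mdot -mxtrace_tr trmx_mul trmxK. Qed.

Lemma mdotDr p q (A B C : 'M[R]_(p, q)) : mdot A (B + C) = mdot A B + mdot A C.
Proof. by rewrite /mdot mulmxDr mxtraceD. Qed.

Lemma mdotNr p q (A B : 'M[R]_(p, q)) : mdot A (- B) = - mdot A B.
Proof. by rewrite /mdot mulmxN raddfN. Qed.

Lemma mdotZr p q a (A B : 'M[R]_(p, q)) : mdot A (a *: B) = a * mdot A B.
Proof. by rewrite /mdot -scalemxAr mxtraceZ. Qed.

Lemma mdotE p q (A B : 'M[R]_(p, q)) : mdot A B = \sum_i \sum_j A i j * B i j.
Proof.
rewrite /mdot /mxtrace exchange_big/=; apply: eq_bigr => j _.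
by rewrite mxE; apply: eq_bigr => i _; rewrite mxE.
Qed.

Lemma fro2D p q (A B : 'M[R]_(p, q)) :
  fro2 (A + B) = fro2 A + fro2 B + 2 * mdot A B.
Proof.
rewrite /fro2 -/(mdot (A + B) (A + B)) mdotDr !(mdotC (A + B)) !mdotDr.
by rewrite (mdotC B A) /mdot; ring.
Qed.

Lemma fro2Z p q a (A : 'M[R]_(p, q)) : fro2 (a *: A) = a ^+ 2 * fro2 A.
Proof.
rewrite !fro2E mulr_sumr; apply: eq_bigr => i _; rewrite mulr_sumr.
by apply: eq_bigr => j _; rewrite mxE exprMn.
Qed.

Lemma fro2N p q (A : 'M[R]_(p, q)) : fro2 (- A) = fro2 A.
Proof. by rewrite -scaleN1r fro2Z sqrrN expr1n mul1r. Qed.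

Lemma mxtrace_sandwich p n (S : 'M[R]_p) (W : 'M[R]_(p, n)) :
  \tr (W^T *m S *m W) = \sum_i qform S (col i W).
Proof.
rewrite /mxtrace; apply: eq_bigr => i _.
rewrite /qform /mxtrace big_ord1 !mxE; apply: eq_bigr => j _.
rewrite !mxE; congr (_ * _); apply: eq_bigr => k _; by rewrite !mxE.
Qed.

Lemma fro2_mulmx_cols p q r (A : 'M[R]_(p, q)) (B : 'M[R]_(q, r)) :
  fro2 (A *m B) = \sum_i fro2 (A *m col i B).
Proof.
rewrite -(eq_bigr _ (fun i _ => qform_gram A (col i B))) -mxtrace_sandwich.
by rewrite /fro2 trmx_mul !mulmxA.
Qed.

Lemma fro2_cols q r (B : 'M[R]_(q, r)) : fro2 B = \sum_i fro2 (col i B).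
Proof.
by rewrite -{1}[B]mul1mx fro2_mulmx_cols; apply: eq_bigr => i _; rewrite mul1mx.
Qed.

Lemma posdef_unitmx n (S : 'M[R]_n) :
  (forall y, y != 0 -> 0 < qform S y) -> S \in unitmx.
Proof.
move=> Spos; rewrite -row_free_unit -kermx_eq0; apply/rowV0P => u /sub_kermxP uS.
apply/eqP; apply: contraT => u0; have := Spos u^T.
rewrite -(inj_eq trmx_inj) trmxK trmx0 => /(_ u0).
by rewrite /qform trmxK uS mul0mx mxtrace0 ltxx.
Qed.

End quadratic_forms.

(** The one-dimensional determinant bound, from 1 + t <= e^t. It turns the normalizing factor of
    each one-dimensional Gaussian integral into an exponential of a trace term. *)
Lemma sqrt_le_expR (R : realType) (x : R) : Num.sqrt x <= expR ((x - 1) / 2).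
Proof.
rewrite -[leRHS]ger0_norm ?expR_ge0// -sqrtr_sqr ler_wsqrtr// -expRM_natl.
have -> : 2%:R * ((x - 1) / 2) = x - 1 :> R by field.
by apply: le_trans (expR_ge1Dx _); lra.
Qed.

(** * Exponential moments of Gaussian quadratic and bilinear forms *)

Section gaussian_quadratic.
Context {d : measure_display} {Omega : measurableType d} {R : realType}.
Variable P : probability Omega R.
Notation gamma := (@normal_prob R 0 1).

Definition colv n (xi : 'I_n -> Omega -> R) (w : Omega) : 'cV[R]_n :=
  \col_i xi i w.

Lemma measurable_qform d' (O : measurableType d') n (N : 'M[R]_n)
    (xi : 'I_n -> O -> R) : (forall i, measurable_fun setT (xi i)) ->
  measurable_fun setT (fun w => qform N (\col_i xi i w)).
Proof.
move=> mxi; under eq_fun do rewrite qformE.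
apply: measurable_sum => i; apply: measurable_sum => j.
apply: measurable_funM => //; under eq_fun do rewrite !mxE.
exact: measurable_funM.
Qed.

(* The determinant bound behind this is [ln det S^-1 <= tr S^-1 - n]; each
   integration step replaces [S] by a Schur complement. *)
Lemma gaussian_quadratic_integral n (xi : 'I_n -> Omega -> R)
    (S V : 'M[R]_n) : iid_normal P xi ->
  S^T = S -> (forall y, y != 0 -> 0 < qform S y) -> S *m V = 1%:M ->
  (\int[P]_w (expR (- (qform S (colv xi w) - fro2 (colv xi w)) / 2))%:E
   <= (expR ((\tr V - n%:R) / 2))%:E)%E.
Proof.
elim: n xi S V => [|n IH] xi S V hxi Ssym Spos SV.
  under eq_integral do rewrite qformE fro2E !big_ord0 subr0 oppr0 mul0r expR0.
  rewrite integral_cst//= (probability_setT P) /mxtrace big_ord0 subr0 mul0r.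
  by rewrite expR0 mule1.
pose S1 : 'M[R]_(1 + n) := S; pose V1 : 'M[R]_(1 + n) := V.
pose a := S ord0 ord0.
pose b : 'cV[R]_n := dlsubmx S1.
pose S' := drsubmx S1.
have Sa : ulsubmx S1 = a%:M.
  by apply/matrixP => i j; rewrite !mxE !ord1 mulr1n; congr (S _ _); exact: val_inj.
have Sb : ursubmx S1 = b^T by rewrite /b trmx_dlsub /S1 Ssym.
have SE : S1 = block_mx a%:M b^T b S' by rewrite -Sa -Sb submxK.
have S'sym : S'^T = S' by rewrite /S' trmx_drsub /S1 Ssym.
have aE : a = qform S (delta_mx ord0 ord0).
  rewrite qformE (bigD1 ord0)//= (bigD1 ord0)//= !mxE !eqxx !mulr1 !big1 ?addr0//.
    by move=> i i0; rewrite big1// => j _; rewrite !mxE (negbTE i0) mul0r mulr0.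
  by move=> j j0; rewrite !mxE (negbTE j0) !mulr0.
have a0 : 0 < a.
  rewrite aE; apply: Spos; apply/eqP => /matrixP /(_ ord0 ord0).
  by rewrite !mxE !eqxx => /eqP; rewrite oner_eq0.
have qS (z : R) (y : 'cV[R]_n) : qform S (col_mx z%:M y : 'cV_(1 + n)) =
    a * z ^+ 2 + z * \tr (b^T *m y) *+ 2 + qform S' y.
  transitivity (@qform R (1 + n) S1 (col_mx z%:M y)); first by [].
  rewrite SE qform_block tr_scalar_mx mul_scalar_mx -scalemxAl mxtraceZ.
  rewrite mul_mx_scalar mxtraceZ; have -> : \tr (y^T *m b) = \tr (b^T *m y).
    by rewrite -mxtrace_tr trmx_mul trmxK.
  rewrite {1}/qform tr_scalar_mx -!scalar_mxM mxtrace_scalar.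
  by rewrite !mulr1n mulr2n; ring.
pose Sc := S' - a^-1 *: (b *m b^T).
have tr11 (u : 'M[R]_1) : u = (\tr u)%:M by rewrite [LHS]mx11_scalar /mxtrace big_ord1.
have qbb y : qform (b *m b^T) y = (\tr (b^T *m y)) ^+ 2.
  rewrite -[X in X *m _]trmxK qform_gram /fro2 {1}(tr11 (b^T *m y)).
  by rewrite tr_scalar_mx mul_scalar_mx mxtraceZ expr2.
have qSc y : qform Sc y = qform S' y - a^-1 * (\tr (b^T *m y)) ^+ 2.
  by rewrite /Sc qformD qformN qformZ qbb.
have Scsym : Sc^T = Sc.
  by rewrite /Sc linearB/= linearZ/= trmx_mul trmxK S'sym.
(* The head coordinate - a^-1 b^T y minimizes the form of [S] for a given tail; the minimum is the
   form of the Schur complement. *)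
have Scpos y : y != 0 -> 0 < qform Sc y.
  move=> y0; have := qS (- a^-1 * \tr (b^T *m y)) y.
  have : col_mx (- a^-1 * \tr (b^T *m y))%:M y != 0 :> 'cV_(1 + n).
    by rewrite col_mx_eq0 negb_and y0 orbT.
  move=> /Spos h E; rewrite E in h; rewrite qSc; move: h; congr (0 < _).
  by field; rewrite gt_eqF.
have VE : V1 = block_mx (ulsubmx V1) (ursubmx V1) (dlsubmx V1) (drsubmx V1).
  by rewrite submxK.
set al := ulsubmx V1 in VE; set ga := ursubmx V1 in VE.
set be := dlsubmx V1 in VE; set V' := drsubmx V1 in VE.
have : S1 *m V1 = 1%:M := SV.
rewrite SE VE mulmx_block scalar_mx_block => /eq_block_mx[e1 e2 e3 e4].
have : V1 *m S1 = 1%:M := mulmx1C SV.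
rewrite SE VE mulmx_block scalar_mx_block => /eq_block_mx[_ _ f3 _].
rewrite !mul_scalar_mx in e1 e2; rewrite mul_mx_scalar in f3.
have gaE : ga = - a^-1 *: (b^T *m V').
  move/eqP: e2; rewrite addr_eq0 => /eqP /(congr1 (fun M => a^-1 *: M)).
  by rewrite scalerA mulVf ?gt_eqF// scale1r scalerN scaleNr.
have beE : be = - a^-1 *: (V' *m b).
  move/eqP: f3; rewrite addr_eq0 => /eqP /(congr1 (fun M => a^-1 *: M)).
  by rewrite scalerA mulVf ?gt_eqF// scale1r scalerN scaleNr.
have ScV' : Sc *m V' = 1%:M.
  rewrite -e4 gaE /Sc mulmxBl -scalemxAr -scalemxAl mulmxA scaleNr.
  by rewrite addrC.
(* [V'] inverts the Schur complement, and the corner of [V] is a^-1 + a^-2 b^T V' b with a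
   nonnegative second term. Traces of inverses thus add up in the direction the induction needs. *)
have trV : a^-1 + \tr V' <= \tr V.
  have -> : \tr V = \tr al + \tr V'.
    transitivity (@mxtrace R (1 + n) V1); first by [].
    by rewrite VE mxtrace_block.
  rewrite lerD2r.
  have -> : \tr al = a^-1 + a^-1 ^+ 2 * \tr (b^T *m V' *m b).
    have an0 : a != 0 by rewrite gt_eqF.
    apply: (mulfI an0); move: e1 => /(congr1 mxtrace).
    rewrite mxtraceD mxtraceZ mxtrace1 beE -scalemxAr mxtraceZ mulmxA mulNr.
    by move=> /eqP; rewrite subr_eq => /eqP ->; field.
  rewrite lerDl mulr_ge0 ?sqr_ge0//.
  have -> : \tr (b^T *m V' *m b) = qform Sc (V' *m b).
    rewrite /qform trmx_mul -!mulmxA (mulmxA Sc) ScV' mul1mx.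
    by rewrite -[RHS]mxtrace_tr !trmx_mul !trmxK mulmxA.
  have [->|/Scpos/ltW//] := eqVneq (V' *m b) 0.
  by rewrite /qform mulmx0 mxtrace0.
pose tl i := xi (lift ord0 i).
have colE w : colv xi w = col_mx (xi ord0 w)%:M (colv tl w) :> 'cV_(1 + n).
  apply/colP => i; rewrite !mxE; case: splitP => j.
    by rewrite ord1 !mxE mulr1n => i0; congr (xi _ _); apply: val_inj; exact: i0.
  by move=> ij; rewrite !mxE; congr (xi _ _); apply: val_inj; exact: ij.
pose Y w := \tr (b^T *m colv tl w).
have fro2c (z : R) (y : 'cV[R]_n) : fro2 (col_mx z%:M y : 'cV_(1 + n)) = z ^+ 2 + fro2 y.
  transitivity (@fro2 R (1 + n) 1 (col_mx z%:M y)); first by [].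
  by rewrite fro2_col_mx {1}/fro2 tr_scalar_mx -scalar_mxM mxtrace_scalar mulr1n expr2.
pose G w := - (qform S' (colv tl w) - fro2 (colv tl w)) / 2.
pose f (z : measurableTypeR R * g_sigma_algebraType (cylinders tl)) :=
  (expR (- (a - 1) / 2 * z.1 ^+ 2 - z.1 * Y z.2) * expR (G z.2))%:E.
have mtl i : measurable_fun setT (tl i : g_sigma_algebraType (cylinders tl) -> R).
  exact: measurable_coord.
have mY : measurable_fun setT (Y : g_sigma_algebraType (cylinders tl) -> R).
  rewrite /Y /mxtrace; under eq_fun do rewrite big_ord1 mxE.
  apply: measurable_sum => i; under eq_fun do rewrite [colv _ _ _ _]mxE.
  exact: measurable_funM.
have mG : measurable_fun setT (G : g_sigma_algebraType (cylinders tl) -> R).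
  apply: measurable_funM => //; apply: measurableT_comp => //.
  apply: measurable_funB; first exact: measurable_qform.
  by under eq_fun do rewrite -qform1; exact: measurable_qform.
have fE w : (expR (- (qform S (colv xi w) - fro2 (colv xi w)) / 2))%:E
    = f (xi ord0 w, w).
  rewrite colE qS fro2c /f /G /Y/= -expRD; congr (expR _)%:E.
  by rewrite mulr2n; field.
under eq_integral do rewrite fE.
rewrite (integrate_head hxi); last 2 first.
- apply/measurable_EFinP; apply: measurable_funM.
    apply: measurableT_comp => //; apply: measurable_funB.
      by apply: measurable_funM => //; apply: measurable_funX; exact: measurable_fst.
    apply: measurable_funM; first exact: measurable_fst.
    by apply: (measurableT_comp mY); exact: measurable_snd.
  apply: measurableT_comp => //.
  by apply: (measurableT_comp mG); exact: measurable_snd.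
- by move=> z; rewrite lee_fin mulr_ge0 ?expR_ge0.
(* The square completed in the head coordinate leaves a^-1 (b^T y)^2 / 2 in the exponent, which is
   what turns [S'] into [Sc]. *)
have inner w : (\int[gamma]_z f (z, w) = (Num.sqrt a^-1)%:E *
    (expR (- (qform Sc (colv tl w) - fro2 (colv tl w)) / 2))%:E)%E.
  rewrite /f/=; under eq_integral do rewrite EFinM.
  rewrite ge0_integralZr//; last first.
  - apply/measurable_EFinP; apply: measurableT_comp => //.
    by apply: measurable_funB; apply: measurable_funM => //; exact: measurable_funX.
  rewrite normal_exp_quadratic// -!EFinM; congr EFin.
  rewrite -mulrA -expRD; congr (_ * expR _); rewrite qSc /G /Y; field.
  by rewrite gt_eqF.
under eq_integral do rewrite inner.
rewrite ge0_integralZl//; last first.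
- apply/measurable_EFinP; apply: measurableT_comp => //.
  have mxi i : measurable_fun setT (tl i) by case: hxi => h _ _; exact: h.
  apply: measurable_funM => //; apply: measurableT_comp => //.
  apply: measurable_funB; first exact: measurable_qform.
  by under eq_fun do rewrite -qform1; exact: measurable_qform.
have := IH tl Sc V' (iid_normal_tail hxi) Scsym Scpos ScV'.
move=> /(lee_wpmul2l _) => /(_ (Num.sqrt a^-1)%:E).
rewrite lee_fin sqrtr_ge0 => /(_ isT) /le_trans; apply.
rewrite -EFinM lee_fin.
apply: (le_trans (ler_wpM2r (expR_ge0 _) (sqrt_le_expR _))).
rewrite -expRD ler_expR -mulrDl ler_pM2r ?invr_gt0//.
by rewrite -natr1; lra.
Qed.

(** The exponent equals -(y^T S y - |y|^2) / 2 with S = (1 + Z^T Z) / 2 and Z = 1 - 2 N. This [S] is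
    positive definite whatever [N] is, so no smallness of [N] is required, in contrast with
    [gaussian_bilinear_mgf]. *)
Lemma gaussian_bilinear_self_normalized n (xi : 'I_n -> Omega -> R)
    (N : 'M[R]_n) : iid_normal P xi ->
  (\int[P]_w (expR (qform N (colv xi w) - fro2 (N *m colv xi w)))%:E
   <= (expR (\tr N + fro2 N))%:E)%E.
Proof.
move=> hxi.
pose Z : 'M[R]_n := 1%:M - 2 *: N.
pose S : 'M[R]_n := 2^-1 *: (1%:M + Z^T *m Z).
have Ssym : S^T = S by rewrite /S linearZ/= linearD/= trmx1 trmx_mul trmxK.
have qS y : qform S y = (fro2 y + fro2 (Z *m y)) / 2.
  by rewrite /S qformZ qformD qform1 qform_gram mulrC.
have Spos y : y != 0 -> 0 < qform S y.
  rewrite -fro2_eq0 qS => y0; rewrite divr_gt0// ltr_wpDr ?fro2_ge0//.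
  by rewrite lt_neqAle eq_sym y0 fro2_ge0.
have Su := posdef_unitmx Spos.
have SV := mulmxV Su; set V := invmx S in SV.
have VS := mulVmx Su; rewrite -/V in VS.
have Vsym : V^T = V by rewrite /V trmx_inv Ssym.
have ZZ : Z^T *m Z = 2 *: S - 1%:M.
  by rewrite /S scalerA mulfV ?pnatr_eq0// scale1r addrAC subrr add0r.
have trZ : \tr Z = n%:R - 2 * \tr N by rewrite linearB/= mxtrace1 mxtraceZ.
have trS : \tr S = n%:R - 2 * \tr N + 2 * fro2 N.
  have : fro2 Z = n%:R - 4 * \tr N + 4 * fro2 N.
    rewrite /Z -scaleNr fro2D fro2Z mdotZr {1}/fro2 /mdot trmx1 !mul1mx mxtrace1.
    by ring.
  rewrite /fro2 ZZ linearB/= mxtraceZ mxtrace1 => h; lra.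
(* [|Z S^(-1/2) - S^(1/2)|^2 >= 0], written without square roots *)
have key : \tr V <= n%:R + 2 * \tr N + 2 * fro2 N.
  have : 0 <= \tr ((Z - S) *m V *m (Z - S)^T).
    pose W := V *m (Z - S)^T.
    have -> : (Z - S) *m V *m (Z - S)^T = W^T *m S *m W.
      by rewrite /W trmx_mul trmxK Vsym -!mulmxA (mulmxA S) SV mul1mx.
    rewrite mxtrace_sandwich; apply: sumr_ge0 => i _.
    have [->|/Spos/ltW//] := eqVneq (col i W) 0.
    by rewrite /qform mulmx0 mxtrace0.
  have -> : (Z - S) *m V *m (Z - S)^T = Z *m V *m Z^T - Z - (Z^T - S).
    have -> : (Z - S)^T = Z^T - S by rewrite raddfB/= Ssym.
    by rewrite mulmxBl SV mulmxBl mul1mx mulmxBr -(mulmxA Z V S) VS mulmx1.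
  have -> : \tr (Z *m V *m Z^T - Z - (Z^T - S))
      = \tr (Z *m V *m Z^T) - \tr Z - (\tr Z - \tr S).
    by rewrite (mxtraceB _ (Z^T - S)) (mxtraceB _ Z) (mxtraceB Z^T) mxtrace_tr.
  have -> : \tr (Z *m V *m Z^T) = 2 * n%:R - \tr V.
    rewrite mxtrace_mulC mulmxA ZZ mulmxBl -scalemxAl SV mul1mx.
    by rewrite mxtraceB mxtraceZ mxtrace1.
  by rewrite trZ trS; lra.
apply: (le_trans _ (_ : (expR ((\tr V - n%:R) / 2))%:E <= _)%E); last first.
  by rewrite lee_fin ler_expR; lra.
apply: le_trans (gaussian_quadratic_integral hxi Ssym Spos SV).
have fZ y : fro2 (Z *m y) = fro2 y - 4 * qform N y + 4 * fro2 (N *m y).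
  rewrite /Z mulmxBl mul1mx -scalemxAl -scaleNr fro2D fro2Z mdotZr.
  by rewrite /qform /mdot mulmxA; ring.
under eq_integral => w _.
  rewrite (_ : _ - _ = - (qform S (colv xi w) - fro2 (colv xi w)) / 2); last first.
    by rewrite qS fZ; field.
  over.
by [].
Qed.

(** Smallness of [N] gives S = 1 - (N + N^T) >= 1/2, hence an inverse of norm at most 2. This
    version serves single bilinear forms, where no supremum has to be absorbed. *)
Lemma gaussian_bilinear_mgf n (xi : 'I_n -> Omega -> R) (N : 'M[R]_n) :
  iid_normal P xi -> (forall y, 4 * `|qform N y| <= fro2 y) ->
  (\int[P]_w (expR (qform N (colv xi w)))%:E
   <= (expR (\tr N + 4 * fro2 N))%:E)%E.
Proof.
move=> hxi Nsmall.
pose M : 'M[R]_n := N + N^T.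
have qM y : qform M y = 2 * qform N y by rewrite qformD qform_tr mulr_natl mulr2n.
pose S : 'M[R]_n := 1%:M - M.
have Msym : M^T = M by rewrite /M linearD/= trmxK addrC.
have Ssym : S^T = S by rewrite /S linearB/= trmx1 Msym.
have qS y : qform S y = fro2 y - 2 * qform N y.
  by rewrite /S qformD qformN qform1 qM.
have qSge y : fro2 y / 2 <= qform S y.
  by rewrite qS; have := Nsmall y; have := ler_norm (qform N y); lra.
have Spos y : y != 0 -> 0 < qform S y.
  rewrite -fro2_eq0 => y0; apply: lt_le_trans (qSge y); rewrite divr_gt0//.
  by rewrite lt_neqAle eq_sym y0 fro2_ge0.
have Su := posdef_unitmx Spos.
have SV := mulmxV Su; set V := invmx S in SV.
have VS := mulVmx Su; rewrite -/V in VS.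
have Vsym : V^T = V by rewrite /V trmx_inv Ssym.
(* A Neumann expansion stopped at second order with exact remainder: the linear term yields the mean
   2 tr N, the remainder is bounded through [qV]. *)
have VE : V = 1%:M + M + M *m V *m M.
  have E1 : V = 1%:M + V *m M.
    by rewrite -{1}VS /S mulmxBr mulmx1 subrK.
  have E2 : V = 1%:M + M *m V.
    by rewrite -{1}SV /S mulmxBl mul1mx subrK.
  transitivity (1%:M + V *m M); first exact: E1.
  by rewrite {1}E2 mulmxDl mul1mx addrA.
have qV z : qform V z <= 2 * fro2 z.
  pose y := V *m z.
  have yE : qform S y = qform V z.
    by rewrite /y -qform_sandwich Vsym -mulmxA SV mulmx1.
  have yz : mdot y z = qform V z by rewrite /mdot /y trmx_mul Vsym.
  have := fro2_ge0 (y + (- 2) *: z); rewrite fro2D fro2Z mdotZr yz.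
  by have := qSge y; rewrite yE; lra.
apply: (le_trans _ (_ : (expR ((\tr V - n%:R) / 2))%:E <= _)%E); last first.
  rewrite lee_fin ler_expR VE !mxtraceD mxtrace1 mxtrace_tr.
  have : \tr (M *m V *m M) <= 2 * fro2 M.
    rewrite -{1}Msym mxtrace_sandwich fro2_cols mulr_sumr.
    by apply: ler_sum => i _; exact: qV.
  have : fro2 M <= 4 * fro2 N.
    have := fro2_ge0 (N - N^T); rewrite /M !fro2D fro2N fro2_tr mdotNr; lra.
  lra.
apply: le_trans (gaussian_quadratic_integral hxi Ssym Spos SV).
under eq_integral => w _.
  rewrite (_ : qform N _ = - (qform S (colv xi w) - fro2 (colv xi w)) / 2); last first.
    by rewrite qS; field.
  over.
by [].
Qed.

End gaussian_quadratic.

(** * Exceptional events *)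

Section exceptional_events.
Context {d : measure_display} {Omega : measurableType d} {R : realType}.
Variable P : probability Omega R.

(** Bounding the complement makes failure probabilities additive. The measurable [F] inside [Q]
    allows properties quantified over uncountably many points, such as those from chaining. *)
Definition fails_with (p : R) (Q : Omega -> Prop) : Prop :=
  exists F : set Omega,
    [/\ measurable F, F `<=` [set w | Q w] & (P (~` F) <= p%:E)%E].

Lemma fails_with_prob_ge p Q : fails_with p Q -> prob_ge P (1 - p) Q.
Proof.
move=> [F [mF FQ PF]]; exists F; split => //.
have : (P F = 1 - P (~` F))%E.
  by rewrite -[in LHS](setCK F) probability_setC//; exact: measurableC.
move=> ->; rewrite EFinB; apply: leeB => //.
Qed.

Lemma fails_with_le p q Q Q' : p <= q -> (forall w, Q w -> Q' w) ->
  fails_with p Q -> fails_with q Q'.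
Proof.
move=> pq QQ' [F [mF FQ PF]]; exists F; split => //.
  by move=> w /FQ /QQ'.
by apply: le_trans PF _; rewrite lee_fin.
Qed.

(** Countable subadditivity. The levels of a chain form an infinite family, and bounding the partial
    sums spares any discussion of a series. *)
Lemma fails_with_forall (p : nat -> R) (a : R) (Q : nat -> Omega -> Prop) :
  (forall n, fails_with (p n) (Q n)) ->
  (forall n, \sum_(i < n) p i <= a) ->
  fails_with a (fun w => forall n, Q n w).
Proof.
move=> h pa; have /choice[F hF] : forall n, exists F : set Omega,
    [/\ measurable F, F `<=` [set w | Q n w] & (P (~` F) <= (p n)%:E)%E] by [].
exists (\bigcap_n F n); split.
- by apply: bigcap_measurableType => n _; have [] := hF n.
- by move=> w wF n; have [_ FQ _] := hF n; apply: FQ; exact: wF.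
rewrite setC_bigcap.
have mFc n : measurable (~` F n) by apply: measurableC; have [] := hF n.
apply: (le_trans (@measure_sigma_subadditive _ _ _ P _ _ mFc
  (bigcupT_measurable _ mFc) (@subset_refl _ _))).
apply: lime_le; first exact: is_cvg_ereal_nneg_natsum.
apply: nearW => n; apply: (@le_trans _ _ (\sum_(i < n) (p i)%:E)%E).
  by rewrite big_mkord; apply: lee_sum => i _; have [] := hF i.
by rewrite sumEFin lee_fin.
Qed.

Lemma fails_with_forall_fin (I : finType) (p : I -> R) (Q : I -> Omega -> Prop) :
  (forall i, fails_with (p i) (Q i)) ->
  fails_with (\sum_i p i) (fun w => forall i, Q i w).
Proof.
move=> h; have p0 i : 0 <= p i.
  have [F [_ _ PF]] := h i; rewrite -lee_fin; apply: le_trans PF.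
  exact: measure_ge0.
(* The finite family is continued to all of [nat] by the sure event, with failure probability 0. *)
pose T n w := if (insub n : option 'I_#|I|) is Some j then Q (enum_val j) w else True.
pose q n := if (insub n : option 'I_#|I|) is Some j then p (enum_val j) else 0.
have qT n : fails_with (q n) (T n).
  rewrite /q /T; case: insubP => [j _ _|_]; first exact: h.
  by exists setT; split => //; rewrite setCT measure0.
have /(fails_with_forall qT) : forall n, \sum_(i < n) q i <= \sum_i p i.
  move=> n; have q0 i : 0 <= q i by rewrite /q; case: insubP.
  have qE : \sum_(i < #|I|) q i = \sum_i p i.
    rewrite [RHS](reindex_onto (enum_val) (enum_rank)) /=; last first.
      by move=> i _; rewrite enum_rankK.
    rewrite [RHS](eq_bigl xpredT); last by move=> i; rewrite enum_valK eqxx.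
    by apply: eq_bigr => i _; rewrite /q valK.
  have [nI|/ltnW nI] := leqP n #|I|.
    by rewrite -qE -!(big_mkord xpredT q) [leRHS](big_cat_nat (leq0n n) nI)//= lerDl sumr_ge0.
  rewrite -qE -!(big_mkord xpredT q) [leLHS](big_cat_nat (leq0n _) nI)//=.
  rewrite gerDl big_nat_cond big1// => i.
  rewrite andbT => /andP[+ _]; rewrite leqNgt => /negbTE iI.
  by rewrite /q; case: insubP => // j; rewrite iI.
apply: fails_with_le => // w hw i; have := hw (enum_rank i).
by rewrite /T valK enum_rankK.
Qed.

Lemma fails_with_and p q Q Q' : fails_with p Q -> fails_with q Q' ->
  fails_with (p + q) (fun w => Q w /\ Q' w).
Proof.
move=> h h'; have : forall b : bool, fails_with (if b then p else q)
    (fun w => if b then Q w else Q' w) by case.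
move=> /(@fails_with_forall_fin bool) /=.
apply: fails_with_le; first by rewrite big_bool.
by move=> w hw; split; [exact: (hw true)|exact: (hw false)].
Qed.

Lemma fails_with_exp (f : Omega -> R) (c : R) : measurable_fun setT f ->
  (\int[P]_w (expR (f w))%:E <= 1)%E ->
  fails_with (expR (- c)) (fun w => f w <= c).
Proof.
move=> mf intf; pose G := [set w | f w <= c]; exists G.
have mF : measurable G.
  by rewrite -[X in measurable X]setTI; exact: measurable_fun_le.
split => //; have mFc := measurableC mF.
have : (\int[P]_(w in ~` G) (expR c)%:E <= 1)%E.
  apply: le_trans intf.
  have mef : measurable_fun setT (fun w => (expR (f w))%:E).
    by apply/measurable_EFinP; exact: measurableT_comp.
  apply: (@le_trans _ _ (\int[P]_(w in ~` G) (expR (f w))%:E)%E).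
    apply: ge0_le_integral => //.
    - exact: measurable_funTS.
    - move=> w /negP; rewrite -ltNge => /ltW fc.
      by rewrite lee_fin ler_expR.
  exact: ge0_subset_integral.
rewrite integral_cst// => h.
rewrite -(lee_pmul2l (_ : (expR c)%:E \is a fin_num)%E)//; last first.
  by rewrite lte_fin expR_gt0.
by rewrite -EFinM -expRD subrr expR0.
Qed.

End exceptional_events.

(** Independence is used twice, between the vectors and between the coordinates of each. The link is
    that a box is a finite intersection of the sets generating [vector_measurable]. *)
Lemma iid_standard_gaussian_normal (disp : measure_display)
    (Omega : measurableType disp) (R : realType) (P : probability Omega R)
    n (I : finType) (X : I -> Omega -> 'cV[R]_n) :
  iid_standard_gaussian P X ->
  iid_normal P (fun (k : 'I_#|{: I * 'I_n}|) w =>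
    X (enum_val k).1 w (enum_val k).2 ord0).
Proof.
move=> [gX iX]; split.
- by move=> k; have [+ _ _] := gX (enum_val k).1; exact.
- by move=> k A mA; have [_ + _] := gX (enum_val k).1; exact.
move=> B mB.
pose U i : set 'cV[R]_n :=
  [set u | forall j, B (enum_rank (i, j)) (u j ord0)].
have mU i : i \in [set: I]%SET -> vector_measurable (U i).
  move=> _; have -> : U i = \bigcap_(j : 'I_n) [set u : 'cV[R]_n |
      B (enum_rank (i, j)) (u j ord0)].
    by apply/seteqP; split => u /= h j; [move=> _; exact: h|exact: h].
  rewrite /vector_measurable; set G := [set _ | _].
  apply: (@fin_bigcap_measurable _ (g_sigma_algebraType G)) => // j _.
  by apply: sub_sigma_algebra; exists j, (B (enum_rank (i, j))).
have := iX [set: I]%SET U mU.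
have -> : \bigcap_(i in [set` [set: I]%SET]) X i @^-1` U i =
    \bigcap_k ((fun w => X (enum_val k).1 w (enum_val k).2 ord0) @^-1` B k).
  apply/seteqP; split => w /=.
    move=> h k _ /=; have := h (enum_val k).1; rewrite /= inE => /(_ isT).
    by move=> /(_ (enum_val k).2); rewrite -surjective_pairing enum_valK.
  move=> h i _ j /=; have := h (enum_rank (i, j)) Logic.I.
  by rewrite /= enum_rankK.
move=> ->; rewrite (reindex_onto (enum_rank) (enum_val)) /=; last first.
  by move=> k _; rewrite enum_valK.
rewrite [RHS](eq_bigl xpredT); last by move=> i; rewrite enum_rankK eqxx.
rewrite (eq_bigl xpredT); last by move=> i; rewrite inE.
transitivity (\prod_i \prod_j P ((fun w => X i w j ord0) @^-1`
    B (enum_rank (i, j))))%E; last first.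
  by rewrite pair_bigA; apply: eq_bigr => -[i j] _; rewrite enum_rankK.
apply: eq_bigr => i _.
have [_ _ /(_ [set: 'I_n]%SET (fun j => B (enum_rank (i, j))))] := gX i.
rewrite (eq_bigl xpredT); last by move=> j; rewrite inE.
move=> h; transitivity (P (\bigcap_(j in [set` [set: 'I_n]%SET])
    (fun w => X i w j ord0) @^-1` B (enum_rank (i, j)))).
  congr (P _); apply/seteqP; split => w /= hw j; [move=> _; exact: hw|].
  by have := hw j; rewrite /= inE => /(_ isT).
by rewrite h; last by move=> j _; exact: mB.
Qed.

(** * Chaining over an l1 ball *)

Section dyadic_rounding.
Context {R : realType}.

(** At level 0 the mesh exceeds every coordinate of the unit l1 ball, so all of them round to 0. The
    ratio 4 makes the square roots of the meshes a geometric sequence of ratio 1/2. *)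
Definition mesh (n : nat) : R := 2 / 4 ^+ n.

Lemma mesh_gt0 n : 0 < mesh n.
Proof. by rewrite divr_gt0// exprn_gt0. Qed.

Lemma meshS n : mesh n.+1 = mesh n / 4.
Proof. by rewrite /mesh exprS invfM mulrCA mulrC. Qed.

(** The limit along vanishing meshes, as an Archimedean argument based on k < 4^k. *)
Lemma mesh_inv_unbounded (b c x : R) : (forall n, x <= b + c * mesh n) -> x <= b.
Proof.
move=> h; rewrite leNgt; apply/negP => bx.
have c0 : 0 < c.
  rewrite ltNge; apply/negP => c0; have := h 0%N; rewrite leNgt => /negP; apply.
  by apply: le_lt_trans bx; rewrite gerDl mulr_le0_ge0// ltW// mesh_gt0.
pose k := Num.truncn (2 * c / (x - b)).
have xb : 0 < x - b by rewrite subr_gt0.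
have : 2 * c / (x - b) < k.+1%:R by exact: truncnS_gt.
rewrite ltr_pdivrMr// => hk.
have k4 : (k.+1%:R : R) <= 4 ^+ k.+1.
  by rewrite -natrX ler_nat ltnW// ltn_expl.
have := h k.+1; rewrite -lerBlDl leNgt => /negP; apply.
rewrite /mesh mulrA ltr_pdivrMr ?exprn_gt0// mulrC.
by apply: lt_le_trans hk _; rewrite mulrC ler_wpM2l// ltW.
Qed.

Lemma sum_mesh_le M : \sum_(n < M) mesh n <= 8 / 3.
Proof.
have : \sum_(n < M) mesh n <= 8 / 3 - mesh M * (4 / 3).
  elim: M => [|M IH]; first by rewrite big_ord0 /mesh expr0; lra.
  by rewrite big_ord_recr/= meshS; lra.
by have := mesh_gt0 M; lra.
Qed.

(** The weight is the extra exponent of the union bound at level [n] in [level_event]. The induction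
    carries an explicit tail term. *)
Lemma sum_mesh_affine_le M : \sum_(n < M) mesh n * (n.+1%:R + 4) <= 15.
Proof.
have : \sum_(n < M) mesh n * (n.+1%:R + 4) <= 15 - mesh M * (M%:R * (4 / 3) + 37 / 5).
  elim: M => [|M IH]; first by rewrite big_ord0 /mesh expr0; lra.
  rewrite big_ord_recr/= meshS.
  have := mesh_gt0 M; have := ler0n R M; rewrite -[M.+1%:R]natr1.
  move: IH; set S := \sum_(i < M) _; move: S (mesh M) (M%:R) => S x k IH k0 x0.
  by nra.
have : 0 <= mesh M * (M%:R * (4 / 3) + 37 / 5).
  by rewrite mulr_ge0 ?ltW ?mesh_gt0// addr_ge0// mulr_ge0.
lra.
Qed.

(** The initial mesh [e] is kept variable, since peeling off the first level leaves the same sum for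
    [e / 4]. Meshes above [y] contribute y^2 / mesh, meshes below contribute the mesh: two geometric
    series, both dominated by the mesh closest to [y]. *)
Let sum_min_aux M (e y : R) : 0 < e -> 0 <= y ->
  \sum_(n < M) Num.min (y ^+ 2) ((e / 4 ^+ n) ^+ 2) / (e / 4 ^+ n)
  <= if e <= y then 4 / 3 * e else 3 * y - y ^+ 2 / (3 * e).
Proof.
elim: M e => [|M IH] e e0 y0.
  rewrite big_ord0; case: (leP e y) => [ey|ye]; first by rewrite mulr_ge0// ltW.
  rewrite subr_ge0 ler_pdivrMr ?mulr_gt0//.
  have : 0 <= y * (e - y) by rewrite mulr_ge0// subr_ge0 ltW.
  by have := mulr_ge0 y0 (ltW e0); nra.
rewrite big_ord_recl expr0 divr1.
have -> : \sum_(i < M) Num.min (y ^+ 2) ((e / 4 ^+ bump 0 i) ^+ 2) / (e / 4 ^+ bump 0 i)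
   = \sum_(i < M) Num.min (y ^+ 2) ((e / 4 / 4 ^+ i) ^+ 2) / (e / 4 / 4 ^+ i).
  apply: eq_bigr => i _; have -> // : e / 4 ^+ bump 0 i = e / 4 / 4 ^+ i.
  by rewrite /bump leq0n add1n exprS invfM mulrA.
have e4 : 0 < e / 4 by rewrite divr_gt0.
have := IH (e / 4) e4 y0; set X := \sum_(i < M) _ => hX.
have [ye|ey] := ltP y e; last first.
  have -> : Num.min (y ^+ 2) (e ^+ 2) = e ^+ 2.
    by apply/min_idPr; rewrite ler_sqr ?nnegrE// ltW.
  rewrite expr2 mulfK ?gt_eqF//.
  have e4y : e / 4 <= y by lra.
  by rewrite e4y in hX; lra.
have -> : Num.min (y ^+ 2) (e ^+ 2) = y ^+ 2.
  by apply/min_idPl; rewrite ler_sqr ?nnegrE// ltW.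
pose t := y / e; have yE : y = t * e by rewrite /t divfK// gt_eqF.
have t0 : 0 <= t by rewrite /t divr_ge0// ltW.
have t1 : t < 1 by rewrite /t ltr_pdivrMr// mul1r.
have -> : y ^+ 2 / e = t ^+ 2 * e by rewrite yE; field; rewrite gt_eqF.
have -> : y ^+ 2 / (3 * e) = t ^+ 2 * e / 3 by rewrite yE; field; rewrite gt_eqF.
have E4 : y ^+ 2 / (3 * (e / 4)) = t ^+ 2 * e * 4 / 3 by rewrite yE; field; rewrite gt_eqF.
rewrite E4 in hX; move: hX; case: (leP (e / 4) y) => [ey4|ye4] hX; last by rewrite yE in hX *; lra.
have t4 : 1 / 4 <= t by rewrite /t ler_pdivlMr//; lra.
have : 0 <= e * ((t - 1 / 4) * (1 - t)).
  by rewrite mulr_ge0 ?(ltW e0)// mulr_ge0// subr_ge0// ltW.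
have : 0 <= e * t by rewrite mulr_ge0// ltW.
rewrite yE; lra.
Qed.

Lemma sum_min_mesh_le M (y : R) : 0 <= y ->
  \sum_(n < M) Num.min (y ^+ 2) (mesh n ^+ 2) / mesh n <= 3 * y.
Proof.
move=> y0; have := @sum_min_aux M 2 y (ltr0Sn _ 1) y0.
move=> /le_trans; apply; case: (leP 2 y) => h; first lra.
by rewrite gerBl divr_ge0 ?sqr_ge0//.
Qed.

(** The terms vanish while the mesh exceeds [y], and are then at most sqrt (y mesh), which halves
    from one level to the next. *)
Let sum_trunc_aux M (e y : R) : 0 < e -> 0 <= y ->
  \sum_(n < M) (e / 4 ^+ n) * Num.sqrt (Num.truncn (y / (e / 4 ^+ n)))%:R
  <= if e <= y then 2 * Num.sqrt (y * e) else 2 * y.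
Proof.
elim: M e => [|M IH] e e0 y0.
  by rewrite big_ord0; case: ifP => _; rewrite mulr_ge0 ?sqrtr_ge0.
rewrite big_ord_recl expr0 divr1.
have -> : \sum_(i < M) (e / 4 ^+ bump 0 i) * Num.sqrt (Num.truncn (y / (e / 4 ^+ bump 0 i)))%:R
   = \sum_(i < M) (e / 4 / 4 ^+ i) * Num.sqrt (Num.truncn (y / (e / 4 / 4 ^+ i)))%:R.
  apply: eq_bigr => i _; have -> // : e / 4 ^+ bump 0 i = e / 4 / 4 ^+ i.
  by rewrite /bump leq0n add1n exprS invfM mulrA.
have e4 : 0 < e / 4 by rewrite divr_gt0.
have := IH (e / 4) e4 y0; set X := \sum_(i < M) _ => hX.
have sqE : Num.sqrt (y * (e / 4)) = Num.sqrt (y * e) / 2.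
  have -> : y * (e / 4) = (y * e) * 2^-1 ^+ 2 by field.
  by rewrite sqrtrM ?mulr_ge0 ?(ltW e0)// sqrtr_sqr gtr0_norm.
have [ye|ey] := ltP y e.
  have -> : Num.truncn (y / e) = 0%N.
    by apply/truncn0Pn; rewrite -ltNge ltr_pdivrMr// mul1r.
  rewrite sqrtr0 mulr0 add0r; apply: le_trans hX _.
  case: (leP (e / 4) y) => // ey4; rewrite sqE.
  have : Num.sqrt (y * e) <= 2 * y.
    rewrite -[leRHS]ger0_norm ?mulr_ge0// -sqrtr_sqr ler_wsqrtr//.
    by have := ler_wpM2l y0 ey4; lra.
  by lra.
have e4y : e / 4 <= y by lra.
rewrite e4y sqE in hX.
have : e * Num.sqrt (Num.truncn (y / e))%:R <= Num.sqrt (y * e).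
  rewrite -{1}[e]gtr0_norm// -sqrtr_sqr -sqrtrM ?sqr_ge0// ler_wsqrtr//.
  have : (Num.truncn (y / e))%:R <= y / e by rewrite truncn_le divr_ge0// ltW.
  rewrite -(ler_pM2l (_ : 0 < e ^+ 2)) ?exprn_gt0// => /le_trans; apply.
  by rewrite le_eqVlt; apply/orP; left; apply/eqP; field; rewrite gt_eqF.
lra.
Qed.

Lemma sum_trunc_mesh_le M (y : R) : 0 <= y ->
  \sum_(n < M) mesh n * Num.sqrt (Num.truncn (y / mesh n))%:R <= 2 * y.
Proof.
move=> y0; have := @sum_trunc_aux M 2 y (ltr0Sn _ 1) y0.
move=> /le_trans; apply; case: (leP 2 y) => // h.
rewrite ler_pM2l// -[leRHS]ger0_norm// -sqrtr_sqr ler_wsqrtr//.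
by rewrite expr2 ler_wpM2l.
Qed.

(** The sign is recorded only for a nonzero magnitude: the cell of 0 contains both signs and has the
    single code (false, 0). *)
Definition level n (y : R) : bool * nat :=
  let k := Num.truncn (`|y| / mesh n) in ((y < 0) && (0 < k)%N, k).

(** In the cell of 0 both minima are the squares themselves. In any other cell both are the squared
    mesh, which bounds the squared width of the cell. *)
Lemma level_close n (y z : R) : level n y = level n z ->
  (y - z) ^+ 2 <=
  2 * Num.min (y ^+ 2) (mesh n ^+ 2) + 2 * Num.min (z ^+ 2) (mesh n ^+ 2).
Proof.
have m0 := mesh_gt0 n.
have lev (u : R) : let k := (level n u).2 in
    k%:R * mesh n <= `|u| < k.+1%:R * mesh n.
  have := @truncn_itv R (`|u| / mesh n); rewrite divr_ge0 ?(ltW m0)// => /(_ isT).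
  by rewrite ler_pdivlMr// ltr_pdivrMr.
move=> e; have := lev y; have := lev z; rewrite e /=.
set k := Num.truncn (`|z| / mesh n).
have [-> | k0] := posnP k.
  rewrite mul0r !mul1r !normr_ge0/= => zm ym.
  have -> : Num.min (y ^+ 2) (mesh n ^+ 2) = y ^+ 2.
    by apply/min_idPl; rewrite -real_normK ?num_real// ler_sqr ?nnegrE// ltW.
  have -> : Num.min (z ^+ 2) (mesh n ^+ 2) = z ^+ 2.
    by apply/min_idPl; rewrite -real_normK ?num_real// ler_sqr ?nnegrE// ltW.
  by have := sqr_ge0 (y + z); lra.
move=> /andP[zm zM] /andP[ym yM].
have k1 : mesh n <= k%:R * mesh n by rewrite ler_peMl ?(ltW m0)// ler1n.
have -> : Num.min (y ^+ 2) (mesh n ^+ 2) = mesh n ^+ 2.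
  apply/min_idPr; rewrite -[leRHS]real_normK ?num_real// ler_sqr ?nnegrE ?(ltW m0)//.
  exact: le_trans k1 ym.
have -> : Num.min (z ^+ 2) (mesh n ^+ 2) = mesh n ^+ 2.
  apply/min_idPr; rewrite -[leRHS]real_normK ?num_real// ler_sqr ?nnegrE ?(ltW m0)//.
  exact: le_trans k1 zm.
have yz0 : (y < 0) = (z < 0).
  move: e; rewrite /level => -[]; rewrite -/k => + e2; rewrite e2.
  by rewrite -/k k0 !andbT.
have : `|y - z| <= mesh n.
  have : `|y - z| = `| `|y| - `|z| |.
    have [y0|y0] := ltP y 0.
      have z0 : z < 0 by rewrite -yz0.
      rewrite (ltr0_norm y0) (ltr0_norm z0).
      by rewrite [LHS]distrC opprK addrC.
    have z0 : 0 <= z by rewrite leNgt -yz0 -leNgt.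
    by rewrite (ger0_norm y0) (ger0_norm z0).
  move=> ->; rewrite ler_norml; move: yM zM; rewrite -natr1 mulrDl mul1r.
  by move=> yM zM; apply/andP; split; lra.
rewrite -(@ler_sqr _ `|y - z|) ?nnegrE ?(ltW m0)// real_normK ?num_real//.
by move=> /le_trans; apply; have := sqr_ge0 (mesh n); lra.
Qed.

Lemma level_bound n (y : R) : `|y| <= 1 -> ((level n y).2 < (4 ^ n).+1)%N.
Proof.
move=> y1; rewrite ltnS /= -(ler_nat R).
have m0 := mesh_gt0 n.
have : (Num.truncn (`|y| / mesh n))%:R <= `|y| / mesh n.
  by rewrite truncn_le divr_ge0// ltW.
move=> /le_trans; apply; rewrite ler_pdivrMr// natrX /mesh mulrCA divff ?mulr1.
  lra.
by rewrite expf_eq0 pnatr_eq0 andbF.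
Qed.

(* Exponent of a rounded coordinate in the union bound. The square root makes the
   total over an l1 ball, weighted by [mesh], linear in [L] (sum_trunc_mesh_le). *)
Definition level_cost (L : R) (z : bool * nat) : R :=
  L * z.1%:R + 6 * L * Num.sqrt z.2%:R.

Lemma level_cost_le L n y : 0 <= L ->
  level_cost L (level n y) <= 7 * L * Num.sqrt (level n y).2%:R.
Proof.
move=> L0; rewrite /level_cost /=; set k := Num.truncn _.
have : ((y < 0) && (0 < k)%N)%:R <= Num.sqrt (k%:R : R).
  have [->|k0] := posnP k; first by rewrite andbF sqrtr_ge0.
  apply: (@le_trans _ _ 1); first by case: (_ && _).
  by rewrite -{1}sqrtr1 ler_wsqrtr// ler1n.
move=> /(ler_wpM2l L0); lra.
Qed.

(** The origin of the factor 6 in [level_cost]: with q >= 1 the square root, 6 L q >= L + 4 q, and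
    e^(4q) >= (1 + q)^4 dominates q^2 (q^2 + 1), the inverse of the telescoping difference. *)
Let expR_sqrt_nat (L : R) k : 1 <= L ->
  expR (- (6 * L * Num.sqrt k.+1%:R)) <= expR (- L) * (k.+1%:R^-1 - k.+2%:R^-1).
Proof.
move=> L1; set q := Num.sqrt _.
have q1 : 1 <= q by rewrite /q -{1}sqrtr1 ler_wsqrtr// ler1n.
have q2 : q ^+ 2 = k.+1%:R by rewrite sqr_sqrtr.
apply: (@le_trans _ _ (expR (- L) * expR (- (4 * q)))).
  by rewrite -expRD ler_expR; nra.
rewrite ler_pM2l ?expR_gt0// expRN.
have -> : k.+1%:R^-1 - k.+2%:R^-1 = (k.+1%:R * k.+2%:R)^-1 :> R.
  rewrite -(natr1 k.+1); have : (0 : R) < k.+1%:R by [].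
  move: (k.+1%:R : R) => a a0; field.
  by rewrite !gt_eqF// addr_gt0.
rewrite lef_pV2 ?posrE ?expR_gt0 ?mulr_gt0//.
rewrite expRM_natl.
have eq : 1 + q <= expR q by exact: expR_ge1Dx.
have : (1 + q) ^+ 4 <= expR q ^+ 4.
  by rewrite ler_pXn2r ?nnegrE ?expR_ge0// addr_ge0// (le_trans _ q1).
move=> /(le_trans _); apply; rewrite -(natr1 k.+1) -q2.
have q0 : 0 <= q by lra.
have -> : (1 + q) ^+ 4 = (1 + q ^+ 2 + 2 * q) ^+ 2 by ring.
have -> : q ^+ 2 * (q ^+ 2 + 1) = (1 + q ^+ 2) ^+ 2 - (1 + q ^+ 2) by ring.
by have := sqr_ge0 q; nra.
Qed.

(** The code of 0 is free and all the others together weigh at most 2 e^-L + e^-2L, however fine the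
    mesh. One factor of the square comes from the sign, the other from the magnitude. *)
Lemma sum_level_cost_le (L : R) M : 1 <= L ->
  \sum_(z : bool * 'I_M.+1) expR (- level_cost L (z.1, z.2 : nat))
  <= (1 + expR (- L)) ^+ 2.
Proof.
move=> L1.
have -> : \sum_(z : bool * 'I_M.+1) expR (- level_cost L (z.1, z.2 : nat)) =
    (\sum_(b : bool) expR (- (L * b%:R))) *
    (\sum_(k < M.+1) expR (- (6 * L * Num.sqrt (k : nat)%:R))).
  rewrite big_distrlr/= pair_bigA; apply: eq_bigr => -[b k] _.
  by rewrite /level_cost opprD expRD.
rewrite big_bool/= mulr1 mulr0 oppr0 expR0 [X in X * _]addrC expr2.
apply: ler_wpM2l; first by rewrite addr_ge0// expR_ge0.
rewrite big_ord_recl sqrtr0 mulr0 oppr0 expR0 lerD2l.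
apply: (@le_trans _ _ (expR (- L) * \sum_(k < M) (k.+1%:R^-1 - k.+2%:R^-1))).
  rewrite mulr_sumr; apply: ler_sum => k _; exact: expR_sqrt_nat.
have -> : \sum_(k < M) (k.+1%:R^-1 - k.+2%:R^-1) = 1 - M.+1%:R^-1 :> R.
  elim: M => [|M IH]; first by rewrite big_ord0 invr1 subrr.
  by rewrite big_ord_recr/= IH; ring.
by rewrite ger_pMr ?expR_gt0// gerBl invr_ge0.
Qed.

End dyadic_rounding.

Section frobenius_inequalities.
Context {R : realType}.

Lemma mdot_young p q (A B : 'M[R]_(p, q)) t : 0 < t ->
  2 * `|mdot A B| <= t * fro2 A + fro2 B / t.
Proof.
move=> t0; have h (e : R) : e ^+ 2 = 1 -> 2 * (e * mdot A B) <= t * fro2 A + fro2 B / t.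
  move=> e1; have := fro2_ge0 (t *: A + (- e) *: B).
  rewrite fro2D !fro2Z mdotC mdotZr mdotC mdotZr sqrrN e1 mul1r mdotC => H.
  rewrite -subr_ge0 -(pmulr_rge0 _ t0); apply: le_trans H _.
  by rewrite mdotC le_eqVlt; apply/orP; left; apply/eqP; field; rewrite gt_eqF.
case: ger0P => _.
  by have := h 1; rewrite mul1r expr1n; apply.
by have := h (-1); rewrite mulN1r sqrrN expr1n; apply.
Qed.

Lemma fro2D_le p q (A B : 'M[R]_(p, q)) : fro2 (A + B) <= 2 * fro2 A + 2 * fro2 B.
Proof. by have := fro2_ge0 (A - B); rewrite !fro2D fro2N mdotNr; lra. Qed.

Lemma cauchy_schwarz_mdot p q (A B : 'M[R]_(p, q)) :
  mdot A B ^+ 2 <= fro2 A * fro2 B.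
Proof.
have [B0|B0] := eqVneq (fro2 B) 0.
  move/eqP: (B0); rewrite fro2_eq0 => /eqP ->.
  by rewrite /mdot mulmx0 mxtrace0 expr0n/= mulr_ge0 ?fro2_ge0.
have Bp : 0 < fro2 B by rewrite lt_neqAle eq_sym B0 fro2_ge0.
have := fro2_ge0 (fro2 B *: A + (- mdot A B) *: B).
rewrite fro2D !fro2Z mdotZr (mdotC (_ *: A)) mdotZr (mdotC B A) sqrrN => H.
rewrite -subr_ge0 -(pmulr_rge0 _ Bp); apply: le_trans H _.
by rewrite le_eqVlt; apply/orP; left; apply/eqP; ring.
Qed.

(** A matrix and its transpose have the same operator norm: |A^T y|^2 is the inner product of y with
    A A^T y, and Cauchy-Schwarz concludes. *)
Lemma fro2_tr_mulmx_le p q (A : 'M[R]_(p, q)) (e : R) :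
  0 <= e -> (forall z : 'cV_q, fro2 (A *m z) <= e * fro2 z) ->
  forall y : 'cV_p, fro2 (A^T *m y) <= e * fro2 y.
Proof.
move=> e0 h y; pose u := A^T *m y; rewrite -/u.
have [u0|u0] := eqVneq (fro2 u) 0; first by rewrite u0 mulr_ge0 ?fro2_ge0.
have up : 0 < fro2 u by rewrite lt_neqAle eq_sym u0 fro2_ge0.
have uE : fro2 u = mdot y (A *m u) by rewrite {1}/fro2 {1}/u trmx_mul trmxK -mulmxA.
have := cauchy_schwarz_mdot y (A *m u); rewrite -uE expr2 => H.
have := ler_wpM2l (fro2_ge0 y) (h u) => H2.
by rewrite -(ler_pM2r up); apply: le_trans H (le_trans H2 _); rewrite mulrCA mulrA.
Qed.

End frobenius_inequalities.

(** * Chaining for a quadratic chaos indexed by an l1 ball *)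

Section chaining.
Context {disp : measure_display} {Omega : measurableType disp} {R : realType}.
Variables (P : probability Omega R) (n k N : nat) (xi : 'I_n -> Omega -> R).
Hypothesis hxi : iid_normal P xi.
Variable Fj : 'I_N -> 'M[R]_(k, n).
Let F (w : 'cV[R]_N) : 'M[R]_(k, n) := \sum_j w j ord0 *: Fj j.
Hypothesis F_bounded : forall w (y : 'cV_n), fro2 (F w *m y) <= fro2 w * fro2 y.

Let FD w w' : F (w + w') = F w + F w'.
Proof. by rewrite /F -big_split; apply: eq_bigr => j _; rewrite mxE scalerDl. Qed.

Let FN w : F (- w) = - F w.
Proof. by rewrite /F -sumrN; apply: eq_bigr => j _; rewrite mxE scaleNr. Qed.

Let F0 : F 0 = 0.
Proof. by rewrite /F big1// => j _; rewrite mxE scale0r. Qed.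

Let F_fro w : fro2 (F w) <= n%:R * fro2 w.
Proof.
rewrite -[F w]mulmx1 fro2_mulmx_cols.
apply: (@le_trans _ _ (\sum_(i < n) fro2 w)); last first.
  by rewrite sumr_const card_ord mulr_natl.
apply: ler_sum => i _; apply: le_trans (F_bounded _ _) _.
have -> : fro2 (col i (1%:M : 'M[R]_n)) = 1; last by rewrite mulr1.
rewrite fro2E (bigD1 i)//= big_ord1 !mxE eqxx expr1n big1 ?addr0// => j ji.
by rewrite big_ord1 !mxE (negbTE ji) expr0n.
Qed.

Let chaos (w : 'cV[R]_N) (om : Omega) : R :=
  fro2 (F w *m colv xi om) - fro2 (F w).

(** The self-normalizing quantity |F(w'+w) y|^2 together with its mean |F(w'+w)|_F^2. *)
Let sizes (w w' : 'cV[R]_N) (om : Omega) : R :=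
  fro2 (F (w' + w) *m colv xi om) + fro2 (F (w' + w)).

Let measurable_fro2 p (A : 'M[R]_(p, n)) :
  measurable_fun setT (fun om => fro2 (A *m colv xi om)).
Proof.
under eq_fun do rewrite -qform_gram.
by apply: measurable_qform; case: hxi.
Qed.

(* The bilinear form behind an increment is [F(w'-w)^T F(w'+w)]. *)
Let increment_tail (s : R) (w w' : 'cV[R]_N) (c : R) :
  fails_with P (expR (- c)) (fun om =>
    s * (chaos w' om - chaos w om) <=
    c + s ^+ 2 * (fro2 (w' - w) * sizes w w' om)).
Proof.
pose f om := s * (chaos w' om - chaos w om)
  - s ^+ 2 * (fro2 (w' - w) * sizes w w' om).
suff : fails_with P (expR (- c)) (fun om => f om <= c).
  by apply: fails_with_le => // om; rewrite /f lerBlDr.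
have mchaos v : measurable_fun setT (chaos v) by exact: measurable_funB.
have mf : measurable_fun setT f.
  apply: measurable_funB; first by apply: measurable_funM => //; exact: measurable_funB.
  apply: measurable_funM => //; apply: measurable_funM => //.
  exact: measurable_funD.
apply: fails_with_exp => //.
pose N0 := (F (w' - w))^T *m F (w' + w); pose N1 : 'M[R]_n := s *: N0.
have Fm : F (w' - w) = F w' - F w by rewrite FD FN.
have qN p (A B : 'M[R]_(p, n)) y : qform ((A - B)^T *m (A + B)) y
    = fro2 (A *m y) - fro2 (B *m y).
  rewrite /qform -mulmxA -mulmxA [y^T *m _]mulmxA -trmx_mul.
  rewrite -/(mdot ((A - B) *m y) ((A + B) *m y)) mulmxDl mulmxDl mulNmx.
  rewrite mdotDr !(mdotC (_ - _)) !mdotDr !mdotNr (mdotC (B *m y) (A *m y)).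
  by rewrite /mdot -/(fro2 _) -/(fro2 _); ring.
have trN : \tr N0 = fro2 (F w') - fro2 (F w).
  rewrite /N0 Fm FD -/(mdot (F w' - F w) (F w' + F w)).
  rewrite mdotDr !(mdotC (_ - _)) !mdotDr !mdotNr (mdotC (F w) (F w')).
  by rewrite /mdot -/(fro2 _) -/(fro2 _); ring.
have opN (y : 'cV[R]_k) : fro2 ((F (w' - w))^T *m y) <= fro2 (w' - w) * fro2 y.
  apply: fro2_tr_mulmx_le => [|z]; first exact: fro2_ge0.
  exact: F_bounded.
have N0y (y : 'cV[R]_n) : fro2 (N0 *m y) <= fro2 (w' - w) * fro2 (F (w' + w) *m y).
  by rewrite /N0 -mulmxA; exact: opN.
have N0f : fro2 N0 <= fro2 (w' - w) * fro2 (F (w' + w)).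
  rewrite /N0 fro2_mulmx_cols [fro2 (F (w' + w))]fro2_cols mulr_sumr.
  by apply: ler_sum => i _; exact: opN.
have mg : measurable_fun setT
    (fun om => qform N1 (colv xi om) - fro2 (N1 *m colv xi om)).
  apply: measurable_funB => //; apply: measurable_qform.
  by case: hxi.
have meg : measurable_fun setT
    (fun om => expR (qform N1 (colv xi om) - fro2 (N1 *m colv xi om))).
  exact: measurableT_comp.
have := gaussian_bilinear_self_normalized N1 hxi.
set K := expR (\tr N1 + fro2 N1) => hK.
have K0 : 0 < K by exact: expR_gt0.
apply: (@le_trans _ _ (\int[P]_om (K^-1%:E *
    (expR (qform N1 (colv xi om) - fro2 (N1 *m colv xi om)))%:E))%E).
  apply: ge0_le_integral => //.
  - by apply/measurable_EFinP; exact: measurableT_comp.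
  - by apply/measurable_EFinP; exact: measurable_funM.
  - move=> om _; rewrite -EFinM lee_fin /K -expRN -expRD ler_expR /f /chaos /sizes.
    rewrite /N1 mxtraceZ trN qformZ -scalemxAl !fro2Z.
    have -> : qform N0 (colv xi om) =
        fro2 (F w' *m colv xi om) - fro2 (F w *m colv xi om).
      by rewrite /N0 Fm FD qN.
    have := ler_wpM2l (sqr_ge0 s) (N0y (colv xi om)).
    have := ler_wpM2l (sqr_ge0 s) N0f.
    rewrite mulrDr mulrDr; lra.
rewrite ge0_integralZl//; last 2 first.
- exact/measurable_EFinP.
- by rewrite lee_fin invr_ge0 ltW.
rewrite -(lee_pmul2l (_ : K%:E \is a fin_num)) ?lte_fin//.
by rewrite muleA -EFinM divff ?gt_eqF// mul1e mule1.
Qed.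

Variable L : R.
Hypothesis L1 : 1 <= L.
Hypothesis LN : 2 * N%:R * expR (- L) <= 1.

Let code := {ffun 'I_N -> bool * nat}.
Let code_of m (w : 'cV[R]_N) : code := [ffun j => level m (w j ord0)].
Let cost (z : code) : R := \sum_j level_cost L (z j).

(** The union bound needs finitely many codes. Magnitudes at level [m] are at most 4^m on the ball,
    so bounded codes suffice; [unf] embeds them into the common type [code]. *)
Let fcode m := {ffun 'I_N -> bool * 'I_(4 ^ m).+1}.
Let unf m (z : fcode m) : code := [ffun j => ((z j).1, (z j).2 : nat)].

(** Costs add over coordinates, so the sum factors, and (1 + e^-L)^(2N) <= exp (2 N e^-L) is at most
    e by [LN], at every level. *)
Let sum_cost_le m : \sum_(z : fcode m) expR (- cost (unf z)) <= expR 1.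
Proof.
have -> : \sum_(z : fcode m) expR (- cost (unf z)) =
    \sum_(z : fcode m) \prod_j expR (- level_cost L ((z j).1, (z j).2 : nat)).
  apply: eq_bigr => z _; rewrite /cost -sumrN expR_sum.
  by apply: eq_bigr => j _; rewrite ffunE.
rewrite -(bigA_distr_bigA (fun (_ : 'I_N) (z : bool * 'I_(4 ^ m).+1) =>
  expR (- level_cost L (z.1, z.2 : nat)))) /= prodr_const card_ord.
apply: (@le_trans _ _ (((1 + expR (- L)) ^+ 2) ^+ N)).
  apply: lerXn2r; rewrite ?nnegrE ?sqr_ge0//; last exact: sum_level_cost_le.
  by apply: sumr_ge0 => z _; exact: expR_ge0.
rewrite -exprM; apply: (@le_trans _ _ (expR (expR (- L)) ^+ (2 * N))).
  by apply: lerXn2r; rewrite ?nnegrE ?expR_ge0 ?addr_ge0 ?expR_ge0 ?expR_ge1Dx.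
by rewrite -expRM_natl ler_expR natrM.
Qed.

(** The union runs over all pairs of codes at consecutive levels, whether or not one refines the
    other: since costs add, this only squares the sum of the weights. *)
Let level_event m (r r' : code -> 'cV[R]_N) (s u : R) : 0 < s ->
  fails_with P (expR (- u) * expR (- m.+1%:R)) (fun om =>
    forall (z : fcode m) (z' : fcode m.+1),
    `|chaos (r' (unf z')) om - chaos (r (unf z)) om| <=
    (cost (unf z) + cost (unf z') + u + (m.+1%:R + 4)) / s
    + s * (fro2 (r' (unf z') - r (unf z)) * sizes (r (unf z)) (r' (unf z')) om)).
Proof.
move=> s0.
(* The 4 pays for the two signs and the two sums over codes, as 2 e^(1 + 1 - 4) <= 1; [m.+1] makes
   the levels summable. *)
pose c (z : fcode m) (z' : fcode m.+1) :=
  cost (unf z) + cost (unf z') + u + (m.+1%:R + 4).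
have h (i : bool * (fcode m * fcode m.+1)) :=
  increment_tail ((-1) ^+ i.1 * s) (r (unf i.2.1)) (r' (unf i.2.2))
    (c i.2.1 i.2.2).
have := fails_with_forall_fin h; apply: fails_with_le.
  rewrite -(pair_bigA _ (fun (_ : bool) (zz : fcode m * fcode m.+1) =>
     expR (- c zz.1 zz.2)))/= big_bool/= -(pair_bigA _ (fun z z' => expR (- c z z')))/=.
  have -> : \sum_(z : fcode m) \sum_(z' : fcode m.+1) expR (- c z z') =
    expR (- u) * expR (- m.+1%:R) * expR (- 4) *
      ((\sum_(z : fcode m) expR (- cost (unf z))) *
       (\sum_(z' : fcode m.+1) expR (- cost (unf z')))).
    rewrite big_distrlr/= mulr_sumr; apply: eq_bigr => z _; rewrite mulr_sumr.
    by apply: eq_bigr => z' _; rewrite -!expRD; congr expR; rewrite /c; ring.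
  set a := expR (- u) * _; have a0 : 0 <= a by rewrite mulr_ge0// expR_ge0.
  have : (\sum_(z : fcode m) expR (- cost (unf z))) *
      (\sum_(z' : fcode m.+1) expR (- cost (unf z'))) <= expR 1 * expR 1.
    by apply: ler_pM; rewrite ?sum_cost_le//; apply: sumr_ge0 => ? _; exact: expR_ge0.
  move=> /(ler_wpM2l (expR_ge0 (-4))).
  rewrite -expRD -expRD (_ : - 4 + (1 + 1) = -2); last by ring.
  have : 2 * expR (-2) <= 1 :> R.
    rewrite expRN; have := expR_ge1Dx (2 : R).
    by rewrite ler_pdivrMr ?expR_gt0// mul1r; lra.
  set S1 := (\sum_(z : fcode m) _) * _ => h1 h2.
  apply: (@le_trans _ _ (a * (2 * (expR (- 4) * S1)))).
    by rewrite le_eqVlt; apply/orP; left; apply/eqP; ring.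
  by rewrite ler_piMr//; lra.
move=> om hom z z'; rewrite -/(c z z').
have := hom (false, (z, z')); have := hom (true, (z, z')).
rewrite /= expr0 expr1 mul1r mulN1r sqrrN mulNr.
set D := _ - chaos _ om; set Q := fro2 _ * _ => h1 h2.
have e : c z z' / s + s * Q = (c z z' + s ^+ 2 * Q) / s by field; rewrite gt_eqF.
rewrite e ler_norml; apply/andP; split.
  by rewrite lerNl ler_pdivlMr// mulNr mulrC.
by rewrite ler_pdivlMr// mulrC.
Qed.

Variable Rb : R.
Hypothesis Rb0 : 0 <= Rb.

Let ball (w : 'cV[R]_N) : Prop := l1norm w <= 1 /\ fro2 (F w) <= Rb.

Let ball0 : ball 0.
Proof.
split; last by rewrite F0 /fro2 mulmx0 mxtrace0.
by rewrite /l1norm big1// => j _; rewrite mxE normr0.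
Qed.

Let ball_coord w j : ball w -> `|w j ord0| <= 1.
Proof.
move=> [w1 _]; apply: le_trans w1; rewrite /l1norm (bigD1 j)//= lerDl.
by apply: sumr_ge0 => i _.
Qed.

Let fro2_colE (w : 'cV[R]_N) : fro2 w = \sum_j w j ord0 ^+ 2.
Proof. by rewrite fro2E; apply: eq_bigr => j _; rewrite big_ord1. Qed.

Let ball_fro2 w : ball w -> fro2 w <= 1.
Proof.
move=> bw; have [w1 _] := bw; apply: le_trans w1; rewrite fro2_colE.
apply: ler_sum => j _; have := ball_coord j bw.
rewrite -real_normK ?num_real// expr2 => h.
by rewrite ler_piMl.
Qed.

(** The squared rounding error at level [m] up to a constant: a coordinate below the mesh can lose
    its whole square, any other one at most the squared mesh. *)
Let Psi m (w : 'cV[R]_N) : R := \sum_j Num.min (w j ord0 ^+ 2) (mesh m ^+ 2).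

Let Psi_ge0 m w : 0 <= Psi m w.
Proof. by apply: sumr_ge0 => j _; rewrite le_min !sqr_ge0. Qed.

Let PsiS m w : Psi m.+1 w <= Psi m w.
Proof.
apply: ler_sum => j _; rewrite le_min ge_min lexx/= ge_min meshS; apply/orP; right.
have -> : (mesh m / 4) ^+ 2 = mesh m ^+ 2 / 16 :> R by field.
by have := sqr_ge0 (mesh m : R); lra.
Qed.

Let Psi_le m w : Psi m w <= N%:R * mesh m ^+ 2.
Proof.
apply: (@le_trans _ _ (\sum_(j < N) mesh m ^+ 2)); last first.
  by rewrite sumr_const card_ord mulr_natl.
by apply: ler_sum => j _; rewrite ge_min lexx orbT.
Qed.

Let same_code m w w' : code_of m w = code_of m w' ->
  fro2 (w - w') <= 2 * Psi m w + 2 * Psi m w'.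
Proof.
move=> e; rewrite fro2_colE !mulr_sumr -big_split; apply: ler_sum => j _.
rewrite !mxE; apply: level_close.
by move/ffunP: e => /(_ j); rewrite !ffunE.
Qed.

(* Each cell gets a representative inside [ball] that nearly minimizes [Psi];
   this keeps the quadratic form under control along the chain. *)
Let representatives : exists r : nat -> code -> 'cV[R]_N,
  [/\ forall z, r 0%N z = 0, forall m z, ball (r m z) &
    forall m w, ball w ->
      fro2 (w - r m (code_of m w)) <= 4 * Psi m w + 2 * mesh m ^+ 2].
Proof.
have : forall mz : nat * code, exists r : 'cV[R]_N,
    [/\ mz.1 = 0%N -> r = 0, ball r & forall w, ball w -> code_of mz.1 w = mz.2 ->
      fro2 (w - r) <= 4 * Psi mz.1 w + 2 * mesh mz.1 ^+ 2].
  move=> [[|m] z] /=.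
    (* At level 0 the chain starts from the point 0, where the chaos vanishes. *)
    exists 0; split => // w bw _; rewrite subr0.
    have -> : Psi 0 w = fro2 w.
      rewrite fro2_colE; apply: eq_bigr => j _; apply/min_idPl.
      have h := ball_coord j bw.
      rewrite /mesh expr0 divr1 -[leLHS]real_normK ?num_real//.
      by rewrite ler_sqr ?nnegrE//; lra.
    by have := fro2_ge0 w; have := sqr_ge0 (mesh 0 : R); lra.
  have [[w0 [bw0 cw0]]|no] := pselect (exists w, ball w /\ code_of m.+1 w = z).
    pose cell := [set w | ball w /\ code_of m.+1 w = z].
    have lbE : has_inf [set Psi m.+1 w | w in cell].
      split; first by exists (Psi m.+1 w0), w0.
      by exists 0 => _ [w _ <-]; exact: Psi_ge0.
    (* The squared mesh is the slack allowed above the infimum of [Psi] on the cell. Then [Psi] at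
       the representative is at most [Psi] at [w] plus this slack, and [same_code] yields the
       factors 4 and 2. *)
    have m2 : 0 < mesh m.+1 ^+ 2 :> R by rewrite exprn_gt0// mesh_gt0.
    have [_ [r [br cr] <-] hr] := inf_adherent m2 lbE.
    exists r; split => // w bw cw.
    apply: (le_trans (same_code (etrans cw (esym cr)))).
    have : inf [set Psi m.+1 w | w in cell] <= Psi m.+1 w.
      by apply: ge_inf; [case: lbE|exists w].
    lra.
  by exists 0; split => // w bw cw; exfalso; apply: no; exists w.
move=> /choice[r hr]; exists (fun m z => r (m, z)); split.
- by move=> z; have [+ _ _] := hr (0%N, z); apply.
- by move=> m z; have [_ + _] := hr (m, z).
- by move=> m w bw; have [_ _ h] := hr (m, code_of m w); exact: h.
Qed.

Let unf_code_of m w : ball w -> exists z : fcode m, unf z = code_of m w.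
Proof.
move=> bw; exists [ffun j => ((level m (w j ord0)).1, inord (level m (w j ord0)).2)].
apply/ffunP => j; rewrite !ffunE /=; rewrite inordK//.
by apply: level_bound; exact: ball_coord.
Qed.

Let L0 : 0 <= L. Proof. by apply: le_trans L1. Qed.

Let cost_ge0 z : 0 <= cost z.
Proof.
apply: sumr_ge0 => j _; rewrite /level_cost.
by rewrite addr_ge0// !mulr_ge0 ?L0 ?sqrtr_ge0.
Qed.

(** Exchanging levels and coordinates leaves, for each coordinate, a sum linear in |w_j|, and the l1
    norm is at most 1. The constant is 7 from [level_cost_le] times 2 from [sum_trunc_mesh_le]. *)
Let sum_cost_mesh w M : ball w ->
  \sum_(m < M) mesh m * cost (code_of m w) <= 14 * L.
Proof.
move=> [w1 _]; under eq_bigr do rewrite /cost mulr_sumr.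
rewrite exchange_big/=.
apply: (@le_trans _ _ (\sum_j 14 * L * `|w j ord0|)); last first.
  by rewrite -mulr_sumr -[leRHS]mulr1 ler_wpM2l// mulr_ge0.
apply: ler_sum => j _.
apply: (@le_trans _ _ (7 * L * \sum_(m < M) mesh m *
    Num.sqrt (Num.truncn (`|w j ord0| / mesh m))%:R)).
  rewrite mulr_sumr; apply: ler_sum => m _; rewrite ffunE mulrCA.
  by rewrite ler_wpM2l ?(ltW (mesh_gt0 m))//; exact: level_cost_le.
have := sum_trunc_mesh_le M (normr_ge0 (w j ord0)).
move=> /(ler_wpM2l (_ : 0 <= 7 * L)) => /(_ (mulr_ge0 (ler0n _ _) L0)); lra.
Qed.

Let sum_Psi_mesh w M : ball w -> \sum_(m < M) Psi m w / mesh m <= 3.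
Proof.
move=> [w1 _]; under eq_bigr do rewrite /Psi mulr_suml.
rewrite exchange_big/=.
apply: (@le_trans _ _ (\sum_j 3 * `|w j ord0|)); last by rewrite -mulr_sumr -/(l1norm w); lra.
apply: ler_sum => j _; have := sum_min_mesh_le M (normr_ge0 (w j ord0)).
by rewrite real_normK ?num_real.
Qed.

Let sum_expR_le M : \sum_(m < M) expR (- m.+1%:R) <= 1 :> R.
Proof.
apply: (@le_trans _ _ (1 - 2^-1 ^+ M)); last by rewrite gerBl exprn_ge0.
elim: M => [|M IH]; first by rewrite big_ord0 expr0 subrr.
rewrite big_ord_recr/=; have : expR (- M.+1%:R) <= 2^-1 ^+ M.+1 :> R.
  rewrite expRN -[X in expR X]mulr1 expRM_natl exprVn lef_pV2 ?posrE ?exprn_gt0 ?expR_gt0//.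
  by apply: lerXn2r; rewrite ?nnegrE ?expR_ge0//; have := expR_ge1Dx (1 : R); lra.
by move: IH; rewrite exprS; lra.
Qed.

Let fro2_diff_le p q (A B : 'M[R]_(p, q)) t : 0 < t ->
  `|fro2 A - fro2 B| <= (fro2 (A - B) / t + t * fro2 (A + B)) / 2.
Proof.
move=> t0; have -> : fro2 A - fro2 B = mdot (A + B) (A - B).
  rewrite mdotDr mdotNr !(mdotC (A + B)) !mdotDr (mdotC B A).
  by rewrite /mdot -/(fro2 _) -/(fro2 _); ring.
by have := mdot_young (A + B) (A - B) t0; lra.
Qed.

(** For a fixed outcome the supremum R2 of |F(w) y|^2 over the ball is finite, being at most |y|^2,
    and the chain gives R2 <= Rb + Y + (R2 + Rb) / (4 K) with Y of order K (L + u). Solving for R2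
    eliminates it. The parameter [K] trades the relative error Rb / K against the size of Y. *)
Lemma quadratic_chaos_l1_ball (K u : R) : 1 <= K -> 0 <= u ->
  fails_with P (expR (- u)) (fun om => forall w : 'cV[R]_N,
    l1norm w <= 1 -> fro2 (\sum_j w j ord0 *: Fj j) <= Rb ->
    `|fro2 ((\sum_j w j ord0 *: Fj j) *m colv xi om)
      - fro2 (\sum_j w j ord0 *: Fj j)| <= 120 * (35 * (32 * K) * (L + u)) + Rb / K).
Proof.
move=> K1 u0; have [r [r0 rball rclose]] := representatives.
have K0 : 0 < K by apply: lt_le_trans K1.
(* Chosen so that 280 / [be] = 1 / (4 K), which makes the self-normalizing contribution
   absorbable. *)
pose be := 35 * (32 * K).
have be0 : 0 < be by rewrite mulr_gt0 ?ltr0n// mulr_gt0 ?ltr0n.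
pose s m := (be * mesh m)^-1.
have s0 m : 0 < s m by rewrite invr_gt0 mulr_gt0// mesh_gt0.
have ev m := @level_event m (r m) (r m.+1) (s m) u (s0 m).
have := fails_with_forall ev (a := expR (- u)).
have su : forall M, \sum_(m < M) expR (- u) * expR (- m.+1%:R) <= expR (- u).
  by move=> M; rewrite -mulr_sumr ler_piMr ?expR_ge0.
move=> /(_ su); apply: fails_with_le => // om hom.
pose x := colv xi om; pose q w := fro2 (F w *m x).
pose R2 := sup [set q w | w in ball].
have qR2 w : ball w -> q w <= R2.
  move=> bw; apply: ub_le_sup; last by exists w.
  exists (fro2 x) => _ [v bv <-]; apply: le_trans (F_bounded _ _) _.
  by rewrite ler_piMl ?fro2_ge0 ?ball_fro2.
have R20 : 0 <= R2 by apply: le_trans (qR2 _ ball0); exact: fro2_ge0.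
have sizesle w w' : ball w -> ball w' -> sizes w w' om <= 4 * (R2 + Rb).
  move=> bw bw'; rewrite /sizes FD mulmxDl.
  have := fro2D_le (F w' *m x) (F w *m x); have := fro2D_le (F w') (F w).
  have := qR2 _ bw; have := qR2 _ bw'; case: bw => _; case: bw' => _.
  by rewrite /q -/x; lra.
have sizes0 w w' : 0 <= sizes w w' om by rewrite addr_ge0 ?fro2_ge0.
(* 70 = 14 + 4 * 14 comes from the costs at two consecutive levels, 3 and 15 from the sums of the
   meshes. The 280 is 4, from the bound on [sizes], times 70 >= 16 * 3 + 8 * (8 / 3), from the
   distances. *)
have bound w : ball w -> `|chaos w om| <=
    be * (70 * L + 3 * u + 15) + 280 * (R2 + Rb) / be.
  move=> bw; pose v m := r m (code_of m w).
  have step m : `|chaos (v m.+1) om - chaos (v m) om| <=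
      be * (mesh m * cost (code_of m w) + 4 * (mesh m.+1 * cost (code_of m.+1 w))
        + mesh m * u + mesh m * (m.+1%:R + 4))
      + 4 * (R2 + Rb) / be * (16 * (Psi m w / mesh m) + 8 * mesh m).
    have [z zE] := unf_code_of m bw; have [z' z'E] := unf_code_of m.+1 bw.
    have := hom m z z'; rewrite zE z'E -/(v m) -/(v m.+1) => /le_trans; apply.
    have m0 := mesh_gt0 m : 0 < mesh m :> R; apply: lerD.
      rewrite /s invrK meshS le_eqVlt; apply/orP; left; apply/eqP.
      by rewrite mulrC; field.
    have dist : fro2 (v m.+1 - v m) <= 16 * Psi m w + 8 * mesh m ^+ 2.
      have -> : v m.+1 - v m = (w - v m) + - (w - v m.+1).
        by rewrite opprB [RHS]addrC subrKA.
      have := fro2D_le (w - v m) (- (w - v m.+1)); rewrite fro2N.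
      have := rclose m _ bw; have := rclose m.+1 _ bw; rewrite -/(v m) -/(v m.+1).
      have := PsiS m w; have := sqr_ge0 (mesh m : R).
      rewrite meshS; have -> : (mesh m / 4) ^+ 2 = mesh m ^+ 2 / 16 :> R by field.
      by lra.
    have := ler_pM (fro2_ge0 _) (sizes0 _ _) dist
      (sizesle _ _ (rball m (code_of m w)) (rball m.+1 (code_of m.+1 w))).
    move=> /(ler_wpM2l (ltW (s0 m))) /le_trans; apply.
    rewrite /s le_eqVlt; apply/orP; left; apply/eqP; field.
    by rewrite !gt_eqF.
  have tele M : `|chaos (v M) om| <= be * (70 * L + 3 * u + 15)
      + 280 * (R2 + Rb) / be.
    have : `|chaos (v M) om| <= \sum_(m < M)
      (be * (mesh m * cost (code_of m w) + 4 * (mesh m.+1 * cost (code_of m.+1 w))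
        + mesh m * u + mesh m * (m.+1%:R + 4))
      + 4 * (R2 + Rb) / be * (16 * (Psi m w / mesh m) + 8 * mesh m)).
      elim: M => [|M IH].
        by rewrite big_ord0 /v r0 /chaos F0 mul0mx /fro2 !mulmx0 !mxtrace0 subrr normr0.
      rewrite big_ord_recr/=; apply: le_trans (lerD IH (step M)).
      apply: le_trans (ler_normD _ _); rewrite addrC subrK//.
    move=> /le_trans; apply; rewrite big_split/= -!mulr_sumr !big_split/=.
    rewrite -[\sum_(i < M) 4 * _]mulr_sumr -[\sum_(i < M) 16 * _]mulr_sumr.
    rewrite -[\sum_(i < M) 8 * _]mulr_sumr -mulr_suml.
    have c1 := sum_cost_mesh M bw.
    have c2 : \sum_(m < M) mesh m.+1 * cost (code_of m.+1 w) <= 14 * L.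
      apply: le_trans (sum_cost_mesh M.+1 bw); rewrite big_ord_recl.
      by rewrite lerDr mulr_ge0 ?cost_ge0// ltW// mesh_gt0.
    have c3 := sum_mesh_le (R := R) M; have c4 := sum_mesh_affine_le (R := R) M.
    have c5 := sum_Psi_mesh M bw.
    have c3u := ler_wpM2r u0 c3.
    move: c1 c2 c3 c3u c4 c5.
    set S1 := \sum_(i < M) _ * cost _; set S2 := \sum_(i < M) mesh i.+1 * _.
    set S3 := \sum_(i < M) mesh i; set S4 := \sum_(i < M) _ * (_ + 4).
    set S5 := \sum_(i < M) Psi _ _ / _ => c1 c2 c3 c3u c4 c5.
    apply: lerD; first by rewrite ler_pM2l//; lra.
    have -> : 280 * (R2 + Rb) / be = 4 * (R2 + Rb) / be * 70 by field; rewrite gt_eqF.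
    rewrite ler_wpM2l//; last lra.
    by rewrite divr_ge0 ?(ltW be0)// mulr_ge0// addr_ge0.
  (* The end of the chain: |w - v m| is of the order of the mesh, so the chaos at [v m] tends to the
     chaos at [w]. The constant depends on the dimensions and on the outcome, but the mesh in front
     of it vanishes. *)
  apply: (@mesh_inv_unbounded _ _ (((4 * N%:R + 2) * fro2 x + 4 * R2
     + ((4 * N%:R + 2) * n%:R + 4 * Rb)) / 2)) => m.
  have m0 := mesh_gt0 m : 0 < mesh m :> R.
  have dv : fro2 (w - v m) <= (4 * N%:R + 2) * mesh m ^+ 2.
    by have := rclose m _ bw; have := Psi_le m w; rewrite -/(v m); lra.
  have e1 : fro2 (w - v m) / mesh m <= (4 * N%:R + 2) * mesh m.
    by rewrite ler_pdivrMr// -mulrA -expr2.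
  have bv : ball (v m) by exact: rball.
  have Fsub : F (w - v m) = F w - F (v m) by rewrite FD FN.
  have d1 : `|q w - q (v m)| <= ((4 * N%:R + 2) * mesh m * fro2 x + mesh m * (4 * R2)) / 2.
    apply: (le_trans (fro2_diff_le _ _ m0)); rewrite ler_pM2r ?invr_gt0//.
    apply: lerD.
      apply: le_trans (ler_wpM2r (fro2_ge0 x) e1).
      rewrite mulrAC ler_pM2r ?invr_gt0// -mulmxBl -Fsub; exact: F_bounded.
    rewrite ler_pM2l//; have := fro2D_le (F w *m x) (F (v m) *m x).
    by have := qR2 _ bw; have := qR2 _ bv; rewrite /q; lra.
  have d2 : `|fro2 (F w) - fro2 (F (v m))|
      <= ((4 * N%:R + 2) * mesh m * n%:R + mesh m * (4 * Rb)) / 2.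
    apply: (le_trans (fro2_diff_le _ _ m0)); rewrite ler_pM2r ?invr_gt0//.
    apply: lerD.
      apply: le_trans (ler_wpM2r (ler0n R n) e1).
      rewrite mulrAC ler_pM2r ?invr_gt0// -Fsub mulrC; exact: F_fro.
    rewrite ler_pM2l//; have := fro2D_le (F w) (F (v m)).
    by case: bw => _; case: bv => _; lra.
  have := tele m.
  have : `|chaos w om| <= `|chaos (v m) om| +
      (`|q w - q (v m)| + `|fro2 (F w) - fro2 (F (v m))|).
    have -> : chaos w om = chaos (v m) om + ((q w - q (v m)) -
        (fro2 (F w) - fro2 (F (v m)))) by rewrite /chaos /q -/x; ring.
    apply: le_trans (ler_normD _ _) _; rewrite lerD2l.
    exact: ler_normB.
  lra.
(* [bound] is uniform over the ball; adding the mean |F(w)|_F^2 <= Rb and taking the supremum gives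
   an inequality for R2 itself. *)
have R2le : R2 <= Rb + (be * (70 * L + 3 * u + 15) + 280 * (R2 + Rb) / be).
  apply: ge_sup; first by exists (q 0), 0.
  move=> _ [w bw <-]; have := bound w bw; rewrite /chaos -/x -/(q w).
  by move=> /(le_trans (ler_norm _)); case: bw => _; lra.
move=> w w1 wRb; have := bound w (conj w1 wRb); rewrite /chaos => /le_trans; apply.
have e280 : 280 * (R2 + Rb) / be = (R2 + Rb) / (4 * K).
  by rewrite /be; field; rewrite gt_eqF.
rewrite e280 in R2le *.
pose a := (R2 + Rb) / (4 * K); pose b := Rb / K.
have aE : R2 = 4 * K * a - Rb by rewrite /a; field; rewrite gt_eqF.
have bE : Rb = K * b by rewrite /b; field; rewrite gt_eqF.
have b0 : 0 <= b by rewrite /b divr_ge0// ltW.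
have a0 : 0 <= a by rewrite /a divr_ge0 ?addr_ge0// mulr_ge0// ltW.
rewrite -/a -/b in R2le *.
set Y := be * _ in R2le *.
pose Z := be * (L + u); rewrite -/be -/Z.
have Yle : Y <= 85 * Z.
  have -> : 85 * Z = be * (85 * (L + u)) by rewrite /Z; ring.
  by rewrite /Y ler_pM2l//; have := L1; lra.
have Z0 : 0 <= Z by rewrite mulr_ge0 ?(ltW be0)// addr_ge0// L0.
have Ka : a <= K * a by rewrite ler_peMl.
have Y0 : 0 <= Y by rewrite mulr_ge0 ?(ltW be0)//; have := L0; lra.
have h : 4 * (K * a) - 2 * (K * b) <= Y + a.
  by move: aE bE R2le; lra.
have : 3 * (K * a) <= 2 * (K * b) + Y by lra.
have -> : 3 * (K * a) = K * (3 * a) by ring.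
have YK : Y <= K * Y by rewrite ler_peMl.
move=> h2; have : K * (3 * a) <= K * (2 * b + Y) by rewrite mulrDr; lra.
rewrite ler_pM2l// => h3; lra.
Qed.

End chaining.

(** * Linear systems *)

Section row_stack.
Context {R : realType}.

(** Stacking turns a sum of [fro2] or [mdot] over blocks into a single one, the form required by the
    Gaussian bounds. *)
Definition rowstack (I : finType) p q (f : I -> 'M[R]_(p, q)) :
    'M[R]_(#|{: I * 'I_p}|, q) :=
  \matrix_(a, b) f (enum_val a).1 (enum_val a).2 b.

Lemma mdot_rowstack (I : finType) p q (f g : I -> 'M[R]_(p, q)) :
  mdot (rowstack f) (rowstack g) = \sum_i mdot (f i) (g i).
Proof.
rewrite mdotE (reindex_onto enum_rank enum_val) /=; last by move=> a _; rewrite enum_valK.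
rewrite (eq_bigl xpredT); last by move=> i; rewrite enum_rankK eqxx.
transitivity (\sum_i \sum_a \sum_b f i a b * g i a b); last first.
  by apply: eq_bigr => i _; rewrite mdotE.
rewrite [RHS]pair_bigA; apply: eq_bigr => -[i a] _; apply: eq_bigr => b _.
by rewrite !mxE enum_rankK.
Qed.

Lemma fro2_rowstack (I : finType) p q (f : I -> 'M[R]_(p, q)) :
  fro2 (rowstack f) = \sum_i fro2 (f i).
Proof. exact: mdot_rowstack. Qed.

Lemma rowstack_mulmx (I : finType) p q r (f : I -> 'M[R]_(p, q)) (y : 'M[R]_(q, r)) :
  rowstack f *m y = rowstack (fun i => f i *m y).
Proof. by apply/matrixP => a b; rewrite !mxE; apply: eq_bigr => k _; rewrite !mxE. Qed.

Lemma rowstack_lin (I : finType) N p q (c : 'I_N -> R) (f : 'I_N -> I -> 'M[R]_(p, q)) :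
  \sum_j c j *: rowstack (f j) = rowstack (fun i => \sum_j c j *: f j i).
Proof.
apply/matrixP => a b; rewrite summxE !mxE summxE.
by apply: eq_bigr => j _; rewrite !mxE.
Qed.

Lemma fro2_mulmx_tr_rows p q r (u : 'M[R]_(p, q)) (X : 'M[R]_(q, r)) (e : R) :
  0 <= e -> (forall y : 'cV_r, fro2 (X *m y) <= e * fro2 y) ->
  fro2 (u *m X) <= e * fro2 u.
Proof.
move=> e0 h; rewrite -fro2_tr trmx_mul fro2_mulmx_cols -[in leRHS]fro2_tr.
rewrite [in leRHS]fro2_cols mulr_sumr; apply: ler_sum => i _.
exact: fro2_tr_mulmx_le.
Qed.

Lemma fro2_mulmx_le p q r (u : 'M[R]_(p, q)) (y : 'M[R]_(q, r)) :
  fro2 (u *m y) <= fro2 u * fro2 y.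
Proof.
rewrite [in leRHS]fro2E mulr_suml fro2E; apply: ler_sum => i _.
rewrite [fro2 y]fro2_cols mulr_sumr; apply: ler_sum => j _.
rewrite mxE; have := cauchy_schwarz_mdot (row i u)^T (col j y).
have -> : mdot (row i u)^T (col j y) = \sum_k u i k * y k j.
  by rewrite mdotE; apply: eq_bigr => k _; rewrite big_ord1 !mxE.
have -> : fro2 (row i u)^T = \sum_k u i k ^+ 2.
  by rewrite fro2E; apply: eq_bigr => k _; rewrite big_ord1 !mxE.
exact.
Qed.

(** The cross term is split with the weight that leaves the factor rho, rather than rho^2, on the
    old energy. Summed over time, this yields 1 / (1 - rho)^2 without any estimate on powers of the
    transition matrix. *)
Lemma contraction_step p (rho f : R) (u e : 'cV[R]_p) : 0 <= rho -> rho < 1 ->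
  0 <= f -> fro2 u <= rho ^+ 2 * f ->
  fro2 (u + e) <= rho * f + fro2 e / (1 - rho).
Proof.
move=> r0 r1 f0 uf; rewrite fro2D.
have g0 := fro2_ge0 e; set g := fro2 e in g0 *.
have r1' : 0 < 1 - rho by rewrite subr_gt0.
pose B := rho * (1 - rho) * f + rho * (g / (1 - rho)).
have gE : g = (g / (1 - rho)) * (1 - rho) by rewrite divfK// gt_eqF.
set c := g / (1 - rho) in gE B *.
have c0 : 0 <= c by rewrite divr_ge0// ltW.
have B0 : 0 <= B.
  apply: addr_ge0; last exact: mulr_ge0.
  by apply: mulr_ge0 => //; apply: mulr_ge0 => //; exact: ltW.
have : 2 * mdot u e <= B.
  apply: le_trans (ler_norm _) _.
  rewrite -[leRHS]ger0_norm// -ler_sqr ?nnegrE// !real_normK ?num_real//.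
  have := cauchy_schwarz_mdot u e; rewrite -/g => cs.
  have h := ler_wpM2r g0 uf.
  have : 4 * (rho ^+ 2 * f * g) <= B ^+ 2.
    rewrite gE -subr_ge0; have -> : B ^+ 2 - 4 * (rho ^+ 2 * f * (c * (1 - rho)))
      = (rho * (1 - rho) * f - rho * c) ^+ 2 by rewrite /B; ring.
    exact: sqr_ge0.
  rewrite exprMn; lra.
rewrite gE /B; nra.
Qed.

End row_stack.

(** * Trajectories as linear images of the noise *)

Section linear_system.
Context {R : realType}.
Variables (d T m : nat) (A : 'I_m -> 'M[R]_d) (rho : R).
Hypothesis rho0 : 0 <= rho.
Hypothesis rho1 : rho < 1.
Hypothesis Arho : forall l (z : 'cV_d), fro2 (A l *m z) <= rho ^+ 2 * fro2 z.

Notation noise_index := ('I_m * 'I_T.+1 * 'I_d)%type.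
Notation n := #|{: noise_index}|.

(** [noise_mx l s] reads off the noise at time s + 1, so that noise times are indexed by ['I_T.+1].
    For s > T, [inord] falls back to a default index; the orthogonality lemmas assume s <= T. *)
Definition noise_mx (l : 'I_m) (s : nat) : 'M[R]_(d, n) :=
  \matrix_(j, k) (enum_val k == (l, inord s, j) :> noise_index)%:R.

Fixpoint state_mx (l : 'I_m) (t : nat) : 'M[R]_(d, n) :=
  if t is t'.+1 then A l *m state_mx l t' + noise_mx l t' else 0.

Let Delta := (1 - rho) ^+ 2.

Lemma noise_mx_mul l s (y : 'cV[R]_n) j :
  (noise_mx l s *m y) j ord0 = y (enum_rank (l, inord s, j)) ord0.
Proof.
rewrite mxE (bigD1 (enum_rank (l, inord s, j)))//= mxE enum_rankK eqxx mul1r.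
rewrite big1 ?addr0// => k kj; rewrite mxE; case: eqP => e; last by rewrite mul0r.
by move: kj; rewrite -e enum_valK eqxx.
Qed.

Lemma noise_mx_fro2 (y : 'cV[R]_n) :
  \sum_l \sum_(s < T.+1) fro2 (noise_mx l s *m y) = fro2 y.
Proof.
rewrite [RHS]fro2E [RHS](reindex_onto enum_rank enum_val) /=; last by move=> a _; rewrite enum_valK.
rewrite [RHS](eq_bigl xpredT); last by move=> i; rewrite enum_rankK eqxx.
rewrite [LHS]pair_bigA /=; transitivity (\sum_(p : 'I_m * 'I_T.+1) \sum_j
   y (enum_rank (p, j)) ord0 ^+ 2).
  apply: eq_bigr => -[l s] _; rewrite fro2E; apply: eq_bigr => j _.
  by rewrite big_ord1 noise_mx_mul inord_val.
by rewrite [LHS]pair_bigA; apply: eq_bigr => -[p j] _; rewrite big_ord1.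
Qed.

Lemma noise_mx_orth l s s' : (s <= T)%N -> (s' <= T)%N ->
  noise_mx l s *m (noise_mx l s')^T = (s == s')%:R%:M.
Proof.
move=> sT s'T; apply/matrixP => i j; rewrite !mxE.
under eq_bigr do rewrite !mxE.
rewrite (bigD1 (enum_rank (l, inord s, i)))//=.
rewrite enum_rankK eqxx mul1r.
rewrite big1 ?addr0; last first.
  move=> k kj; case: eqP => e; last by rewrite mul0r.
  by move: kj; rewrite -e enum_valK eqxx.
rewrite -[RHS]mulr_natr -natrM mulnb; congr (nat_of_bool _)%:R.
rewrite xpair_eqE xpair_eqE eqxx /=; congr (_ && _).
by apply/eqP/eqP => [/(congr1 (@nat_of_ord _))|->//]; rewrite !inordK.
Qed.

(** The product is the covariance of a noise vector with an earlier state, which involves only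
    noises of smaller index. *)
Lemma state_noise_orth l t s : (t <= s)%N -> (s <= T)%N ->
  noise_mx l s *m (state_mx l t)^T = 0.
Proof.
elim: t => [|t IH] ts sT /=; first by rewrite trmx0 mulmx0.
rewrite linearD/= trmx_mul mulmxDr mulmxA IH ?(ltnW ts)// mul0mx add0r.
by rewrite noise_mx_orth ?(leq_trans (ltnW ts))// gtn_eqF// raddf0.
Qed.

Lemma noise_fro2 l s p (H : 'M[R]_(p, d)) : (s <= T)%N ->
  fro2 (H *m noise_mx l s) = fro2 H.
Proof.
move=> sT; rewrite -fro2_tr {1}/fro2 trmxK trmx_mul mulmxA -(mulmxA H).
by rewrite noise_mx_orth// eqxx mulmx1 -[RHS]fro2_tr /fro2 trmxK.
Qed.

(** The latest noise is orthogonal to the rest of the state and has identity covariance. Hence the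
    mean of the empirical form is at least T |h|^2. *)
Lemma state_fro2_ge l t p (H : 'M[R]_(p, d)) : (t <= T)%N ->
  fro2 H <= fro2 (H *m state_mx l t.+1).
Proof.
move=> tT; rewrite /= mulmxDr addrC fro2D noise_fro2// -addrA lerDl.
have -> : mdot (H *m noise_mx l t) (H *m (A l *m state_mx l t)) = 0.
  rewrite mdotC /mdot mxtrace_mulC !trmx_mul !mulmxA -(mulmxA H (noise_mx _ _)).
  by rewrite state_noise_orth// mulmx0 !mul0mx mxtrace0.
by rewrite mulr0 addr0 fro2_ge0.
Qed.

Let Delta_gt0 : 0 < Delta. Proof. by rewrite exprn_gt0// subr_gt0. Qed.

(** A deterministic bound for every [y]: the map from the noise to the whole trajectory has operator
    norm at most Delta^(-1/2). *)
Lemma state_sum_le (y : 'cV[R]_n) :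
  \sum_l \sum_(t < T.+1) fro2 (state_mx l t.+1 *m y) <= fro2 y / Delta.
Proof.
rewrite -noise_mx_fro2 mulr_suml; apply: ler_sum => l _.
set S := \sum_(t < T.+1) _; set W := \sum_(s < T.+1) _.
(* The initial state is 0, so the sum shifted by one step is again bounded by [S]. *)
have S0 : \sum_(t < T.+1) fro2 (state_mx l t *m y) <= S.
  rewrite big_ord_recl {1}/fro2 /= mul0mx mulmx0 mxtrace0 add0r /S big_ord_recr/=.
  by rewrite lerDl fro2_ge0.
have : S <= rho * S + W / (1 - rho).
  apply: (@le_trans _ _ (rho * (\sum_(t < T.+1) fro2 (state_mx l t *m y)) + W / (1 - rho))).
    rewrite mulr_sumr mulr_suml -big_split; apply: ler_sum => t _ /=.
    rewrite mulmxDl; apply: contraction_step => //; first exact: fro2_ge0.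
    by rewrite -mulmxA; exact: Arho.
  by rewrite lerD2r ler_wpM2l.
have r1' : 0 < 1 - rho by rewrite subr_gt0.
move=> h; rewrite ler_pdivlMr// /Delta expr2 mulrA -ler_pdivlMr//.
by move: h; rewrite mulrBr mulr1 [S * rho]mulrC; lra.
Qed.

Lemma state_fro2_le l t p (u : 'M[R]_(p, d)) : (t <= T.+1)%N ->
  fro2 (u *m state_mx l t) <= fro2 u / Delta.
Proof.
case: t => [|t] tT.
  by rewrite /= mulmx0 /fro2 mulmx0 mxtrace0 divr_ge0 ?fro2_ge0// ltW.
rewrite mulrC; apply: fro2_mulmx_tr_rows => [|y]; first by rewrite invr_ge0 ltW.
rewrite mulrC; apply: le_trans (state_sum_le y).
rewrite (bigD1 l)//= (bigD1 (Ordinal tT))//= -addrA lerDl.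
by apply: addr_ge0; [|apply: sumr_ge0 => ? _]; apply: sumr_ge0 => ? _; exact: fro2_ge0.
Qed.

Notation blocks := ('I_m * 'I_T)%type.

Lemma block_sum_le p (H : 'I_m -> 'M[R]_(p, d)) a (y : 'cV[R]_n) :
  0 <= a -> (forall l, fro2 (H l) <= a) ->
  \sum_(i : blocks) fro2 (H i.1 *m state_mx i.1 i.2.+1 *m y) <= a * (fro2 y / Delta).
Proof.
move=> a0 Ha.
apply: (@le_trans _ _ (a * \sum_(i : blocks) fro2 (state_mx i.1 i.2.+1 *m y))).
  rewrite mulr_sumr; apply: ler_sum => i _; rewrite -mulmxA.
  by apply: (le_trans (fro2_mulmx_le _ _)); rewrite ler_wpM2r ?fro2_ge0.
rewrite ler_wpM2l//; apply: le_trans (state_sum_le y).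
rewrite -(pair_bigA _ (fun l (t : 'I_T) => fro2 (state_mx l t.+1 *m y)))/=.
by apply: ler_sum => l _; rewrite [leRHS]big_ord_recr/= lerDl fro2_ge0.
Qed.

(** * Tail bounds for forms in the trajectories *)

Section events.
Context {disp : measure_display} {Omega : measurableType disp}.
Variables (P : probability Omega R) (xi : 'I_n -> Omega -> R).
Hypothesis hxi : iid_normal P xi.

(** Chernoff bound at a free parameter [s], limited by the operator norm of U^T V. Its Frobenius
    norm is split as the operator norm of [U] times the Frobenius norm of [V]. *)
Lemma bilinear_tail p (U V : 'M[R]_(p, n)) (al be s c : R) :
  0 <= al -> 0 < s -> 0 <= be -> 4 * s * be <= 1 ->
  (forall y : 'cV_n, fro2 (U *m y) <= al * fro2 y) ->
  (forall y : 'cV_n, `|mdot (U *m y) (V *m y)| <= be * fro2 y) ->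
  fails_with P (2 * expR (- c)) (fun om =>
    `|mdot (U *m colv xi om) (V *m colv xi om) - mdot U V|
    <= c / s + 4 * s * al * fro2 V).
Proof.
move=> al0 s0 be0 sbe Ual UVbe.
pose N := U^T *m V.
have qN y : qform N y = mdot (U *m y) (V *m y).
  by rewrite /qform /mdot /N trmx_mul !mulmxA.
have Nf : fro2 N <= al * fro2 V.
  rewrite /N fro2_mulmx_cols [fro2 V]fro2_cols mulr_sumr; apply: ler_sum => i _.
  by apply: fro2_tr_mulmx_le.
have half (e : R) : e ^+ 2 = 1 -> fails_with P (expR (- c)) (fun om =>
    e * s * (qform N (colv xi om) - \tr N) - 4 * (s ^+ 2 * (al * fro2 V)) <= c).
  move=> e1; have ne : `|e| = 1 by apply/eqP; rewrite -sqr_norm_eq1 e1.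
  have mq : measurable_fun setT (fun om => qform N (colv xi om)).
    by apply: measurable_qform; case: hxi.
  apply: fails_with_exp.
    by apply: measurable_funB => //; apply: measurable_funM => //; exact: measurable_funB.
  pose N1 := (e * s) *: N.
  have N1small y : 4 * `|qform N1 y| <= fro2 y.
    rewrite qformZ qN !normrM ne mul1r (gtr0_norm s0).
    have := ler_wpM2l (ltW s0) (UVbe y) => h.
    have := ler_wpM2r (fro2_ge0 y) sbe; lra.
  have := gaussian_bilinear_mgf hxi N1small.
  set K := expR _ => hK; have K0 : 0 < K by exact: expR_gt0.
  have meg : measurable_fun setT (fun om => expR (qform N1 (colv xi om))).
    by apply: measurableT_comp => //; apply: measurable_qform; case: hxi.
  apply: (@le_trans _ _ (\int[P]_om (K^-1%:E * (expR (qform N1 (colv xi om)))%:E))%E).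
    apply: ge0_le_integral => //.
    - apply/measurable_EFinP; apply: measurableT_comp => //.
      by apply: measurable_funB => //; apply: measurable_funM => //; exact: measurable_funB.
    - by apply/measurable_EFinP; exact: measurable_funM.
    - move=> om _; rewrite -EFinM lee_fin /K -expRN -expRD ler_expR.
      rewrite /N1 mxtraceZ qformZ fro2Z exprMn e1 mul1r.
      by have := ler_wpM2l (sqr_ge0 s) Nf; lra.
  rewrite ge0_integralZl//; last 2 first.
  - exact/measurable_EFinP.
  - by rewrite lee_fin invr_ge0 ltW.
  rewrite -(lee_pmul2l (_ : K%:E \is a fin_num)) ?lte_fin//.
  by rewrite muleA -EFinM divff ?gt_eqF// mul1e mule1.
have h1 := half 1 (expr1n _ _).
have h2 : fails_with P (expR (- c)) (fun om => (-1) * s *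
    (qform N (colv xi om) - \tr N) - 4 * (s ^+ 2 * (al * fro2 V)) <= c).
  by apply: half; rewrite sqrrN expr1n.
have := fails_with_and h1 h2; apply: fails_with_le; first by lra.
move=> om; rewrite -qN -/(\tr N) => -[]; rewrite mul1r mulN1r mulNr.
rewrite /mdot -/N; set D := qform N _ - _ => g1 g2.
have -> : c / s + 4 * s * al * fro2 V = (c + 4 * (s ^+ 2 * (al * fro2 V))) / s.
  by field; rewrite gt_eqF.
rewrite ler_norml; apply/andP; split.
  by rewrite lerNl ler_pdivlMr// mulNr mulrC; lra.
by rewrite ler_pdivlMr// mulrC; lra.
Qed.

(** [U] is left free to serve both noise rows, with [th] = 1, and state rows, with [th] =
    Delta^(-1/2). The weights are a column of the pseudoinverse or constantly 1. *)
Lemma weighted_bilinear_tail (U : blocks -> 'rV[R]_n) (c : 'I_m -> R)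
    (g th c0 : R) (j : 'I_d) :
  (0 < T)%N -> 0 < g -> 0 < th -> \sum_l c l ^+ 2 <= g ^+ 2 ->
  (forall y : 'cV_n, \sum_i fro2 (U i *m y) <= th ^+ 2 * fro2 y) ->
  fails_with P (2 * expR (- c0)) (fun om =>
    `|\sum_(i : blocks) c i.1 * ((U i *m colv xi om) ord0 ord0
         * (state_mx i.1 i.2.+1 *m colv xi om) j ord0)
      - \sum_(i : blocks) c i.1 * (U i *m (row j (state_mx i.1 i.2.+1))^T) ord0 ord0|
    <= g * th * Num.sqrt (T%:R / Delta) * (4 * c0 + 1)).
Proof.
move=> T0 g0 th0 cg Uth.
pose V (i : blocks) : 'rV[R]_n := c i.1 *: row j (state_mx i.1 i.2.+1).
have VE i : V i = (c i.1 *: row j 1%:M) *m state_mx i.1 i.2.+1.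
  by rewrite -scalemxAl -row_mul mul1mx.
have Hrow l : fro2 (c l *: row j (1%:M : 'M[R]_d)) = c l ^+ 2.
  rewrite fro2Z fro2E big_ord1 (bigD1 j)//= !mxE eqxx expr1n big1 ?addr0 ?mulr1//.
  by move=> k kj; rewrite !mxE eq_sym (negbTE kj) expr0n.
have cl l : c l ^+ 2 <= g ^+ 2.
  apply: le_trans cg; rewrite (bigD1 l)//= lerDl.
  by apply: sumr_ge0 => k _; exact: sqr_ge0.
have Vop (y : 'cV_n) : fro2 (rowstack V *m y) <= g ^+ 2 / Delta * fro2 y.
  rewrite rowstack_mulmx fro2_rowstack.
  under eq_bigr do rewrite VE.
  have -> : g ^+ 2 / Delta * fro2 y = g ^+ 2 * (fro2 y / Delta).
    by rewrite mulrAC -mulrA.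
  apply: (@block_sum_le 1 (fun l => c l *: row j 1%:M)); first exact: sqr_ge0.
  by move=> l; rewrite Hrow.
have Vfro : fro2 (rowstack V) <= g ^+ 2 * (T%:R / Delta).
  rewrite fro2_rowstack; under eq_bigr do rewrite VE.
  apply: (@le_trans _ _ (\sum_(i : blocks) c i.1 ^+ 2 / Delta)).
    apply: ler_sum => i _; rewrite -Hrow; apply: state_fro2_le.
    by rewrite ltnS ltnW.
  rewrite -(pair_bigA _ (fun l (t : 'I_T) => c l ^+ 2 / Delta))/=.
  under eq_bigr do rewrite sumr_const card_ord -mulr_natr -mulrA.
  rewrite -mulr_suml [_ / _]mulrC ler_wpM2r//.
  by rewrite mulr_ge0// invr_ge0 ltW.
have Uop (y : 'cV_n) : fro2 (rowstack U *m y) <= th ^+ 2 * fro2 y.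
  by rewrite rowstack_mulmx fro2_rowstack.
pose q := Num.sqrt Delta; have q0 : 0 < q by rewrite sqrtr_gt0.
have q2 : q ^+ 2 = Delta by rewrite sqr_sqrtr// ltW.
pose r := Num.sqrt (T%:R : R).
have r1 : 1 <= r by rewrite /r -{1}sqrtr1 ler_wsqrtr// ler1n.
have r0 : 0 < r by apply: lt_le_trans r1.
have r2 : r ^+ 2 = T%:R by rewrite sqr_sqrtr.
(* With this choice the variance term equals g th sqrt (T / Delta) and c0 / s is 4 c0 times that;
   the operator norm condition becomes 1 / sqrt T <= 1. *)
pose s := q / (4 * g * th * r).
have s0 : 0 < s by rewrite divr_gt0// !mulr_gt0.
have UVop (y : 'cV_n) : `|mdot (rowstack U *m y) (rowstack V *m y)|
    <= th * g / q * fro2 y.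
  have B0 : 0 <= th * g / q * fro2 y.
    by rewrite mulr_ge0 ?fro2_ge0// divr_ge0 ?(ltW q0)// mulr_ge0// ltW.
  rewrite -[leRHS]ger0_norm// -ler_sqr ?nnegrE// !real_normK ?num_real//.
  apply: (le_trans (cauchy_schwarz_mdot _ _)).
  apply: (le_trans (ler_pM (fro2_ge0 _) (fro2_ge0 _) (Uop y) (Vop y))).
  rewrite -q2 le_eqVlt; apply/orP; left; apply/eqP; field; by rewrite gt_eqF.
have small : 4 * s * (th * g / q) <= 1.
  have -> : 4 * s * (th * g / q) = r^-1.
    by rewrite /s; field; rewrite !gt_eqF.
  by rewrite invf_le1.
have := @bilinear_tail _ (rowstack U) (rowstack V) (th ^+ 2) (th * g / q) s c0
  (sqr_ge0 _) s0 _ small Uop UVop.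
have b0 : 0 <= th * g / q by rewrite divr_ge0 ?(ltW q0)// mulr_ge0// ltW.
move=> /(_ b0); apply: fails_with_le => // om.
have e1 (y : 'cV[R]_n) : mdot (rowstack U *m y) (rowstack V *m y) = \sum_(i : blocks)
    c i.1 * ((U i *m y) ord0 ord0 * (state_mx i.1 i.2.+1 *m y) j ord0).
  rewrite !rowstack_mulmx mdot_rowstack; apply: eq_bigr => i _.
  rewrite mdotE !big_ord1 /V -scalemxAl -row_mul.
  have -> (M : 'M[R]_(d, 1)) e : (e *: row j M) ord0 ord0 = e * M j ord0.
    by rewrite !mxE.
  by rewrite mulrCA.
have e2 : mdot (rowstack U) (rowstack V) = \sum_(i : blocks)
    c i.1 * (U i *m (row j (state_mx i.1 i.2.+1))^T) ord0 ord0.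
  rewrite mdot_rowstack; apply: eq_bigr => i _.
  rewrite mdotC /mdot /V linearZ/= -scalemxAl mxtraceZ mxtrace_mulC.
  by rewrite /mxtrace big_ord1.
rewrite e1 e2 => /le_trans; apply.
have -> : Num.sqrt (T%:R / Delta) = r / q by rewrite sqrtrM// sqrtrV// ltW.
have := ler_wpM2l (_ : 0 <= 4 * s * th ^+ 2) Vfro => h.
have s4 : 0 <= 4 * s * th ^+ 2 by rewrite mulr_ge0 ?sqr_ge0// mulr_ge0// ltW.
have := h s4; rewrite -r2 -q2 => h2.
have -> : g * th * (r / q) * (4 * c0 + 1) = c0 / s +
    4 * s * th ^+ 2 * (g ^+ 2 * (r ^+ 2 / q ^+ 2)).
  by rewrite /s; field; rewrite !gt_eqF.
by rewrite lerD2l.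
Qed.

(* Rescaling by [Delta / a] makes the block map a contraction. *)
Lemma block_chaos_l1_ball p N (Hj : 'I_N -> 'I_m -> 'M[R]_(p, d)) (a K L u Rb : R) :
  let H (w : 'cV[R]_N) l := \sum_j w j ord0 *: Hj j l in
  0 < a -> (forall w l, fro2 (H w l) <= a * fro2 w) ->
  1 <= K -> 0 <= u -> 1 <= L -> 2 * N%:R * expR (- L) <= 1 -> 0 <= Rb ->
  fails_with P (expR (- u)) (fun om => forall w : 'cV[R]_N, l1norm w <= 1 ->
    \sum_(i : blocks) fro2 (H w i.1 *m state_mx i.1 i.2.+1) <= Rb ->
    `|\sum_(i : blocks) fro2 (H w i.1 *m state_mx i.1 i.2.+1 *m colv xi om)
      - \sum_(i : blocks) fro2 (H w i.1 *m state_mx i.1 i.2.+1)|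
    <= a / Delta * (120 * (35 * (32 * K) * (L + u))) + Rb / K).
Proof.
move=> H a0 Ha K1 u0 L1 LN Rb0.
pose b := Delta / a; have b0 : 0 < b by rewrite divr_gt0.
pose sb := Num.sqrt b; have sb2 : sb ^+ 2 = b by rewrite sqr_sqrtr// ltW.
pose Fj j := sb *: rowstack (fun i : blocks => Hj j i.1 *m state_mx i.1 i.2.+1).
have FE (w : 'cV[R]_N) : \sum_j w j ord0 *: Fj j =
    sb *: rowstack (fun i : blocks => H w i.1 *m state_mx i.1 i.2.+1).
  under eq_bigr do rewrite scalerA mulrC -scalerA.
  rewrite -scaler_sumr rowstack_lin; congr (_ *: rowstack _); apply/funext => i.
  by rewrite /H mulmx_suml; apply: eq_bigr => j _; rewrite -scalemxAl.
have Fb (w : 'cV[R]_N) (y : 'cV_n) : fro2 ((\sum_j w j ord0 *: Fj j) *m y) <= fro2 w * fro2 y.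
  rewrite FE -scalemxAl fro2Z sb2 rowstack_mulmx fro2_rowstack.
  have := @block_sum_le p (H w) (a * fro2 w) y; rewrite mulr_ge0 ?fro2_ge0 ?(ltW a0)//.
  move=> /(_ isT (Ha w)) /(ler_wpM2l (ltW b0)) /le_trans; apply.
  rewrite /b le_eqVlt; apply/orP; left; apply/eqP; field.
  by rewrite !gt_eqF.
have bR0 : 0 <= b * Rb by rewrite mulr_ge0// ltW.
have := quadratic_chaos_l1_ball hxi Fb L1 LN bR0 K1 u0.
apply: fails_with_le => // om h w w1 wRb; have := h w w1.
rewrite FE -scalemxAl !fro2Z sb2 rowstack_mulmx !fro2_rowstack ler_pM2l// => /(_ wRb).
rewrite -mulrBr normrM gtr0_norm// -ler_pdivlMl//= => /le_trans; apply.
rewrite mulrDr /b invf_div lerD2l mulrCA le_eqVlt; apply/orP; left; apply/eqP.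
by field; rewrite !gt_eqF// (lt_le_trans _ K1).
Qed.

End events.

End linear_system.

(** * Norms, graphs and vectorization *)

Section norms_and_graphs.
Context {R : realType}.

Lemma l2normE p (x : 'cV[R]_p) : l2norm x = Num.sqrt (fro2 x).
Proof. by rewrite /l2norm fro2E; congr Num.sqrt; apply: eq_bigr => i _; rewrite big_ord1. Qed.

Lemma sqr_l2norm p (x : 'cV[R]_p) : l2norm x ^+ 2 = fro2 x.
Proof. by rewrite l2normE sqr_sqrtr ?fro2_ge0. Qed.

Lemma l2norm_ge0 p (x : 'cV[R]_p) : 0 <= l2norm x.
Proof. exact: sqrtr_ge0. Qed.

Lemma l1norm_l2norm p (x : 'cV[R]_p) : l1norm x <= Num.sqrt p%:R * l2norm x.
Proof.
have l0 : 0 <= l1norm x by apply: sumr_ge0.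
rewrite l2normE -sqrtrM// -[leLHS]ger0_norm// -sqrtr_sqr ler_wsqrtr//.
have := cauchy_schwarz_mdot (const_mx 1 : 'cV[R]_p) (\col_i `|x i ord0|).
rewrite mdotE !fro2E.
under eq_bigr do rewrite big_ord1 !mxE mul1r.
under [X in _ <= X * _]eq_bigr do rewrite big_ord1 !mxE expr1n.
rewrite sumr_const card_ord.
under [X in _ <= _ * X]eq_bigr do rewrite big_ord1 !mxE real_normK ?num_real//.
by under [X in _ -> _ <= _ * X]eq_bigr do rewrite big_ord1.
Qed.

(** The supremum is over a set bounded by the Frobenius norm; nonnegativity of [rho] comes from the
    image of 0. *)
Lemma spectral_norm_le p q (A : 'M[R]_(p, q)) rho : spectral_norm A <= rho ->
  0 <= rho /\ forall z : 'cV_q, fro2 (A *m z) <= rho ^+ 2 * fro2 z.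
Proof.
move=> Arho.
have unit (x : 'cV_q) : l2norm x <= 1 -> l2norm (A *m x) <= rho.
  move=> x1; apply: le_trans Arho; apply: ub_le_sup; last by exists x.
  exists (Num.sqrt (fro2 A)) => _ [z /= z1 <-].
  rewrite l2normE ler_wsqrtr//; apply: (le_trans (fro2_mulmx_le _ _)).
  rewrite ler_piMr ?fro2_ge0// -sqr_l2norm -[leRHS](expr1n _ 2).
  by rewrite ler_sqr ?nnegrE ?l2norm_ge0.
have zero : l2norm (0 : 'cV[R]_q) = 0 by rewrite l2normE /fro2 mulmx0 mxtrace0 sqrtr0.
split.
  by apply: le_trans (unit 0 _); rewrite ?l2norm_ge0// zero.
move=> z; have [z0|z0] := eqVneq (l2norm z) 0.
  have : fro2 z = 0 by rewrite -sqr_l2norm z0 expr0n.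
  move/eqP; rewrite fro2_eq0 => /eqP ->.
  by rewrite mulmx0 /fro2 !mulmx0 !mxtrace0 mulr0.
have zp : 0 < l2norm z by rewrite lt_neqAle eq_sym z0 l2norm_ge0.
have := unit ((l2norm z)^-1 *: z).
have r0 : 0 <= rho by apply: le_trans (unit 0 _); rewrite ?l2norm_ge0// zero.
rewrite -(ler_sqr (l2norm_ge0 _) (ler01)) -(ler_sqr (l2norm_ge0 _) r0).
rewrite !sqr_l2norm -scalemxAr !fro2Z exprVn -sqr_l2norm mulVf ?expf_neq0// expr1n.
move=> /(_ (lexx _)); rewrite ler_pdivrMl ?exprn_gt0//.
by rewrite sqr_l2norm mulrC.
Qed.

Lemma max_col_norm_ge p q (A : 'M[R]_(p, q)) j :
  \sum_i A i j ^+ 2 <= max_col_norm A ^+ 2.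
Proof.
have h : l2norm (col j A) <= max_col_norm A by exact: le_bigmax.
have := ler_wpM2l (l2norm_ge0 (col j A)) h.
have := ler_wpM2r (le_trans (l2norm_ge0 _) h) h.
rewrite -!expr2 sqr_l2norm => h1 h2; apply: le_trans (le_trans h2 h1).
by rewrite fro2E; apply: ler_sum => i _; rewrite big_ord1 mxE.
Qed.

Lemma max_row_norm_ge p q (A : 'M[R]_(p, q)) i :
  \sum_j A i j ^+ 2 <= max_row_norm A ^+ 2.
Proof.
have h : l2norm (row i A)^T <= max_row_norm A by exact: le_bigmax.
have := ler_wpM2l (l2norm_ge0 (row i A)^T) h.
have := ler_wpM2r (le_trans (l2norm_ge0 _) h) h.
rewrite -!expr2 sqr_l2norm => h1 h2; apply: le_trans (le_trans h2 h1).
by rewrite fro2E; apply: ler_sum => j _; rewrite big_ord1 !mxE.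
Qed.

Lemma max_col_norm_gt0 p q (A : 'M[R]_(p, q)) : A != 0 -> 0 < max_col_norm A.
Proof.
move=> A0; rewrite ltNge; apply/negP => m0; move/negP: A0; apply; apply/eqP/matrixP.
move=> i j; rewrite mxE; apply/eqP; rewrite -sqrf_eq0 eq_le sqr_ge0 andbT.
have -> : 0 = max_col_norm A ^+ 2 :> R.
  apply/esym/eqP; rewrite sqrf_eq0 eq_le m0 /=.
  exact: bigmax_ge_id.
apply: le_trans (max_col_norm_ge A j); rewrite (bigD1 i)//= lerDl.
by apply: sumr_ge0 => k _; exact: sqr_ge0.
Qed.

Lemma max_row_norm_gt0 p q (A : 'M[R]_(p, q)) : A != 0 -> 0 < max_row_norm A.
Proof.
move=> A0; rewrite ltNge; apply/negP => m0; move/negP: A0; apply; apply/eqP/matrixP.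
move=> i j; rewrite mxE; apply/eqP; rewrite -sqrf_eq0 eq_le sqr_ge0 andbT.
have -> : 0 = max_row_norm A ^+ 2 :> R.
  apply/esym/eqP; rewrite sqrf_eq0 eq_le m0 /=.
  exact: bigmax_ge_id.
apply: le_trans (max_row_norm_ge A i); rewrite (bigD1 j)//= lerDl.
by apply: sumr_ge0 => k _; exact: sqr_ge0.
Qed.

Lemma l1norm_on_le p (S : {set 'I_p}) (x : 'cV[R]_p) : l1norm_on S x <= l1norm x.
Proof. by rewrite /l1norm (bigID (mem S))/= lerDl; apply: sumr_ge0. Qed.

Lemma l1norm_onC p (S : {set 'I_p}) (x : 'cV[R]_p) :
  l1norm x = l1norm_on S x + l1norm_on (~: S)%SET x.
Proof.
rewrite /l1norm (bigID (mem S))/=; congr (_ + _).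
by apply: eq_bigl => i; rewrite inE.
Qed.

Lemma compatibility_ge0 n p (Dt : 'M[R]_(p, n)) S : 0 <= compatibility Dt S.
Proof.
rewrite /compatibility; case: ifP => // _; set E := [set _ | _ in _].
have [[x Ex]|/nonemptyPn ->] := pselect (E !=set0); last by rewrite inf0.
apply: lb_le_inf; first by exists x.
move=> _ [th _ <-]; rewrite divr_ge0 ?mulr_ge0 ?sqrtr_ge0//.
by apply: sumr_ge0.
Qed.

(** The substance is that the infimum is positive as soon as some denominator is nonzero, since
    division by 0 would make the right-hand side 0. The bound l1 <= C l2 in finite dimension keeps
    the ratios away from 0. *)
Lemma compatibilityP n p (Dt : 'M[R]_(p, n)) S (th : 'cV[R]_n) :
  l1norm_on S (Dt *m th) <= Num.sqrt #|S|%:R / compatibility Dt S * l2norm th.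
Proof.
have on0 (x : 'cV[R]_p) : 0 <= l1norm_on S x by apply: sumr_ge0.
have [S0|S0] := eqVneq S finset.set0.
  rewrite {1}S0 /l1norm_on big_set0.
  by rewrite mulr_ge0 ?l2norm_ge0// divr_ge0 ?sqrtr_ge0 ?compatibility_ge0.
have [z0|z0] := eqVneq (l1norm_on S (Dt *m th)) 0.
  by rewrite z0 mulr_ge0 ?l2norm_ge0// divr_ge0 ?sqrtr_ge0 ?compatibility_ge0.
set kap := compatibility Dt S.
have kE : kap = inf [set Num.sqrt #|S|%:R * l2norm th / l1norm_on S (Dt *m th)
     | th in [set th : 'cV[R]_n | l1norm_on S (Dt *m th) != 0]].
  by rewrite /kap /compatibility (negbTE S0).
pose s : R := Num.sqrt #|S|%:R.
have s0 : 0 < s by rewrite sqrtr_gt0 ltr0n card_gt0.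
pose C : R := Num.sqrt p%:R * Num.sqrt (fro2 Dt).
have C0 : 0 <= C by rewrite mulr_ge0 ?sqrtr_ge0.
have hC (u : 'cV[R]_n) : l1norm_on S (Dt *m u) <= C * l2norm u.
  apply: (le_trans (l1norm_on_le _ _)); apply: (le_trans (l1norm_l2norm _)).
  rewrite -mulrA ler_wpM2l ?sqrtr_ge0// !l2normE -sqrtrM ?fro2_ge0//.
  by rewrite ler_wsqrtr// fro2_mulmx_le.
have pos (u : 'cV[R]_n) : l1norm_on S (Dt *m u) != 0 -> 0 < l1norm_on S (Dt *m u).
  by move=> u0; rewrite lt_neqAle eq_sym u0 on0.
have Cp : 0 < C.
  rewrite lt_neqAle C0 andbT eq_sym; apply/negP => /eqP CE.
  by have := hC th; rewrite CE mul0r leNgt pos.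
have kp : 0 < kap.
  apply: (@lt_le_trans _ _ (s / C)); first by rewrite divr_gt0.
  rewrite kE; apply: lb_le_inf; first by exists (s * l2norm th / l1norm_on S (Dt *m th)), th.
  move=> _ [u /= u0 <-]; rewrite ler_pdivlMr ?pos// mulrAC ler_pdivrMr// -mulrA.
  by rewrite ler_pM2l// mulrC.
have : kap <= s * l2norm th / l1norm_on S (Dt *m th).
  rewrite kE; apply: ge_inf; last by exists th.
  exists 0 => _ [u _ <-].
  by rewrite divr_ge0 ?mulr_ge0 ?l2norm_ge0 ?on0// ltW.
rewrite ler_pdivlMr ?pos// -/s => h.
by rewrite mulrAC ler_pdivlMr// mulrC.
Qed.

(** * Incidence matrices of connected graphs *)

Section incidence.
Variables (m : nat) (E : {set {set 'I_m}}).
Variables (tgt src : 'I_#|E| -> 'I_m).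
Hypothesis hconn : connected_graph E.
Hypothesis horient : orientation tgt src.
Notation D := (incidence R tgt src).

Lemma incidence_mulmx p (c : 'M[R]_(m, p)) k j :
  (D *m c) k j = c (tgt k) j - c (src k) j.
Proof.
rewrite mxE; under eq_bigr do rewrite mxE mulrBl.
rewrite sumrB; congr (_ - _).
  rewrite (bigD1 (tgt k))//= eqxx mul1r big1 ?addr0// => i /negbTE ->.
  by rewrite mul0r.
rewrite (bigD1 (src k))//= eqxx mul1r big1 ?addr0// => i /negbTE ->.
by rewrite mul0r.
Qed.

Lemma incidence_ker p (c : 'M[R]_(m, p)) : D *m c = 0 ->
  forall i i' j, c i j = c i' j.
Proof.
move=> Dc i i' j; have edge a b : [set a; b]%SET \in E -> c a j = c b j.
  move=> abE; pose k := enum_rank_in abE [set a; b]%SET.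
  have kE : enum_val k = [set a; b]%SET by rewrite enum_rankK_in.
  have : c (tgt k) j = c (src k) j.
    by apply/eqP; rewrite -subr_eq0 -incidence_mulmx Dc mxE.
  have := horient k; rewrite kE => e.
  have: tgt k \in [set a; b]%SET by rewrite e !inE eqxx.
  have: src k \in [set a; b]%SET by rewrite e !inE eqxx orbT.
  have: a \in [set tgt k; src k]%SET by rewrite -e !inE eqxx.
  have: b \in [set tgt k; src k]%SET by rewrite -e !inE eqxx orbT.
  by rewrite !inE => /orP[]/eqP-> /orP[]/eqP-> // _ _ ->.
have /connectP[s] := hconn i i'.
elim: s i => [|a s IH] i /=; first by move=> _ ->.
by move=> /andP[ia sp] e; rewrite (edge _ _ ia); exact: IH.
Qed.

(** 1 - G D is the orthogonal projection on the kernel of D, which consists of the constants by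
    connectedness. Being symmetric with constant columns it is a constant matrix, and its action on
    the all-ones vector fixes the value. *)
Lemma incidence_pinv : (0 < m)%N ->
  pseudoinverse D *m D = 1%:M - const_mx m%:R^-1.
Proof.
move=> m0; have [h1 h2 h3 h4] := pseudoinverseP D; set G := pseudoinverse D in h1 h2 h3 h4 *.
pose Q : 'M[R]_m := 1%:M - G *m D.
have DQ : D *m Q = 0 by rewrite /Q mulmxBr mulmx1 mulmxA h1 subrr.
have Qsym : Q^T = Q by rewrite /Q linearB/= trmx1 h4.
have col := incidence_ker DQ.
have row i j j' : Q i j = Q i j' by rewrite -Qsym [LHS]mxE [RHS]mxE; exact: col.
have D1 : D *m (const_mx 1 : 'cV[R]_m) = 0.
  by apply/matrixP => k j; rewrite incidence_mulmx !mxE subrr.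
have Q1 : Q *m (const_mx 1 : 'cV[R]_m) = const_mx 1.
  by rewrite /Q mulmxBl mul1mx -mulmxA D1 mulmx0 subr0.
have QE i j : Q i j = m%:R^-1.
  move/matrixP: Q1 => /(_ i ord0); rewrite mxE.
  under eq_bigr do rewrite [const_mx _ _ _]mxE mulr1 (row i _ j).
  rewrite sumr_const card_ord [const_mx _ _ _]mxE -[_ *+ m]mulr_natr => h.
  by rewrite -[LHS](mulfK (_ : m%:R != 0)) ?pnatr_eq0 -?lt0n// h mul1r.
apply/matrixP => i j; rewrite -[LHS]opprK -[RHS]opprK; congr (- _).
have := QE i j; rewrite !mxE => h; rewrite -h; ring.
Qed.

Lemma pseudoinverse_incidence_neq0 : (1 < m)%N -> pseudoinverse D != 0.
Proof.
move=> m1; apply/eqP => G0; have := incidence_pinv (ltnW m1).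
rewrite G0 mul0mx => /matrixP.
move=> /(_ (Ordinal (ltnW m1)) (Ordinal m1)); rewrite !mxE => /eqP.
rewrite eq_sym subr_eq0 /= eq_sym invr_eq0 pnatr_eq0.
by case: m m1.
Qed.

Lemma edge_card_gt0 : (1 < m)%N -> (0 < #|E|)%N.
Proof.
move=> m1; rewrite lt0n; apply/negP => /eqP E0.
move/negP: (pseudoinverse_incidence_neq0 m1); apply; apply/eqP/matrixP => i k.
by have := ltn_ord k; rewrite {2}E0.
Qed.

End incidence.

End norms_and_graphs.

(** * Block matrices behind the vectorized unknowns *)

Section vectorization_facts.
Context {R : realType}.

Lemma sum_mxtens p q (f : 'I_(p * q) -> R) :
  \sum_k f k = \sum_i \sum_j f (mxtens_index (i, j)).
Proof.
rewrite pair_bigA (reindex_onto (@mxtens_index p q) (@mxtens_unindex p q)) /=; last first.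
  by move=> k _; rewrite mxtens_unindexK.
apply: eq_big => [[i j]|[i j] _] //=.
by rewrite mxtens_indexK eqxx.
Qed.

(** The column index is the outer one because [vec] stacks columns. *)
Definition unvec m d (h : 'cV[R]_(m * (d * d))) (l : 'I_m) : 'M[R]_d :=
  \matrix_(i, j) h (mxtens_index (l, mxtens_index (j, i))) ord0.

Lemma unvecB m d (h h' : 'cV[R]_(m * (d * d))) l :
  unvec (h - h') l = unvec h l - unvec h' l.
Proof. by apply/matrixP => i j; rewrite !mxE. Qed.

Lemma fro2_unvec m d (h : 'cV[R]_(m * (d * d))) : fro2 h = \sum_l fro2 (unvec h l).
Proof.
rewrite fro2E sum_mxtens; apply: eq_bigr => l _; rewrite sum_mxtens exchange_big/= fro2E.
by apply: eq_bigr => i _; apply: eq_bigr => j _; rewrite big_ord1 mxE.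
Qed.

Lemma unvec_stack m d (A : 'I_m -> 'M[R]_d) l :
  unvec (stack (fun l => vec (A l))) l = A l.
Proof. by apply/matrixP => i j; rewrite !mxE !mxtens_indexK. Qed.

Lemma residualE m d T (x : 'I_m -> nat -> 'cV[R]_d) (a : 'cV[R]_(m * (d * d))) :
  l2norm (response T x - design T x *m a) ^+ 2 =
  \sum_(i : 'I_m * 'I_T) fro2 (x i.1 i.2.+2 - unvec a i.1 *m x i.1 i.2.+1).
Proof.
rewrite sqr_l2norm fro2E sum_mxtens.
rewrite -(pair_bigA _ (fun l (t : 'I_T) => fro2 (x l t.+2 - unvec a l *m x l t.+1)))/=.
apply: eq_bigr => l _; rewrite sum_mxtens; apply: eq_bigr => t _.
rewrite fro2E; apply: eq_bigr => i _; rewrite !big_ord1 !mxE.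
congr ((_ - _) ^+ 2); first by rewrite !mxtens_indexK/= ?mxE.
rewrite sum_mxtens (bigD1 l)//= [X in _ + X]big1 ?addr0; last first.
  move=> l' ll'; rewrite big1// => k _; rewrite mxE !mxtens_indexK/=.
  by rewrite eq_sym (negbTE ll') mul0r.
rewrite sum_mxtens; apply: eq_bigr => j _.
rewrite (bigD1 i)//= [X in _ + X]big1 ?addr0; last first.
  move=> i' ii'; rewrite !mxE !mxtens_indexK/= eqxx ?mxE ?mxtens_indexK/=.
  by rewrite eq_sym (negbTE ii') mulr0 mul0r.
rewrite !mxE !mxtens_indexK/= eqxx ?mxE ?mxtens_indexK/= eqxx mulr1.
by rewrite mulrC.
Qed.

(** Block [l] of the image under [G *t 1] of the basis vector [k], an index made of an edge, a
    column and a row. *)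
Definition gain m q d (G : 'M[R]_(m, q)) (k : 'I_(q * (d * d))) (l : 'I_m) : 'M[R]_d :=
  G l (mxtens_unindex k).1 *:
    delta_mx (mxtens_unindex (mxtens_unindex k).2).2 (mxtens_unindex (mxtens_unindex k).2).1.

Lemma gain_sumE m q d (G : 'M[R]_(m, q)) (w : 'cV[R]_(q * (d * d))) l i j :
  (\sum_k w k ord0 *: gain G k l) i j =
  \sum_e G l e * w (mxtens_index (e, mxtens_index (j, i))) ord0.
Proof.
rewrite summxE sum_mxtens; apply: eq_bigr => e _; rewrite sum_mxtens.
rewrite (bigD1 j)//= [X in _ + X]big1 ?addr0; last first.
  move=> j' jj'; rewrite big1// => i' _; rewrite /gain !mxE !mxtens_indexK/=.
  by rewrite [j == _]eq_sym (negbTE jj') andbF !mulr0.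
rewrite (bigD1 i)//= [X in _ + X]big1 ?addr0; last first.
  move=> i' ii'; rewrite /gain !mxE !mxtens_indexK/=.
  by rewrite [i == _]eq_sym (negbTE ii') !mulr0.
by rewrite /gain !mxE !mxtens_indexK/= !eqxx mulr1 mulrC.
Qed.

(** Cauchy-Schwarz over the edges, entry by entry. This is how the row norms of the pseudoinverse,
    hence mu', control the chaos. *)
Lemma gain_fro2 m q d (G : 'M[R]_(m, q)) (w : 'cV[R]_(q * (d * d))) l :
  fro2 (\sum_k w k ord0 *: gain G k l) <= (\sum_e G l e ^+ 2) * fro2 w.
Proof.
rewrite fro2E; under eq_bigr do under eq_bigr do rewrite gain_sumE.
have -> : fro2 w = \sum_i \sum_j \sum_e w (mxtens_index (e, mxtens_index (j, i))) ord0 ^+ 2.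
  rewrite fro2E sum_mxtens; under eq_bigr do rewrite sum_mxtens exchange_big/=.
  rewrite exchange_big; apply: eq_bigr => i _ /=; rewrite exchange_big.
  by apply: eq_bigr => j _; apply: eq_bigr => e _; rewrite big_ord1.
rewrite mulr_sumr; apply: ler_sum => i _; rewrite mulr_sumr; apply: ler_sum => j _.
have := cauchy_schwarz_mdot (row l G)^T (\col_e w (mxtens_index (e, mxtens_index (j, i))) ord0).
have -> : mdot (row l G)^T (\col_e w (mxtens_index (e, mxtens_index (j, i))) ord0) =
   \sum_e G l e * w (mxtens_index (e, mxtens_index (j, i))) ord0.
  by rewrite mdotE; apply: eq_bigr => e _; rewrite big_ord1 !mxE.
have -> : fro2 (row l G)^T = \sum_e G l e ^+ 2.
  by rewrite fro2E; apply: eq_bigr => e _; rewrite big_ord1 !mxE.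
have -> : fro2 (\col_e w (mxtens_index (e, mxtens_index (j, i))) ord0) =
    \sum_e w (mxtens_index (e, mxtens_index (j, i))) ord0 ^+ 2.
  by rewrite fro2E; apply: eq_bigr => e _; rewrite big_ord1 !mxE.
exact.
Qed.

Definition mean_block m d (h : 'cV[R]_(m * (d * d))) : 'M[R]_d :=
  m%:R^-1 *: \sum_l unvec h l.

Lemma mean_block_fro2 m d (h : 'cV[R]_(m * (d * d))) : (0 < m)%N ->
  m%:R * fro2 (mean_block h) <= fro2 h.
Proof.
move=> m0; have mp : 0 < m%:R :> R by rewrite ltr0n.
have S : fro2 (\sum_l unvec h l) <= m%:R * fro2 h.
  have -> : fro2 h = \sum_i \sum_j \sum_l unvec h l i j ^+ 2.
    rewrite fro2_unvec (eq_bigr _ (fun l _ => fro2E _)) exchange_big.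
    by apply: eq_bigr => i _; rewrite exchange_big.
  rewrite fro2E mulr_sumr; apply: ler_sum => i _.
  rewrite mulr_sumr; apply: ler_sum => j _.
  have := cauchy_schwarz_mdot (const_mx 1 : 'cV[R]_m) (\col_l unvec h l i j).
  have -> : mdot (const_mx 1 : 'cV[R]_m) (\col_l unvec h l i j) = (\sum_l unvec h l) i j.
    by rewrite summxE mdotE; apply: eq_bigr => l _; rewrite big_ord1 !mxE mul1r.
  have -> : fro2 (const_mx 1 : 'cV[R]_m) = m%:R.
    rewrite fro2E; under eq_bigr do rewrite big_ord1 mxE expr1n.
    by rewrite sumr_const card_ord.
  have -> : fro2 (\col_l unvec h l i j) = \sum_l unvec h l i j ^+ 2.
    by rewrite fro2E; apply: eq_bigr => l _; rewrite big_ord1 mxE.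
  exact.
rewrite /mean_block fro2Z exprVn mulrA -ler_pdivlMl ?mulr_gt0 ?invr_gt0 ?exprn_gt0//.
apply: (le_trans S); rewrite le_eqVlt; apply/orP; left; apply/eqP; field.
by rewrite gt_eqF.
Qed.

Lemma unvec_split m q d (D : 'M[R]_(q, m)) (G : 'M[R]_(m, q))
    (h : 'cV[R]_(m * (d * d))) l :
  G *m D = 1%:M - const_mx m%:R^-1 ->
  unvec h l = mean_block h
    + \sum_k (D *t (1%:M : 'M[R]_(d * d)) *m h) k ord0 *: gain G k l.
Proof.
move=> GD; apply/matrixP => i j; rewrite [RHS]mxE gain_sumE.
set p := mxtens_index (j, i).
have wE e : (D *t (1%:M : 'M[R]_(d * d)) *m h) (mxtens_index (e, p)) ord0
    = \sum_l' D e l' * h (mxtens_index (l', p)) ord0.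
  rewrite mxE sum_mxtens; apply: eq_bigr => l' _.
  rewrite (bigD1 p)//= big1 ?addr0; last first.
    move=> p' pp'; rewrite !mxE !mxtens_indexK/= eq_sym (negbTE pp').
    by rewrite mulr0 mul0r.
  by rewrite !mxE !mxtens_indexK/= eqxx mulr1.
under eq_bigr do rewrite wE mulr_sumr.
rewrite exchange_big /=.
have -> : \sum_l' \sum_e G l e * (D e l' * h (mxtens_index (l', p)) ord0) =
    \sum_l' ((l == l')%:R - m%:R^-1) * h (mxtens_index (l', p)) ord0.
  apply: eq_bigr => l' _; move/matrixP: GD => /(_ l l').
  rewrite mxE !mxE => <-; rewrite mulr_suml.
  by apply: eq_bigr => e _; rewrite mulrA.
under eq_bigr do rewrite mulrBl.
rewrite sumrB -mulr_sumr (bigD1 l)//= eqxx mul1r [X in _ + (_ + X - _)]big1 ?addr0; last first.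
  by move=> l' /negbTE; rewrite eq_sym => ->; rewrite mul0r.
rewrite /mean_block !mxE summxE.
under [X in _ * X + _]eq_bigr do rewrite mxE.
by rewrite addrC subrK.
Qed.

End vectorization_facts.

(** * Restricted eigenvalues *)

Section deterministic.
Context {R : realType}.

Lemma mdot_mulmxr p q r (N : 'M[R]_(p, r)) (B : 'M[R]_(p, q)) (M : 'M[R]_(q, r)) :
  mdot N (B *m M) = mdot B (N *m M^T).
Proof.
rewrite /mdot mulmxA mxtrace_mulC mulmxA.
by rewrite -mxtrace_tr !trmx_mul !trmxK mxtrace_mulC mulmxA mxtrace_mulC mulmxA mxtrace_mulC.
Qed.

Lemma mdot_le p q (B Z : 'M[R]_(p, q)) (tau : R) : 0 <= tau ->
  (forall i j, `|Z i j| <= tau) ->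
  `|mdot B Z| <= Num.sqrt (fro2 B) * (Num.sqrt (p%:R * q%:R) * tau).
Proof.
move=> t0 Zt; have B0 := sqrtr_ge0 (fro2 B).
have rhs0 : 0 <= Num.sqrt (fro2 B) * (Num.sqrt (p%:R * q%:R) * tau).
  by rewrite !mulr_ge0 ?sqrtr_ge0.
rewrite -[leRHS]ger0_norm// -ler_sqr ?nnegrE// !real_normK ?num_real//.
apply: (le_trans (cauchy_schwarz_mdot _ _)).
rewrite !exprMn !sqr_sqrtr ?fro2_ge0 ?mulr_ge0// ler_wpM2l ?fro2_ge0//.
rewrite fro2E; apply: (@le_trans _ _ (\sum_(i < p) \sum_(j < q) tau ^+ 2)).
  apply: ler_sum => i _; apply: ler_sum => j _.
  by rewrite -real_normK ?num_real// ler_sqr ?nnegrE.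
under eq_bigr do rewrite sumr_const card_ord.
by rewrite sumr_const card_ord -mulrnA -[leLHS]mulr_natl natrM [X in X * _]mulrC.
Qed.

(** Duality of l1 and sup norm: each coordinate of [w] multiplies one entry of a sum of the [Z]
    weighted by a column of [G]. The column norms, hence mu, enter through [tau]. *)
Lemma gain_dot_le (I : finType) m q d (G : 'M[R]_(m, q)) (w : 'cV[R]_(q * (d * d)))
    (l : I -> 'I_m) (Z : I -> 'M[R]_d) (tau : R) :
  (forall e i j, `|\sum_b G (l b) e * Z b i j| <= tau) ->
  `|\sum_b mdot (\sum_k w k ord0 *: gain G k (l b)) (Z b)| <= tau * l1norm w.
Proof.
move=> Zt.
have -> : \sum_b mdot (\sum_k w k ord0 *: gain G k (l b)) (Z b) =
    \sum_k w k ord0 * (\sum_b G (l b) (mxtens_unindex k).1 * Z b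
      (mxtens_unindex (mxtens_unindex k).2).2 (mxtens_unindex (mxtens_unindex k).2).1).
  under [RHS]eq_bigr do rewrite mulr_sumr.
  rewrite [RHS]exchange_big; apply: eq_bigr => b _ /=.
  rewrite mdotC /mdot mulmx_sumr raddf_sum; apply: eq_bigr => k _ /=.
  rewrite /gain -!scalemxAr !mxtraceZ; congr (_ * (_ * _)).
  set i := _.2; set j := _.1; rewrite -/(mdot (Z b) (delta_mx i j)) mdotE.
  rewrite (bigD1 i)//= (bigD1 j)//= mxE !eqxx mulr1.
  rewrite [X in (_ + X) + _]big1 ?addr0; last first.
    by move=> j' jj'; rewrite mxE (negbTE jj') andbF mulr0.
  rewrite big1 ?addr0// => i' ii'.
  by rewrite big1// => j' _; rewrite mxE (negbTE ii') mulr0.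
apply: (le_trans (ler_norm_sum _ _ _)); rewrite /l1norm mulr_sumr.
by apply: ler_sum => k _; rewrite normrM mulrC ler_wpM2r.
Qed.

Section restricted_eigenvalue.
Variables (m T d n q : nat).
Notation blocks := ('I_m * 'I_T)%type.
Variables (X : blocks -> 'M[R]_(d, n)) (y : 'cV[R]_n).
Variables (D : 'M[R]_(q, m)) (G : 'M[R]_(m, q)).
Hypothesis GD : G *m D = 1%:M - const_mx m%:R^-1.
Hypothesis m0 : (0 < m)%N.

Let Dt := D *t (1%:M : 'M[R]_(d * d)).

Let dev p (H : 'I_m -> 'M[R]_(p, d)) : R :=
  \sum_(b : blocks) fro2 (H b.1 *m X b *m y) - \sum_(b : blocks) fro2 (H b.1 *m X b).

(** The mean of the form is at least T |h|^2. The mean part, the part carried by [w] and the cross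
    terms each deviate by at most T |h|^2 / 32, which leaves more than half. *)
Lemma restricted_eigenvalue (h : 'cV[R]_(m * (d * d))) (Phi tau : R) :
  (forall b (H : 'M[R]_d), fro2 H <= fro2 (H *m X b)) ->
  (forall u : 'rV[R]_d, `|dev (fun=> u)| <= fro2 u * (m%:R * T%:R / 32)) ->
  `|dev (fun l => \sum_k (Dt *m h) k ord0 *: gain G k l)| <= fro2 h * (T%:R / 32) ->
  0 <= tau ->
  (forall e i j, `|\sum_(b : blocks) G b.1 e *
     ((X b *m y) *m (X b *m y)^T - X b *m (X b)^T) i j| <= tau) ->
  0 <= Phi -> l1norm (Dt *m h) <= 4 * Phi * l2norm h ->
  8 * Phi * Num.sqrt d%:R * tau <= Num.sqrt m%:R * (T%:R / 32) ->
  T%:R / 2 * fro2 h <= \sum_(b : blocks) fro2 (unvec h b.1 *m (X b *m y)).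
Proof.
move=> XH devB devW tau0 devG Phi0 cone tauT.
set w := Dt *m h in devW cone *.
pose B := mean_block h; pose W l := \sum_k w k ord0 *: gain G k l.
have HE l : unvec h l = B + W l by exact: unvec_split.
have mp : 0 < m%:R :> R by rewrite ltr0n.
have Bh : m%:R * fro2 B <= fro2 h by exact: mean_block_fro2.
clearbody B.
have f0 := fro2_ge0 h; have B0 := fro2_ge0 B.
pose S b := (X b *m y) *m (X b *m y)^T - X b *m (X b)^T.
have split_dev : dev (unvec h) = dev (fun=> B) + dev W +
    2 * \sum_(b : blocks) mdot (W b.1) (B *m S b).
  rewrite /dev mulr_sumr -!sumrB -!big_split; apply: eq_bigr => b _ /=.
  rewrite HE !mulmxDl !fro2D /S mulmxBr mdotDr mdotNr.
  have e1 : mdot (B *m X b *m y) (W b.1 *m X b *m y) =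
      mdot (W b.1) (B *m (X b *m y *m (X b *m y)^T)).
    by rewrite -(mulmxA (W b.1)) [LHS]mdot_mulmxr !mulmxA.
  have e2 : mdot (B *m X b) (W b.1 *m X b) = mdot (W b.1) (B *m (X b *m (X b)^T)).
    by rewrite [LHS]mdot_mulmxr !mulmxA.
  by rewrite e1 e2; ring.
(* The form of [B] is the sum of the forms of its rows, so control of single rows is enough, and m
   |B|^2 <= |h|^2 absorbs the factor m. *)
have Bdev : `|dev (fun=> B)| <= fro2 h * (T%:R / 32).
  have -> : dev (fun=> B) = \sum_i dev (fun=> row i B).
    rewrite /dev sumrB; congr (_ - _).
      rewrite [RHS]exchange_big; apply: eq_bigr => b _ /=.
      rewrite fro2E; apply: eq_bigr => i _.
      by rewrite fro2E !big_ord1 -!row_mul [row _ _ _ _]mxE.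
    rewrite [RHS]exchange_big; apply: eq_bigr => b _ /=.
    rewrite fro2E; apply: eq_bigr => i _; rewrite fro2E big_ord1.
    by apply: eq_bigr => j _; rewrite -row_mul [row _ _ _ _]mxE.
  apply: (le_trans (ler_norm_sum _ _ _)).
  apply: (@le_trans _ _ (fro2 B * (m%:R * T%:R / 32))).
    have -> : fro2 B = \sum_i fro2 (row i B).
      rewrite fro2E; apply: eq_bigr => i _; rewrite fro2E big_ord1.
      by apply: eq_bigr => j _; rewrite mxE.
    by rewrite mulr_suml; apply: ler_sum => i _.
  have := ler_wpM2r (_ : 0 <= T%:R / 32 :> R) Bh; rewrite divr_ge0// => /(_ isT).
  by move=> hh; apply: le_trans hh; rewrite le_eqVlt; apply/orP; left; apply/eqP; ring.
(* [B] is moved onto the Gram deviation before applying duality in [w]. An entry of [B *m M e] is a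
   row of [B] against a column of entries at most tau, whence sqrt d; |B| <= |h| / sqrt m supplies
   the sqrt m of the hypothesis. *)
have cross : `|2 * \sum_(b : blocks) mdot (W b.1) (B *m S b)| <= fro2 h * (T%:R / 32).
  pose M e := \sum_(b : blocks) G b.1 e *: S b.
  have Mt e i j : `|M e i j| <= tau.
    have -> : M e i j = \sum_(b : blocks) G b.1 e * S b i j; last exact: devG.
    by rewrite summxE; apply: eq_bigr => b _; rewrite mxE.
  pose tau' := Num.sqrt (fro2 B) * (Num.sqrt d%:R * tau).
  have BM e i j : `|\sum_(b : blocks) G b.1 e * (B *m S b) i j| <= tau'.
    have -> : \sum_(b : blocks) G b.1 e * (B *m S b) i j = (B *m M e) i j.
      rewrite /M mulmx_sumr summxE; apply: eq_bigr => b _.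
      by rewrite -scalemxAr [RHS]mxE.
    have -> : (B *m M e) i j = mdot (row i B)^T (col j (M e)).
      by rewrite mxE mdotE; apply: eq_bigr => a _; rewrite big_ord1 !mxE.
    have colt a b : `|col j (M e) a b| <= tau by rewrite [col _ _ _ _]mxE.
    apply: (le_trans (mdot_le (row i B)^T tau0 colt)).
    rewrite mulr1 ler_wpM2r ?mulr_ge0 ?sqrtr_ge0// ler_wsqrtr// fro2_tr.
    rewrite [fro2 B]fro2E (bigD1 i)//= fro2E big_ord1.
    have -> : \sum_j row i B ord0 j ^+ 2 = \sum_j B i j ^+ 2.
      by apply: eq_bigr => k _; rewrite mxE.
    by rewrite lerDl; apply: sumr_ge0 => k _; apply: sumr_ge0 => ? _; exact: sqr_ge0.
  have tau'0 : 0 <= tau' by rewrite !mulr_ge0 ?sqrtr_ge0.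
  have := @gain_dot_le _ m q d G w (fun b : blocks => b.1) (fun b => B *m S b) tau' BM.
  rewrite -/(W _) => h1; rewrite normrM ger0_norm//.
  have h2 := ler_wpM2l tau'0 cone.
  have sB : Num.sqrt m%:R * Num.sqrt (fro2 B) <= l2norm h.
    by rewrite -sqrtrM// l2normE ler_wsqrtr.
  have sm : 0 < Num.sqrt (m%:R : R) by rewrite sqrtr_gt0.
  have l0 := l2norm_ge0 h.
  have h3 : 2 * (tau' * (4 * Phi * l2norm h)) =
     (8 * Phi * Num.sqrt d%:R * tau) * Num.sqrt (fro2 B) * l2norm h.
    by rewrite /tau'; ring.
  have h4 : (8 * Phi * Num.sqrt d%:R * tau) * Num.sqrt (fro2 B) <= l2norm h * (T%:R / 32).
    apply: (le_trans (ler_wpM2r (sqrtr_ge0 _) tauT)).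
    have -> : Num.sqrt m%:R * (T%:R / 32) * Num.sqrt (fro2 B) =
        Num.sqrt m%:R * Num.sqrt (fro2 B) * (T%:R / 32) by ring.
    by rewrite ler_wpM2r// divr_ge0.
  have h5 := ler_wpM2r l0 h4.
  have h6 : l2norm h * (T%:R / 32) * l2norm h = fro2 h * (T%:R / 32).
    by rewrite -sqr_l2norm; ring.
  move: h1; rewrite (_ : \sum_b mdot (\sum_k w k ord0 *: gain G k b.1) (B *m S b)
    = \sum_(b : blocks) mdot (W b.1) (B *m S b))//; lra.
have Qge : T%:R * fro2 h <= \sum_(b : blocks) fro2 (unvec h b.1 *m X b).
  rewrite fro2_unvec mulr_sumr.
  have -> : \sum_(b : blocks) fro2 (unvec h b.1 *m X b) =
      \sum_l \sum_(t < T) fro2 (unvec h l *m X (l, t)).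
    by rewrite [RHS]pair_bigA; apply: eq_bigr => -[l t] _.
  apply: ler_sum => l _; apply: (@le_trans _ _ (\sum_(t < T) fro2 (unvec h l))).
    by rewrite sumr_const card_ord mulr_natl.
  by apply: ler_sum => t _.
have T0 : 0 <= T%:R * fro2 h by rewrite mulr_ge0.
have E : \sum_(b : blocks) fro2 (unvec h b.1 *m (X b *m y)) =
   \sum_(b : blocks) fro2 (unvec h b.1 *m X b) + dev (unvec h).
  rewrite /dev addrC subrK; by apply: eq_bigr => b _; rewrite mulmxA.
rewrite E split_dev.
move: Bdev devW cross; rewrite -/(dev W) !ler_norml => /andP[b1 _] /andP[b2 _] /andP[b3 _].
lra.
Qed.

End restricted_eigenvalue.

(** After division by T / 2 the inequality reads r^2 <= al r + be^2, which forces r <= al + be. *)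
Lemma quadratic_bound (r T lm s b : R) : 0 < T -> 0 <= r -> 0 <= lm -> 0 <= s ->
  0 <= b -> T / 2 * r ^+ 2 <= lm * ((1 + 3 * s) * r + 4 * b) ->
  r <= 6 * (lm / T) * (1 + s) + Num.sqrt (8 * (lm / T * b)).
Proof.
move=> T0 r0 lm0 s0 b0 h; pose x := lm / T.
have lmE : lm = x * T by rewrite /x divfK// gt_eqF.
have x0 : 0 <= x by rewrite /x divr_ge0// ltW.
have h2 : r ^+ 2 <= 2 * x * (1 + 3 * s) * r + 8 * (x * b).
  rewrite -(ler_pM2l T0); move: h; rewrite lmE; lra.
rewrite -/x; set be := Num.sqrt _.
have be0 : 0 <= be := sqrtr_ge0 _.
have be2 : be ^+ 2 = 8 * (x * b) by rewrite /be sqr_sqrtr// mulr_ge0// mulr_ge0.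
pose al := 6 * x * (1 + s).
have al0 : 0 <= al by rewrite /al mulr_ge0 ?addr_ge0// mulr_ge0.
have h3 : r ^+ 2 <= al * r + be ^+ 2.
  rewrite be2; apply: le_trans h2 _; rewrite lerD2r ler_wpM2r// /al.
  have : 0 <= x * (4 : R) by rewrite mulr_ge0.
  by have := mulr_ge0 x0 s0; lra.
rewrite -/al leNgt; apply/negP => hr.
have rp : 0 < r by apply: le_lt_trans hr; rewrite addr_ge0.
have : (al + be) * r < r * r by rewrite ltr_pM2r.
have : be * be <= be * r by rewrite ler_wpM2l//; lra.
by move: h3; rewrite !expr2; lra.
Qed.

Lemma l1_cone p (S : {set 'I_p}) (a w : 'cV[R]_p) :
  l1norm a - l1norm (a + w) <=
  l1norm_on S w - l1norm_on (~: S)%SET w + 2 * l1norm_on (~: S)%SET a.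
Proof.
rewrite (l1norm_onC S a) (l1norm_onC S (a + w)).
have h1 : l1norm_on S a <= l1norm_on S (a + w) + l1norm_on S w.
  rewrite /l1norm_on -big_split; apply: ler_sum => i _ /=; rewrite mxE.
  by have := ler_normB (a i ord0 + w i ord0) (w i ord0); rewrite addrK.
have h2 : l1norm_on (~: S)%SET w <= l1norm_on (~: S)%SET (a + w) + l1norm_on (~: S)%SET a.
  rewrite /l1norm_on -big_split; apply: ler_sum => i _ /=; rewrite mxE.
  by have := ler_normB (a i ord0 + w i ord0) (a i ord0); rewrite addrAC subrr add0r.
lra.
Qed.

End deterministic.

(** * Consequences of the lower bounds on the sample size *)

Section budgets.
Context {R : realType}.

Lemma expR_2ln (x : R) : 0 < x -> expR (- (2 * ln x)) = x^-1 ^+ 2.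
Proof. by move=> x0; rewrite expRN expRM_natl lnK ?posrE// exprVn. Qed.

(** On the right, 16 is the square of the cone constant 4, 120 * 35 * 32 comes from chaining, 256
    from its parameter [K], 4 from 2 L2 + 1 + v <= 4 L2 v, and 64 from the target T / 64. *)
Lemma budget_const : 512 * (512 * (128 * (120 * 35))) =
  16 * (120 * (35 * (32 * 256))) * 4 * 64 :> R.
Proof. by ring. Qed.

(** One power of 1 / De comes from the trajectory norm, the other from the chaining parameter 256 /
    De. The sum 2 L2 + 1 + v is traded for the product L2 v, the shape of the sample size
    condition. *)
Lemma chain_budget (T De a Ph L2 v C0 : R) : 0 < De -> 1 <= L2 -> 1 <= v ->
  0 <= a -> 0 <= Ph -> 512 * (512 * (128 * (120 * 35))) <= C0 ->
  C0 * (v / De ^+ 2) * (1 + a * Ph * Num.sqrt L2) ^+ 2 <= T ->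
  16 * Ph ^+ 2 * (a ^+ 2 / De * (120 * (35 * (32 * (256 / De)) * (2 * L2 + 1 + v))))
  <= T / 64.
Proof.
rewrite budget_const => De0 L21 v1 a0 P0 hC hT.
pose Z := a ^+ 2 * Ph ^+ 2 / De ^+ 2.
have Z0 : 0 <= Z by rewrite /Z divr_ge0 ?sqr_ge0// mulr_ge0 ?sqr_ge0.
have L20 : 0 <= L2 by apply: le_trans L21.
have v0 : 0 <= v by apply: le_trans v1.
have vD0 : 0 <= v / De ^+ 2 by rewrite divr_ge0 ?sqr_ge0.
have q2 : Num.sqrt L2 ^+ 2 = L2 by rewrite sqr_sqrtr.
have s1 : a ^+ 2 * Ph ^+ 2 * L2 <= (1 + a * Ph * Num.sqrt L2) ^+ 2.
  have t0 : 0 <= a * Ph * Num.sqrt L2 by rewrite mulr_ge0 ?sqrtr_ge0// mulr_ge0.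
  by rewrite -[X in _ * X <= _]q2 -!exprMn ler_sqr ?nnegrE ?addr_ge0// lerDr.
have s2 : Z * (L2 * v) <= v / De ^+ 2 * (1 + a * Ph * Num.sqrt L2) ^+ 2.
  by have := ler_wpM2l vD0 s1; apply: le_trans; rewrite le_eqVlt /Z; apply/orP; left; apply/eqP; ring.
have W0 : 0 <= Z * (L2 * v) by rewrite mulr_ge0// mulr_ge0.
have Lv : 2 * L2 + 1 + v <= 4 * (L2 * v).
  have h1 : 0 <= (L2 - 1) * (v - 1) by rewrite mulr_ge0 ?subr_ge0.
  have h2 : 0 <= L2 * (v - 1) by rewrite mulr_ge0 ?subr_ge0.
  by lra.
set k : R := 16 * (120 * (35 * (32 * 256))) in hC *.
have k0 : 0 <= k by rewrite /k !mulr_ge0 ?ler0n.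
have -> : 16 * Ph ^+ 2 * (a ^+ 2 / De * (120 * (35 * (32 * (256 / De)) * (2 * L2 + 1 + v))))
   = k * (Z * (2 * L2 + 1 + v)).
  by rewrite /Z /k; field; rewrite gt_eqF.
clearbody k; rewrite ler_pdivlMr ?ltr0n//; apply: le_trans hT.
rewrite -mulrA; apply: (@le_trans _ _ (k * 4 * 64 * (Z * (L2 * v)))).
  have := ler_wpM2l k0 (ler_wpM2l Z0 Lv).
  rewrite -(ler_pM2r (_ : 0 < 64 :> R)) ?ltr0n// => /le_trans; apply.
  by rewrite le_eqVlt; apply/orP; left; apply/eqP; ring.
by apply: ler_pM => //; rewrite !mulr_ge0 ?ler0n.
Qed.

(** Rests on d (2 d + v) <= 4 (d + v)^2, where the outer d is the price of fitting an l2 ball into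
    an l1 ball. *)
Lemma mean_budget (T De m d v C0 : R) : 0 < De -> 0 < m -> 1 <= d -> 1 <= v ->
  512 * (512 * (128 * (120 * 35))) <= C0 ->
  C0 * ((d + v) ^+ 2 / (m * De ^+ 2)) <= T ->
  d * (1 / De * (120 * (35 * (32 * (64 / De)) * (2 * d + v)))) <= m * T / 64.
Proof.
rewrite budget_const => De0 m0 d1 v1 hC hT.
have d0 : 0 <= d by apply: le_trans d1.
have v0 : 0 <= v by apply: le_trans v1.
pose Z := (m * De ^+ 2)^-1.
have Z0 : 0 <= Z by rewrite /Z invr_ge0 mulr_ge0 ?sqr_ge0// ltW.
set k : R := 16 * (120 * (35 * (32 * 256))) in hC *.
have k0 : 0 <= k by rewrite /k !mulr_ge0 ?ler0n.
have -> : d * (1 / De * (120 * (35 * (32 * (64 / De)) * (2 * d + v)))) =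
    k / 64 * m * (Z * (d * (2 * d + v))).
  by rewrite /Z /k; field; rewrite !gt_eqF.
have C00 : 0 <= C0 by apply: (le_trans _ hC); rewrite !mulr_ge0 ?ler0n.
clearbody k; rewrite ler_pdivlMr ?ltr0n//.
have -> : k / 64 * m * (Z * (d * (2 * d + v))) * 64 = m * (k * (Z * (d * (2 * d + v)))).
  by field.
rewrite ler_wpM2l ?(ltW m0)//; apply: le_trans hT.
have dv : d * (2 * d + v) <= 4 * (d + v) ^+ 2.
  have : 0 <= d * v by rewrite mulr_ge0.
  have : 0 <= d ^+ 2 by rewrite sqr_ge0.
  have : 0 <= v ^+ 2 by rewrite sqr_ge0.
  by rewrite !expr2; lra.
have W0 : 0 <= (d + v) ^+ 2 / (m * De ^+ 2) by rewrite mulr_ge0 ?sqr_ge0.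
apply: (@le_trans _ _ (k * 4 * 64 * ((d + v) ^+ 2 / (m * De ^+ 2)))); last first.
  by rewrite ler_wpM2r.
have h := ler_wpM2l k0 (ler_wpM2l Z0 dv).
apply: (le_trans h); rewrite -/Z.
have -> : k * (Z * (4 * (d + v) ^+ 2)) = k * 4 * ((d + v) ^+ 2 * Z) by ring.
have k4 : k * 4 <= k * 4 * 64 by rewrite ler_peMr ?mulr_ge0 ?ler0n// ler1n.
exact: ler_wpM2r W0 _ _ k4.
Qed.

(* The left-hand side is [8 Phi sqrt(d) tau] with [tau] the uniform deviation
   [mu / sqrt(Delta) * sqrt(T / Delta) * (8 L2 + 1)] of the weighted Gram matrices. *)
Lemma cross_budget (T De m d mu Ph L2 C0 : R) : 0 < De -> 0 < T -> 0 < m -> 1 <= d -> 1 <= L2 ->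
  0 <= mu -> 0 <= Ph -> 512 * (512 * (128 * (120 * 35))) <= C0 ->
  C0 * (mu ^+ 2 * Ph ^+ 2 * L2 ^+ 2 * d ^+ 2 / (m * De ^+ 2)) <= T ->
  8 * Ph * Num.sqrt d * (mu * (Num.sqrt De)^-1 * Num.sqrt (T / De) * (8 * L2 + 1))
    <= Num.sqrt m * (T / 32).
Proof.
rewrite budget_const => De0 T0 m0 d1 L1 mu0 P0 hC hT.
have d0 : 0 <= d by apply: le_trans d1.
have L0 : 0 <= L2 by apply: le_trans L1.
pose Z := mu ^+ 2 * Ph ^+ 2 * L2 ^+ 2 * d ^+ 2 / (m * De ^+ 2).
have Z0 : 0 <= Z by rewrite /Z -!exprMn divr_ge0 ?sqr_ge0// mulr_ge0 ?sqr_ge0 ?ltW.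
have lhs : 8 * Ph * Num.sqrt d * (mu * (Num.sqrt De)^-1 * Num.sqrt (T / De) * (8 * L2 + 1)) <=
  8 * Ph * Num.sqrt d * (mu * (Num.sqrt De)^-1 * Num.sqrt (T / De) * (9 * L2)).
  rewrite ler_wpM2l ?mulr_ge0 ?sqrtr_ge0// ler_wpM2l ?mulr_ge0 ?invr_ge0 ?sqrtr_ge0//.
  by lra.
apply: (le_trans lhs).
rewrite -ler_sqr ?nnegrE ?mulr_ge0 ?invr_ge0 ?sqrtr_ge0 ?divr_ge0 ?(ltW T0)//.
rewrite !exprMn exprVn !sqr_sqrtr ?(ltW De0) ?(ltW m0)//; last first.
  by rewrite divr_ge0 ?ltW.
have e1 : 8 ^+ 2 * Ph ^+ 2 * d * (mu ^+ 2 / De * (T / De) * (9 ^+ 2 * L2 ^+ 2)) * d =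
  72 * 72 * (m * T * Z).
  by rewrite /Z; field; rewrite !gt_eqF.
have k0 : 72 * 72 * 32 * 32 <= 16 * (120 * (35 * (32 * 256))) * 4 * 64 :> R.
  have -> : 16 * (120 * (35 * (32 * 256))) * 4 * 64 =
    (128 * 120 * 32 * 32) * (35 * 256) :> R by ring.
  apply: (@le_trans _ _ (128 * 120 * 32 * 32)).
    by rewrite !ler_wpM2r ?ler0n// ler_pM ?ler0n ?ler_nat.
  rewrite ler_peMr ?mulr_ge0 ?ler0n//.
  by rewrite -[leLHS]mulr1 ler_pM ?ler0n ?ler1n.
have l : 8 ^+ 2 * Ph ^+ 2 * d * (mu ^+ 2 / De * (T / De) * (9 ^+ 2 * L2 ^+ 2)) <=
  72 * 72 * (m * T * Z).
  by rewrite -e1 ler_peMr// ?mulr_ge0 ?divr_ge0 ?sqr_ge0 ?invr_ge0 ?(ltW De0) ?(ltW T0)//.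
apply: (le_trans l).
have h : 72 * 72 * 32 * 32 * Z <= T.
  apply: le_trans hT; rewrite ler_wpM2r//; exact: le_trans hC.
have -> : m * (T ^+ 2 * 32^-1 ^+ 2) = m * T * (T / (32 * 32)) by field.
have -> : 72 * 72 * (m * T * Z) = m * T * (72 * 72 * Z) by ring.
rewrite ler_wpM2l ?mulr_ge0 ?(ltW m0) ?(ltW T0)// ler_pdivlMr ?mulr_gt0 ?ltr0n//.
by apply: le_trans h; rewrite le_eqVlt; apply/orP; left; apply/eqP; ring.
Qed.

End budgets.

(** * Concentration *)

Section deviation_events.
Context {R : realType}.
Variables (d T m : nat) (A : 'I_m -> 'M[R]_d) (rho : R).
Hypothesis rho0 : 0 <= rho.
Hypothesis rho1 : rho < 1.
Hypothesis Arho : forall l (z : 'cV_d), fro2 (A l *m z) <= rho ^+ 2 * fro2 z.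
Hypothesis T0 : (0 < T)%N.

Notation n := #|{: 'I_m * 'I_T.+1 * 'I_d}|.
Notation blocks := ('I_m * 'I_T)%type.
Let Delta := (1 - rho) ^+ 2.
Notation state b := (state_mx T A b.1 b.2.+1).

Context {disp : measure_display} {Omega : measurableType disp}.
Variables (P : probability Omega R) (xi : 'I_n -> Omega -> R).
Hypothesis hxi : iid_normal P xi.

Let Delta_gt0 : 0 < Delta. Proof. by rewrite exprn_gt0// subr_gt0. Qed.

Let Delta_le1 : Delta <= 1.
Proof. by rewrite expr_le1// ?subr_ge0 ?(ltW rho1)// gerBl. Qed.

Lemma weighted_gram_tail q (c : 'I_q -> 'I_m -> R) (U : blocks -> 'M[R]_(d, n))
    (g th c0 : R) :
  0 < g -> 0 < th -> (forall e, \sum_l c e l ^+ 2 <= g ^+ 2) ->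
  (forall y : 'cV_n, \sum_b fro2 (U b *m y) <= th ^+ 2 * fro2 y) ->
  fails_with P (q%:R * (d%:R * (d%:R * (2 * expR (- c0))))) (fun om => forall e i j,
    `|\sum_(b : blocks) c e b.1 * ((U b *m colv xi om) *m (state b *m colv xi om)^T
        - U b *m (state b)^T) i j| <= g * th * Num.sqrt (T%:R / Delta) * (4 * c0 + 1)).
Proof.
move=> g0 th0 cg Uth.
have rowU i (y : 'cV_n) : \sum_b fro2 (row i (U b) *m y) <= th ^+ 2 * fro2 y.
  apply: le_trans (Uth y); apply: ler_sum => b _; rewrite -row_mul.
  rewrite [leRHS]fro2E (bigD1 i)//= fro2E big_ord1.
  have -> : \sum_j row i (U b *m y) ord0 j ^+ 2 = \sum_j (U b *m y) i j ^+ 2.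
    by apply: eq_bigr => k _; rewrite [row _ _ _ _]mxE.
  by rewrite lerDl; apply: sumr_ge0 => k _; apply: sumr_ge0 => ? _; exact: sqr_ge0.
have h e i j := weighted_bilinear_tail rho0 rho1 Arho hxi c0 j T0 g0 th0 (cg e) (rowU i).
have := fails_with_forall_fin (fun e => fails_with_forall_fin (fun i =>
  fails_with_forall_fin (fun j => h e i j))).
apply: fails_with_le.
  by rewrite !sumr_const !card_ord !mulr_natl.
move=> om hom e i j; have := hom e i j.
rewrite -sumrB; congr (`|_| <= _); apply: eq_bigr => b _.
rewrite -mulrBr; congr (_ * _).
have e1 (M : 'M[R]_(d, n)) (y : 'cV_n) k l : (row k M *m y) ord0 l = (M *m y) k l.
  by rewrite -row_mul [LHS]mxE.
have e2 : (row i (U b) *m (row j (state b))^T) ord0 ord0 = (U b *m (state b)^T) i j.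
  by rewrite [LHS]mxE [RHS]mxE; apply: eq_bigr => k _; rewrite !mxE.
rewrite e1 e2 [RHS]mxE; congr (_ + _); last by rewrite [RHS]mxE.
by rewrite [RHS]mxE big_ord1 [X in _ = _ * X]mxE.
Qed.

(** No net of the sphere is needed: u / (sqrt d |u|) lies in the unit l1 ball, so the chaining bound
    applies with the same block in all m systems. The lost factor d is compensated by the target m
    T, to which all systems contribute. *)
Lemma mean_part_deviation (v : R) : (0 < d)%N -> (0 < m)%N -> 1 <= v ->
  d%:R * (1 / Delta * (120 * (35 * (32 * (64 / Delta)) * (2 * d%:R + v))))
    <= m%:R * T%:R / 64 ->
  fails_with P (expR (- v)) (fun om => forall u : 'rV[R]_d,
    `|\sum_(b : blocks) fro2 (u *m state b *m colv xi om)
      - \sum_(b : blocks) fro2 (u *m state b)| <= fro2 u * (m%:R * T%:R / 32)).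
Proof.
move=> d0 m0 v1 budget.
have dp : 1 <= d%:R :> R by rewrite ler1n.
have dp0 : 0 < d%:R :> R by rewrite ltr0n.
have mT0 : 0 <= m%:R * T%:R :> R by rewrite mulr_ge0.
pose Hj (k : 'I_d) (l : 'I_m) : 'rV[R]_d := delta_mx 0 k.
have HE (w : 'cV[R]_d) l : \sum_k w k ord0 *: Hj k l = w^T.
  by rewrite [RHS]row_sum_delta; apply: eq_bigr => k _; rewrite mxE.
have Hop (w : 'cV[R]_d) l : fro2 (\sum_k w k ord0 *: Hj k l) <= 1 * fro2 w.
  by rewrite HE fro2_tr mul1r.
have K1 : 1 <= 64 / Delta.
  by rewrite ler_pdivlMr// mul1r (le_trans Delta_le1)// ler1n.
(* The entropy parameter is 2 d, beyond the logarithm that chaining asks for, and d (2 d + v) still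
   fits the budget. *)
have L1 : 1 <= 2 * d%:R :> R by lra.
have LN : 2 * d%:R * expR (- (2 * d%:R)) <= 1 :> R.
  rewrite expRN ler_pdivrMr ?expR_gt0// mul1r.
  by apply: le_trans (expR_ge1Dx _); rewrite lerDr.
have v0 : 0 <= v by apply: le_trans v1.
(* The largest mean of the rescaled form. Divided by 64 / Delta and scaled back it is m T |u|^2 /
   64, half of the allowed deviation. *)
pose Rb := m%:R * T%:R / (d%:R * Delta).
have Rb0 : 0 <= Rb by rewrite divr_ge0// mulr_ge0// ltW.
have := block_chaos_l1_ball rho0 rho1 Arho hxi ltr01 Hop K1 v0 L1 LN Rb0.
apply: fails_with_le => // om h u.
have [->|u0] := eqVneq u 0.
  have z p : fro2 (0 : 'M[R]_(1, p)) = 0 by apply/eqP; rewrite fro2_eq0.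
  rewrite !big1 ?subr0 ?normr0 ?z ?mul0r// => b _.
    by rewrite mul0mx z.
  by rewrite !mul0mx z.
have f0 : 0 < fro2 u by rewrite lt_neqAle fro2_ge0 andbT eq_sym fro2_eq0.
pose s := Num.sqrt (d%:R * fro2 u).
have s2 : s ^+ 2 = d%:R * fro2 u by rewrite sqr_sqrtr// mulr_ge0// ltW.
have s0 : 0 < s by rewrite sqrtr_gt0 mulr_gt0.
pose w : 'cV[R]_d := s^-1 *: u^T.
have wE l : \sum_k w k ord0 *: Hj k l = s^-1 *: u by rewrite HE linearZ/= trmxK.
have l2 : l2norm u^T ^+ 2 = fro2 u by rewrite sqr_l2norm fro2_tr.
have w1 : l1norm w <= 1.
  have -> : l1norm w = s^-1 * l1norm u^T.
    rewrite /l1norm mulr_sumr; apply: eq_bigr => i _.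
    by rewrite mxE normrM gtr0_norm// invr_gt0.
  rewrite ler_pdivrMl// mulr1; apply: (le_trans (l1norm_l2norm _)).
  by rewrite /s sqrtrM ?ler0n// -l2 sqrtr_sqr ger0_norm// l2norm_ge0.
have sc p (M : blocks -> 'M[R]_(d, p)) :
    \sum_(b : blocks) fro2 ((\sum_k w k ord0 *: Hj k b.1) *m M b) =
    (d%:R * fro2 u)^-1 * \sum_b fro2 (u *m M b).
  rewrite mulr_sumr; apply: eq_bigr => b _.
  by rewrite wE -scalemxAl fro2Z exprVn s2.
have S2 : \sum_(b : blocks) fro2 ((\sum_k w k ord0 *: Hj k b.1) *m state b *m colv xi om) =
    (d%:R * fro2 u)^-1 * \sum_(b : blocks) fro2 (u *m state b *m colv xi om).
  under eq_bigr do rewrite -mulmxA.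
  by rewrite sc; congr (_ * _); apply: eq_bigr => b _; rewrite mulmxA.
have n1 : `|(d%:R * fro2 u)^-1| = (d%:R * fro2 u)^-1 by rewrite gtr0_norm ?invr_gt0 ?mulr_gt0.
have := h w w1; rewrite S2 sc -mulrBr normrM n1.
have ub : \sum_(b : blocks) fro2 (u *m state b) <= m%:R * T%:R * (fro2 u / Delta).
  apply: (@le_trans _ _ (\sum_(b : blocks) fro2 u / Delta)).
    by apply: ler_sum => b _; apply: (state_fro2_le rho0 rho1 Arho); rewrite ltnS ltnW.
  by rewrite sumr_const card_prod !card_ord -[leLHS]mulr_natl natrM.
rewrite !ler_pdivrMl ?mulr_gt0// => h'; apply: (le_trans (h' _)).
  apply: (le_trans ub); rewrite le_eqVlt; apply/orP; left; apply/eqP.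
  by rewrite /Rb; field; rewrite !gt_eqF.
have -> : Rb / (64 / Delta) = m%:R * T%:R / 64 / d%:R.
  by rewrite /Rb; field; rewrite !gt_eqF.
have := ler_wpM2l (ltW f0) budget => h2.
set Q := 1 / Delta * _ in h2 *.
have -> : d%:R * fro2 u * (Q + m%:R * T%:R / 64 / d%:R) =
   fro2 u * (d%:R * Q) + fro2 u * (m%:R * T%:R / 64).
  by field; rewrite !gt_eqF.
by move: h2; clearbody Q; lra.
Qed.

(** [w] is scaled into the unit l1 ball by 4 Phi |h|. The mean of the form is controlled by |h| and
    not by |w|, because the part carried by [w] is [h] minus its mean; this gives the small radius
    [Rb]. *)
Lemma chain_part_deviation q (G : 'M[R]_(m, q)) (a Ph L2 v : R) :
  (0 < m)%N -> 0 < a -> (forall l, \sum_e G l e ^+ 2 <= a ^+ 2) -> 0 < Ph ->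
  0 <= L2 -> 2 * (q * (d * d))%:R * expR (- (2 * L2 + 1)) <= 1 -> 1 <= v ->
  16 * Ph ^+ 2 * (a ^+ 2 / Delta * (120 * (35 * (32 * (256 / Delta)) * (2 * L2 + 1 + v))))
    <= T%:R / 64 ->
  fails_with P (expR (- v)) (fun om => forall (h : 'cV[R]_(m * (d * d))) (w : 'cV[R]_(q * (d * d))),
    fro2 h != 0 ->
    (forall l, unvec h l = mean_block h + \sum_k w k ord0 *: gain G k l) ->
    l1norm w <= 4 * Ph * l2norm h ->
    `|\sum_(b : blocks) fro2 ((\sum_k w k ord0 *: gain G k b.1) *m state b *m colv xi om)
      - \sum_(b : blocks) fro2 ((\sum_k w k ord0 *: gain G k b.1) *m state b)|
    <= fro2 h * (T%:R / 32)).
Proof.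
move=> m0 a0 Ga P0 L20 LN v1 budget.
have Hop (w : 'cV[R]_(q * (d * d))) l :
    fro2 (\sum_k w k ord0 *: gain G k l : 'M[R]_d) <= a ^+ 2 * fro2 w.
  by apply: (le_trans (gain_fro2 _ _ _)); rewrite ler_wpM2r ?fro2_ge0.
have K1 : 1 <= 256 / Delta.
  by rewrite ler_pdivlMr// mul1r (le_trans Delta_le1)// ler1n.
have L1 : 1 <= 2 * L2 + 1 by lra.
have v0 : 0 <= v by apply: le_trans v1.
(* The mean 4 T |h|^2 / Delta after division by (4 Phi |h|)^2. Divided by 256 / Delta and scaled
   back it gives T |h|^2 / 64. *)
pose Rb := T%:R / (4 * Delta * Ph ^+ 2).
have Rb0 : 0 <= Rb by rewrite divr_ge0// mulr_ge0 ?sqr_ge0// mulr_ge0// ltW.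
have a20 : 0 < a ^+ 2 by rewrite exprn_gt0.
have := block_chaos_l1_ball rho0 rho1 Arho hxi a20 Hop K1 v0 L1 LN Rb0.
apply: fails_with_le => // om hom h w h0 hw cone.
have f0 : 0 < fro2 h by rewrite lt_neqAle fro2_ge0 andbT eq_sym.
have r2 := sqr_l2norm h.
have r0 : 0 < l2norm h.
  by rewrite lt_neqAle l2norm_ge0 andbT eq_sym -sqrf_eq0 r2.
pose s := 4 * Ph * l2norm h.
have s0 : 0 < s by rewrite !mulr_gt0.
have s2 : s ^+ 2 = 16 * Ph ^+ 2 * fro2 h by rewrite -r2 /s; ring.
pose w' := s^-1 *: w.
have w1 : l1norm w' <= 1.
  have -> : l1norm w' = s^-1 * l1norm w.
    rewrite /l1norm mulr_sumr; apply: eq_bigr => i _.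
    by rewrite mxE normrM gtr0_norm// invr_gt0.
  by rewrite ler_pdivrMl// mulr1.
have wE l : \sum_k w' k ord0 *: gain G k l = s^-1 *: (\sum_k w k ord0 *: gain G k l : 'M[R]_d).
  by rewrite scaler_sumr; apply: eq_bigr => k _; rewrite [w' _ _]mxE [RHS]scalerA.
have sc p (M : blocks -> 'M[R]_(d, p)) :
    \sum_(b : blocks) fro2 ((\sum_k w' k ord0 *: gain G k b.1) *m M b) =
    (s ^+ 2)^-1 * \sum_b fro2 ((\sum_k w k ord0 *: gain G k b.1) *m M b).
  rewrite mulr_sumr; apply: eq_bigr => b _.
  by rewrite wE -scalemxAl fro2Z exprVn.
have S2 : \sum_(b : blocks) fro2 ((\sum_k w' k ord0 *: gain G k b.1) *m state b *m colv xi om) =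
    (s ^+ 2)^-1 * \sum_(b : blocks) fro2 ((\sum_k w k ord0 *: gain G k b.1) *m state b *m colv xi om).
  under eq_bigr do rewrite -mulmxA.
  by rewrite sc; congr (_ * _); apply: eq_bigr => b _; rewrite mulmxA.
have s20 : 0 < s ^+ 2 by rewrite exprn_gt0.
have n1 : `|(s ^+ 2)^-1| = (s ^+ 2)^-1 by rewrite gtr0_norm ?invr_gt0.
have := hom w' w1; rewrite S2 sc -mulrBr normrM n1.
have ub : \sum_(b : blocks) fro2 ((\sum_k w k ord0 *: gain G k b.1) *m state b) <=
    T%:R * (4 * fro2 h / Delta).
  apply: (@le_trans _ _ (\sum_(b : blocks) fro2 (\sum_k w k ord0 *: gain G k b.1 : 'M[R]_d) / Delta)).
    by apply: ler_sum => b _; apply: (state_fro2_le rho0 rho1 Arho); rewrite ltnS ltnW.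
  have W4 : \sum_l fro2 (\sum_k w k ord0 *: gain G k l : 'M[R]_d) <= 4 * fro2 h.
    apply: (@le_trans _ _ (\sum_l (2 * fro2 (unvec h l) + 2 * fro2 (- mean_block h)))).
      apply: ler_sum => l _; apply: le_trans (fro2D_le _ _).
      by rewrite hw addrAC subrr add0r.
    rewrite big_split -mulr_sumr -fro2_unvec sumr_const card_ord -[X in _ + X <= _]mulr_natl fro2N.
    by have := mean_block_fro2 h m0; lra.
  rewrite -(pair_bigA _ (fun l (t : 'I_T) => fro2 (\sum_k w k ord0 *: gain G k l : 'M[R]_d) / Delta))/=.
  under eq_bigr do rewrite sumr_const card_ord -mulr_natl.
  rewrite -mulr_sumr -mulr_suml ler_wpM2l// ler_pM2r ?invr_gt0//.
rewrite !ler_pdivrMl// => h'; apply: (le_trans (h' _)).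
  apply: (le_trans ub); rewrite s2 le_eqVlt; apply/orP; left; apply/eqP.
  by rewrite /Rb; field; rewrite !gt_eqF.
have -> : Rb / (256 / Delta) = T%:R / 64 / (16 * Ph ^+ 2).
  by rewrite /Rb; field; rewrite !gt_eqF.
have := ler_wpM2l (ltW f0) budget => h2; rewrite s2.
set Q := a ^+ 2 / Delta * _ in h2 *.
have -> : 16 * Ph ^+ 2 * fro2 h * (Q + T%:R / 64 / (16 * Ph ^+ 2)) =
   fro2 h * (16 * Ph ^+ 2 * Q) + fro2 h * (T%:R / 64).
  by field; rewrite !gt_eqF.
by move: h2; clearbody Q; lra.
Qed.

Lemma noise_block_sum (y : 'cV[R]_n) :
  \sum_(b : blocks) fro2 (noise_mx d T b.1 b.2.+1 *m y) <= fro2 y.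
Proof.
rewrite -(noise_mx_fro2 y).
rewrite -(pair_bigA _ (fun l (t : 'I_T) => fro2 (noise_mx d T l t.+1 *m y)))/=.
by apply: ler_sum => l _; rewrite [leRHS]big_ord_recl/= lerDr fro2_ge0.
Qed.

(** The three Gram bounds are unions over entries and cost powers of delta, with exponent 2 L each,
    whence 8 L + 1. The two uniform bounds cost e^-v each. *)
Lemma joint_deviations q (G : 'M[R]_(m, q)) (mu mu' L1 L2 v Ph : R) :
  (0 < d)%N -> (0 < m)%N -> 0 < mu -> (forall e, \sum_l G l e ^+ 2 <= mu ^+ 2) ->
  0 < mu' -> (forall l, \sum_e G l e ^+ 2 <= mu' ^+ 2) -> 0 < Ph -> 0 <= L2 ->
  2 * (q * (d * d))%:R * expR (- (2 * L2 + 1)) <= 1 -> 1 <= v ->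
  16 * Ph ^+ 2 * (mu' ^+ 2 / Delta * (120 * (35 * (32 * (256 / Delta)) * (2 * L2 + 1 + v))))
    <= T%:R / 64 ->
  d%:R * (1 / Delta * (120 * (35 * (32 * (64 / Delta)) * (2 * d%:R + v))))
    <= m%:R * T%:R / 64 ->
  fails_with P
    (2 * (q%:R * (d%:R * (d%:R * (2 * expR (- (2 * L2))))))
     + d%:R * (d%:R * (2 * expR (- (2 * L1)))) + 2 * expR (- v))
    (fun om => let y := colv xi om in let N (b : blocks) := noise_mx d T b.1 b.2.+1 in
    [/\ forall k i j, `|\sum_(b : blocks) G b.1 k * ((N b *m y) *m (state b *m y)^T) i j|
          <= mu * Num.sqrt (T%:R / Delta) * (8 * L2 + 1),
        forall i j, `|\sum_(b : blocks) ((N b *m y) *m (state b *m y)^T) i j|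
          <= Num.sqrt m%:R * (Num.sqrt (T%:R / Delta) * (8 * L1 + 1)),
        forall k i j, `|\sum_(b : blocks) G b.1 k *
             ((state b *m y) *m (state b *m y)^T - state b *m (state b)^T) i j|
          <= mu * (Num.sqrt Delta)^-1 * Num.sqrt (T%:R / Delta) * (8 * L2 + 1),
        forall u : 'rV[R]_d, `|\sum_(b : blocks) fro2 (u *m state b *m y)
            - \sum_(b : blocks) fro2 (u *m state b)| <= fro2 u * (m%:R * T%:R / 32)
      & forall (h : 'cV[R]_(m * (d * d))) (w : 'cV[R]_(q * (d * d))), fro2 h != 0 ->
        (forall l, unvec h l = mean_block h + \sum_k w k ord0 *: gain G k l) ->
        l1norm w <= 4 * Ph * l2norm h ->
        `|\sum_(b : blocks) fro2 ((\sum_k w k ord0 *: gain G k b.1) *m state b *m y)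
          - \sum_(b : blocks) fro2 ((\sum_k w k ord0 *: gain G k b.1) *m state b)|
        <= fro2 h * (T%:R / 32)]).
Proof.
move=> d0 m0 mu0 Gmu mup0 Gmup Ph0 L20 LN v1 budgetW budgetB.
have sD0 : 0 < Num.sqrt Delta by rewrite sqrtr_gt0.
pose N (b : blocks) : 'M[R]_(d, n) := noise_mx d T b.1 b.2.+1.
have Nsum (y : 'cV_n) : \sum_b fro2 (N b *m y) <= 1 ^+ 2 * fro2 y.
  by rewrite expr1n mul1r; exact: noise_block_sum.
have Xsum (y : 'cV_n) : \sum_(b : blocks) fro2 (state b *m y) <= (Num.sqrt Delta)^-1 ^+ 2 * fro2 y.
  rewrite exprVn sqr_sqrtr ?(ltW Delta_gt0)// mulrC; apply: le_trans (state_sum_le rho0 rho1 Arho y).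
  rewrite -(pair_bigA _ (fun l (t : 'I_T) => fro2 (state_mx T A l t.+1 *m y)))/=.
  by apply: ler_sum => l _; rewrite [leRHS]big_ord_recr/= lerDl fro2_ge0.
(* The noise at a block is independent of its state, so the Gram sums of noise and state are already
   centred. *)
have NX b : N b *m (state b)^T = 0 by rewrite state_noise_orth.
have sm0 : 0 < Num.sqrt (m%:R : R) by rewrite sqrtr_gt0 ltr0n.
have sm (e : 'I_1) : \sum_(l < m) (1 : R) ^+ 2 <= Num.sqrt (m%:R : R) ^+ 2.
  by rewrite expr1n sumr_const card_ord sqr_sqrtr.
have sD' : 0 < (Num.sqrt Delta)^-1 by rewrite invr_gt0.
have E1 := weighted_gram_tail (c := fun e l => G l e) (2 * L2) mu0 ltr01 Gmu Nsum.
have E2 := weighted_gram_tail (c := fun _ _ => 1) (2 * L1) sm0 ltr01 sm Nsum.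
have E3 := weighted_gram_tail (c := fun e l => G l e) (2 * L2) mu0 sD' Gmu Xsum.
have E4 := mean_part_deviation d0 m0 v1 budgetB.
have E5 := chain_part_deviation m0 mup0 Gmup Ph0 L20 LN v1 budgetW.
have := fails_with_and (fails_with_and (fails_with_and E1 E2) E3) (fails_with_and E4 E5).
apply: fails_with_le; first by rewrite le_eqVlt; apply/orP; left; apply/eqP; ring.
have c8 (L : R) : 4 * (2 * L) + 1 = 8 * L + 1 by ring.
move=> om /= [[[e1 e2] e3] [e4 e5]]; split => //.
- move=> k i j; have := e1 k i j; rewrite mulr1 c8; apply: le_trans.
  rewrite le_eqVlt; apply/orP; left; apply/eqP; congr (`|_|).
  by apply: eq_bigr => b _; rewrite NX subr0.
- move=> i j; have := e2 ord0 i j; rewrite mulr1 c8 -mulrA; apply: le_trans.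
  rewrite le_eqVlt; apply/orP; left; apply/eqP; congr (`|_|).
  by apply: eq_bigr => b _; rewrite NX subr0 mul1r.
- by move=> k i j; have := e3 k i j; rewrite c8.
Qed.

End deviation_events.

(** * The estimation error *)

Section error_analysis.
Context {R : realType}.

(** The mean part meets only the unweighted sum, of entries sqrt m t2, and |B| <= |h| / sqrt m
    cancels the sqrt m. The rest is duality in [w]. *)
Lemma noise_bound m T d q (G : 'M[R]_(m, q)) (h : 'cV[R]_(m * (d * d)))
    (w : 'cV[R]_(q * (d * d))) (e z : 'I_m * 'I_T -> 'cV[R]_d) (t1 t2 : R) :
  (0 < m)%N -> 0 <= t2 ->
  (forall l, unvec h l = mean_block h + \sum_k w k ord0 *: gain G k l) ->
  (forall k i j, `|\sum_b G b.1 k * (e b *m (z b)^T) i j| <= t1) ->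
  (forall i j, `|\sum_b (e b *m (z b)^T) i j| <= Num.sqrt m%:R * t2) ->
  `|\sum_b mdot (e b) (unvec h b.1 *m z b)| <= t1 * l1norm w + d%:R * t2 * l2norm h.
Proof.
move=> m0 t20 hw h1 h2; set B := mean_block h in hw *.
have Bh : m%:R * fro2 B <= fro2 h by exact: mean_block_fro2.
clearbody B.
have -> : \sum_b mdot (e b) (unvec h b.1 *m z b) = mdot B (\sum_b e b *m (z b)^T) +
    \sum_b mdot (\sum_k w k ord0 *: gain G k b.1) (e b *m (z b)^T).
  have -> : mdot B (\sum_b e b *m (z b)^T) = \sum_b mdot B (e b *m (z b)^T).
    by rewrite /mdot mulmx_sumr raddf_sum.
  rewrite -big_split; apply: eq_bigr => b _ /=.
  by rewrite mdot_mulmxr hw mdotC mdotDr mdotC [X in _ + X]mdotC.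
apply: (le_trans (ler_normD _ _)); rewrite addrC lerD//.
  exact: gain_dot_le.
have S2 i j : `|(\sum_b e b *m (z b)^T) i j| <= Num.sqrt m%:R * t2.
  by rewrite summxE.
have s20 : 0 <= Num.sqrt m%:R * t2 by rewrite mulr_ge0// sqrtr_ge0.
apply: (le_trans (mdot_le B s20 S2)).
rewrite -expr2 sqrtr_sqr ger0_norm ?ler0n//.
have -> : Num.sqrt (fro2 B) * (d%:R * (Num.sqrt m%:R * t2)) =
  d%:R * t2 * (Num.sqrt m%:R * Num.sqrt (fro2 B)) by ring.
by rewrite ler_wpM2l ?mulr_ge0// -sqrtrM// l2normE ler_wsqrtr.
Qed.

Lemma basic_inequality d m T (A : 'I_m -> 'M[R]_d) (x : 'I_m -> nat -> 'cV[R]_d)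
    (e : 'I_m * 'I_T -> 'cV[R]_d) p (Dt : 'M[R]_(p, m * (d * d))) (lambda : R)
    (a : 'cV[R]_(m * (d * d))) :
  let a0 := stack (fun l => vec (A l)) in
  (0 < m)%N ->
  (forall b : 'I_m * 'I_T, x b.1 b.2.+2 = A b.1 *m x b.1 b.2.+1 + e b) ->
  is_minimizer (objective T x Dt lambda) a ->
  \sum_(b : 'I_m * 'I_T) fro2 (unvec (a - a0) b.1 *m x b.1 b.2.+1) <=
  2 * \sum_b mdot (e b) (unvec (a - a0) b.1 *m x b.1 b.2.+1) +
  2 * (m%:R * lambda * (l1norm (Dt *m a0) - l1norm (Dt *m a))).
Proof.
move=> a0 m0 xE /(_ a0); rewrite /objective !residualE.
have e1 : \sum_(b : 'I_m * 'I_T) fro2 (x b.1 b.2.+2 - unvec a0 b.1 *m x b.1 b.2.+1) =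
    \sum_b fro2 (e b).
  by apply: eq_bigr => b _; rewrite xE unvec_stack addrAC subrr add0r.
have e2 : \sum_(b : 'I_m * 'I_T) fro2 (x b.1 b.2.+2 - unvec a b.1 *m x b.1 b.2.+1) =
    \sum_b fro2 (e b) - 2 * \sum_b mdot (e b) (unvec (a - a0) b.1 *m x b.1 b.2.+1)
    + \sum_(b : 'I_m * 'I_T) fro2 (unvec (a - a0) b.1 *m x b.1 b.2.+1).
  rewrite mulr_sumr -sumrB -big_split; apply: eq_bigr => b _ /=.
  rewrite unvecB unvec_stack mulmxBl xE.
  have -> : A b.1 *m x b.1 b.2.+1 + e b - unvec a b.1 *m x b.1 b.2.+1 =
    e b - (unvec a b.1 *m x b.1 b.2.+1 - A b.1 *m x b.1 b.2.+1).
    by rewrite opprB addrA [in RHS]addrC addrA addrC addrA [RHS]addrAC; congr (_ - _).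
  by rewrite fro2D fro2N mdotNr; ring.
rewrite e1 e2; set F := \sum_b fro2 (e b); set N := \sum_b mdot _ _.
set Q := \sum_b fro2 (_ *m _) => h.
have mp : 0 < 2 * m%:R :> R by rewrite mulr_gt0 ?ltr0n.
have := ler_wpM2l (ltW mp) h; rewrite !mulrDr !mulVKf ?gt_eqF// => h2.
by clearbody F N Q; lra.
Qed.

(** One inequality is read twice: discarding Q >= 0 gives the cone, keeping Q gives the bound behind
    the rate. The noise takes half of the penalty, which leaves weight 3 on S and 1 on its
    complement. *)
Lemma cone_bounds (Q N c W WS WSc sg b lm r : R) : 0 < lm -> 0 <= Q ->
  Q <= 2 * N + 2 * (lm * c) -> N <= lm / 2 * (W + r) ->
  c <= WS - WSc + 2 * b -> W = WS + WSc -> WS <= sg * r ->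
  W <= (1 + 4 * sg) * r + 4 * b /\ Q <= lm * ((1 + 3 * sg) * r + 4 * b - WSc).
Proof.
move=> lm0 Q0 hQ hN hc hW hS.
have h1 : Q <= lm * (r + 3 * WS - WSc + 4 * b).
  have := ler_wpM2l (ltW lm0) hc; rewrite hW in hN; lra.
split.
  have h2 : 0 <= r + 3 * WS - WSc + 4 * b.
    by rewrite -(pmulr_rge0 _ lm0); apply: le_trans h1.
  by rewrite hW; lra.
by apply: (le_trans h1); rewrite ler_wpM2l ?(ltW lm0)//; lra.
Qed.

(** When sqrt T r < 1, the first term of the rate alone exceeds r / sqrt m, as M >= 1. Otherwise 108
    = 6 * 18 is the larger of the two constants that arise. *)
Lemma error_rate (T m r M sg b : R) : 0 < T -> 0 < m -> 1 <= M -> 0 <= r ->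
  0 <= sg -> 0 <= b ->
  (1 <= Num.sqrt T * r ->
    r <= 6 * (18 * (M / Num.sqrt T)) * (1 + sg)
         + Num.sqrt (8 * (18 * (M / Num.sqrt T) * b))) ->
  (Num.sqrt m)^-1 * r <= 108 * (M / Num.sqrt (m * T) * (1 + sg)
                             + Num.sqrt (M / (m * Num.sqrt T) * b)).
Proof.
move=> T0 m0 M1 r0 sg0 b0 hr.
have sT : 0 < Num.sqrt T by rewrite sqrtr_gt0.
have sm : 0 < Num.sqrt m by rewrite sqrtr_gt0.
have M0 : 0 < M by apply: lt_le_trans M1.
rewrite sqrtrM ?(ltW m0)//; set s := Num.sqrt (M / _ * b).
have s0 : 0 <= s := sqrtr_ge0 _.
have [h|h] := leP 1 (Num.sqrt T * r).
  have := ler_wpM2l (_ : 0 <= (Num.sqrt m)^-1) (hr h); rewrite invr_ge0 ltW// => /(_ isT).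
  move=> /le_trans; apply; rewrite !mulrDr lerD//.
    by rewrite le_eqVlt; apply/orP; left; apply/eqP; field; rewrite !gt_eqF.
  rewrite ler_pdivrMl//.
  (* 8 * 18 is the square of 12, and 12 <= 108. *)
  have -> : 8 * (18 * (M / Num.sqrt T) * b) = 12 ^+ 2 * m * (M / (m * Num.sqrt T) * b).
    by field; rewrite !gt_eqF.
  rewrite sqrtrM ?mulr_ge0 ?sqr_ge0 ?(ltW m0)// sqrtrM ?sqr_ge0// sqrtr_sqr ger0_norm//.
  rewrite -/s; have := mulr_ge0 (ltW sm) s0; lra.
rewrite ler_pdivrMl//; apply: (@le_trans _ _ ((Num.sqrt T)^-1)).
  by rewrite -[leRHS]mulr1 ler_pdivlMl// ltW.
rewrite mulrDr mulrDr; apply: (@le_trans _ _ (108 * (M / Num.sqrt T) * (1 + sg))); last first.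
  have -> : Num.sqrt m * (108 * (M / (Num.sqrt m * Num.sqrt T) * (1 + sg))) =
    108 * (M / Num.sqrt T) * (1 + sg) by field; rewrite !gt_eqF.
  by rewrite lerDl !mulr_ge0// ltW.
have x0 : 0 < (Num.sqrt T)^-1 by rewrite invr_gt0.
rewrite -[leLHS]mul1r [leRHS](_ : _ = (108 * M * (1 + sg)) * (Num.sqrt T)^-1); last by ring.
rewrite ler_wpM2r ?(ltW x0)//.
have : 1 <= M * (1 + sg) by rewrite -[leLHS]mulr1 ler_pM//; lra.
lra.
Qed.

End error_analysis.

Section estimation_error.
Context {R : realType}.
Variables (d T m n q : nat).
Notation blocks := ('I_m * 'I_T)%type.
Variables (A : 'I_m -> 'M[R]_d) (D : 'M[R]_(q, m)) (G : 'M[R]_(m, q)).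
Hypothesis GD : G *m D = 1%:M - const_mx m%:R^-1.
Hypothesis m0 : (0 < m)%N.
Hypothesis T0 : (0 < T)%N.

Let Dt := D *t (1%:M : 'M[R]_(d * d)).
Let astar := stack (fun l => vec (A l)).

(* [X b *m y] and [N b *m y] are the state and the noise of block [b], as linear
   images of the vector [y] of all noise coordinates. *)
Variables (X N : blocks -> 'M[R]_(d, n)) (y : 'cV[R]_n).
Variables (x : 'I_m -> nat -> 'cV[R]_d).
Hypothesis xX : forall b : blocks, x b.1 b.2.+1 = X b *m y.
Hypothesis xN : forall b : blocks, x b.1 b.2.+2 = A b.1 *m x b.1 b.2.+1 + N b *m y.
Hypothesis XH : forall b (H : 'M[R]_d), fro2 H <= fro2 (H *m X b).

Lemma estimation_error (S : {set 'I_(q * (d * d))}) (lambda M t1 t2 t3 : R)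
    (a : 'cV[R]_(m * (d * d))) :
  let sg := Num.sqrt #|S|%:R / compatibility Dt S in
  let b := l1norm_on (~: S)%SET (Dt *m astar) in
  let Ph := 1 + sg + Num.sqrt T%:R * b in
  let lm := m%:R * lambda in
  is_minimizer (objective T x Dt lambda) a ->
  1 <= M -> lm = 18 * M * Num.sqrt T%:R ->
  t1 <= lm / 2 -> 0 <= t2 -> d%:R * t2 <= lm / 2 -> 0 <= t3 ->
  8 * Ph * Num.sqrt d%:R * t3 <= Num.sqrt m%:R * (T%:R / 32) ->
  (forall k i j, `|\sum_(b : blocks) G b.1 k * ((N b *m y) *m (X b *m y)^T) i j| <= t1) ->
  (forall i j, `|\sum_(b : blocks) ((N b *m y) *m (X b *m y)^T) i j|
     <= Num.sqrt m%:R * t2) ->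
  (forall k i j, `|\sum_(b : blocks) G b.1 k *
     ((X b *m y) *m (X b *m y)^T - X b *m (X b)^T) i j| <= t3) ->
  (forall u : 'rV[R]_d, `|\sum_(b : blocks) fro2 (u *m X b *m y)
      - \sum_(b : blocks) fro2 (u *m X b)| <= fro2 u * (m%:R * T%:R / 32)) ->
  (forall (h : 'cV[R]_(m * (d * d))) (w : 'cV[R]_(q * (d * d))), fro2 h != 0 ->
    (forall l, unvec h l = mean_block h + \sum_k w k ord0 *: gain G k l) ->
    l1norm w <= 4 * Ph * l2norm h ->
    `|\sum_(b : blocks) fro2 ((\sum_k w k ord0 *: gain G k b.1) *m X b *m y)
      - \sum_(b : blocks) fro2 ((\sum_k w k ord0 *: gain G k b.1) *m X b)|
    <= fro2 h * (T%:R / 32)) ->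
  (Num.sqrt m%:R)^-1 * l2norm (a - astar) <=
  108 * (M / Num.sqrt (m%:R * T%:R) * (1 + sg)
         + Num.sqrt (M / (m%:R * Num.sqrt T%:R) * b)).
Proof.
move=> sg b Ph lm amin M1 lmE t1l t20 t2l t30 t3l n1 n2 devG devB devW.
have basic := basic_inequality m0 xN amin.
pose h := a - astar; rewrite -/astar -/h in basic *.
pose w := Dt *m h.
have hw l : unvec h l = mean_block h + \sum_k w k ord0 *: gain G k l.
  exact: unvec_split.
have r0 := l2norm_ge0 h; set r := l2norm h in r0 *.
have sg0 : 0 <= sg by rewrite divr_ge0 ?sqrtr_ge0 ?compatibility_ge0.
have b0 : 0 <= b by apply: sumr_ge0.
have Tp : 0 < T%:R :> R by rewrite ltr0n.
have mp : 0 < m%:R :> R by rewrite ltr0n.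
have sT : 0 < Num.sqrt T%:R :> R by rewrite sqrtr_gt0.
have Ph0 : 0 <= Ph by rewrite !addr_ge0// mulr_ge0// ltW.
have lm0 : 0 < lm by rewrite lmE !mulr_gt0 ?(lt_le_trans ltr01 M1).
have w0 : 0 <= l1norm w by apply: sumr_ge0.
have nb := noise_bound m0 t20 hw n1 n2.
set Q := \sum_b _ in basic; set NN := \sum_b _ in basic.
have NE : NN = \sum_b mdot (N b *m y) (unvec h b.1 *m (X b *m y)).
  by apply: eq_bigr => k _; rewrite xX.
have QE : Q = \sum_b fro2 (unvec h b.1 *m (X b *m y)).
  by apply: eq_bigr => k _; rewrite xX.
have Q0 : 0 <= Q by apply: sumr_ge0 => k _; exact: fro2_ge0.
rewrite -NE in nb.
have N1 : NN <= lm / 2 * (l1norm w + r).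
  apply: (le_trans (ler_norm _)); apply: (le_trans nb).
  by rewrite mulrDr lerD// ler_wpM2r.
have cE : Dt *m a = Dt *m astar + w by rewrite /w /h mulmxBr addrC subrK.
have c1 := l1_cone S (Dt *m astar) w; rewrite -cE -/b in c1.
have WS := compatibilityP Dt S h; rewrite -/sg -/w -/r in WS.
have WSc0 : 0 <= l1norm_on (~: S)%SET w by apply: sumr_ge0.
have [cone Qle] := cone_bounds lm0 Q0 basic N1 c1 (l1norm_onC S w) WS.
apply: error_rate => // hr.
have rp : 0 < r.
  by rewrite -(pmulr_rgt0 _ sT); apply: lt_le_trans hr.
have f2 : fro2 h = r ^+ 2 by rewrite -sqr_l2norm.
(* Since sqrt T r >= 1, the additive 4 b is at most 4 sqrt T b r, which the last term of [Ph]
   accounts for; the cone becomes homogeneous. *)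
have coneP : l1norm w <= 4 * Ph * r.
  apply: (le_trans cone).
  have := ler_wpM2l b0 hr; rewrite mulr1 /Ph; lra.
have f0 : fro2 h != 0 by rewrite f2 expf_neq0// gt_eqF.
have RE := restricted_eigenvalue GD m0 XH devB (devW h w f0 hw coneP) t30 devG Ph0 coneP t3l.
rewrite -QE f2 in RE.
have lmT : lm / T%:R = 18 * (M / Num.sqrt T%:R).
  rewrite lmE -[X in _ / X](sqr_sqrtr (ler0n _ T)) expr2; field.
  by rewrite gt_eqF.
rewrite -lmT; apply: quadratic_bound => //; first exact: ltW.
apply: (le_trans RE); apply: (le_trans Qle); rewrite ler_wpM2l ?(ltW lm0)//; lra.
Qed.

End estimation_error.

(** * Failure probabilities and the size of the penalty *)

Section failure_probability.
Context {R : realType}.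

(** The 7 is 1 + 6 <= e^6; it lets six terms delta^2 be absorbed into one delta. *)
Lemma delta_small (delta : R) : 0 < delta -> delta < expR (- 6) -> 7 * delta <= 1.
Proof.
move=> d0 d6; have h : 7 <= expR 6 :> R by apply: le_trans (expR_ge1Dx _); lra.
have e : expR (- 6) * expR 6 = 1 :> R by rewrite -expRD addrC subrr expR0.
rewrite -[leRHS]e mulrC; apply: ler_pM; [exact: ltW|exact: ler0n|exact: ltW|exact: h].
Qed.

Lemma ln_ge1 (x delta : R) : 0 < delta -> delta < expR (- 6) -> 1 <= x ->
  1 <= ln (x / delta).
Proof.
move=> d0 d6 x1; have x0 : 0 < x by lra.
rewrite -[leLHS](expRK 1) ler_ln ?posrE ?expR_gt0 ?divr_gt0//.
rewrite ler_pdivlMr//; apply: le_trans x1.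
have h := ltW d6; apply: (@le_trans _ _ (expR 1 * expR (- 6))).
  by rewrite ler_pM2l ?expR_gt0.
by rewrite -expRD -[leRHS]expR0 ler_expR; lra.
Qed.

(** The doubled logarithms give squared inverses: one square of d cancels the d^2 entries, and at
    most 4 delta^2 + 2 delta^2 <= delta remains. For v >= 1, e^-v <= e^(-sqrt v). *)
Lemma failure_budget (q d T De delta v : R) : 1 <= q -> 1 <= d -> 1 <= T ->
  0 < De -> De <= 1 -> 0 < delta -> delta < expR (- 6) -> 1 <= v ->
  2 * (q * (d * (d * (2 * expR (- (2 * ln (d * q / delta)))))))
   + d * (d * (2 * expR (- (2 * ln (d * T / (delta * De)))))) + 2 * expR (- v)
  <= 4 * expR (- 1 * Num.sqrt v) + delta.
Proof.
move=> q1 d1 T1 De0 De1 d0 d6 v1.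
have [q0 dd0 T0] : [/\ 0 < q, 0 < d & 0 < T] by split; lra.
have d7 := delta_small d0 d6.
have sq x : 0 < x -> 1 <= x -> x^-1 * delta ^+ 2 <= delta ^+ 2.
  by move=> x0 x1; rewrite ler_piMl ?sqr_ge0// invf_le1.
rewrite !expR_2ln; [|by rewrite !(divr_gt0, mulr_gt0)..].
have e1 : q * (d * (d * (2 * (d * q / delta)^-1 ^+ 2))) = 2 * (q^-1 * delta ^+ 2).
  by field; rewrite !gt_eqF.
have e2 : d * (d * (2 * (d * T / (delta * De))^-1 ^+ 2)) =
    2 * ((T ^+ 2)^-1 * delta ^+ 2) * De ^+ 2.
  by field; rewrite !gt_eqF.
rewrite e1 e2.
have h1 := sq q q0 q1.
have h2 : (T ^+ 2)^-1 * delta ^+ 2 <= delta ^+ 2.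
  by apply: sq; rewrite ?exprn_gt0// exprn_ege1.
have h3 : (T ^+ 2)^-1 * delta ^+ 2 * De ^+ 2 <= delta ^+ 2.
  have De2 : De ^+ 2 <= 1 by rewrite expr_le1// ltW.
  by apply: le_trans h2; rewrite ler_piMr// mulr_ge0 ?invr_ge0 ?sqr_ge0.
have h4 : delta ^+ 2 * 7 <= delta.
  by rewrite expr2 -mulrA -[leRHS]mulr1 ler_wpM2l ?(ltW d0)// mulrC.
have h5 : expR (- v) <= expR (- 1 * Num.sqrt v).
  rewrite mulN1r ler_expR lerN2 -[leRHS]sqr_sqrtr ?expr2; last by lra.
  by rewrite ler_peMr ?sqrtr_ge0// -sqrtr1 ler_wsqrtr.
have h6 := expR_gt0 (- v); have h7 := sqr_ge0 delta.
rewrite -[2 * _ * De ^+ 2]mulrA.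
lra.
Qed.

(** The entropy condition of chaining for the q d^2 coordinates of [w], with L = 2 L2 + 1. *)
Lemma cover_budget (q d delta : R) : 1 <= q -> 1 <= d -> 0 < delta ->
  delta < expR (- 6) ->
  2 * (q * (d * d)) * expR (- (2 * ln (d * q / delta) + 1)) <= 1.
Proof.
move=> q1 d1 d0 d6; have [q0 dd0] : 0 < q /\ 0 < d by split; lra.
have d7 := delta_small d0 d6.
rewrite opprD expRD expR_2ln; last by rewrite divr_gt0// mulr_gt0.
have -> : 2 * (q * (d * d)) * ((d * q / delta)^-1 ^+ 2 * expR (- 1)) =
    2 * delta ^+ 2 * (q^-1 * expR (- 1)) by field; rewrite !gt_eqF.
have x0 : 0 <= 2 * delta ^+ 2 by rewrite mulr_ge0 ?sqr_ge0.
have x1 : 2 * delta ^+ 2 <= 1.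
  by have := ler_wpM2l (ltW d0) d7; rewrite expr2; lra.
have e0 : 0 <= expR (- 1) :> R by exact: expR_ge0.
have e1 : expR (- 1) <= 1 :> R by rewrite -[leRHS]expR0 ler_expR; lra.
have q0' : 0 <= q^-1 by rewrite invr_ge0 ltW.
have q1' : q^-1 <= 1 by rewrite invf_le1.
by rewrite mulr_ile1 ?(mulr_ge0 q0' e0) ?(mulr_ile1 q0' e0).
Qed.

End failure_probability.

(** The factor 18 is twice 9, where 8 L + 1 <= 9 L: both noise levels stay below half of the
    penalty. The level d of the mean part fits because d <= d^(3/2). *)
Lemma penalty_bounds {R : realType} (d m T De mu L1 L2 : R) : 1 <= d -> 0 < m ->
  0 <= T -> 0 < De -> De <= 1 -> 0 < mu -> 1 <= L1 -> 1 <= L2 ->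
  let Mx := Num.max (d `^ (3 / 2) * L1) (mu * L2) in
  let M := De `^ (- (1 / 2)) * Mx in
  let lm := m * (18 / m * Num.sqrt (T / De) * Mx) in
  [/\ 1 <= M, lm = 18 * M * Num.sqrt T,
      mu * Num.sqrt (T / De) * (8 * L2 + 1) <= lm / 2
    & d * (Num.sqrt (T / De) * (8 * L1 + 1)) <= lm / 2].
Proof.
move=> d1 m0 T0 De0 De1 mu0 L11 L21 Mx M lm.
have dd : d <= d `^ (3 / 2).
  by rewrite -[leLHS]powRr1 ?(le_trans ler01)// ler_powR//; lra.
have M1 : d * L1 <= Mx.
  by rewrite le_max; apply/orP; left; rewrite ler_wpM2r// (le_trans ler01).
have M2 : mu * L2 <= Mx by rewrite le_max lexx orbT.
have Mx1 : 1 <= Mx by apply: le_trans M1; rewrite -[leLHS]mulr1 ler_pM.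
have pE : De `^ (- (1 / 2)) = (Num.sqrt De)^-1.
  by rewrite powRN mul1r powR12_sqrt// ltW.
have sD : 0 < Num.sqrt De by rewrite sqrtr_gt0.
have sE : Num.sqrt (T / De) = Num.sqrt T / Num.sqrt De by rewrite sqrtrM// sqrtrV// ltW.
have lmE : lm = 18 * (Num.sqrt (T / De) * Mx) by rewrite /lm; field; rewrite gt_eqF.
have s0 := sqrtr_ge0 (T / De).
clearbody Mx; split.
- rewrite /M pE -[leLHS]mulr1 ler_pM// invf_ge1//.
  by rewrite -sqrtr1 ler_wsqrtr.
- by rewrite lmE sE /M pE; field; rewrite gt_eqF.
- rewrite lmE; have : mu * (8 * L2 + 1) <= 9 * Mx.
    have : mu * 1 <= mu * L2 by rewrite ler_pM2l.
    lra.
  by move=> /(ler_wpM2l s0); lra.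
- rewrite lmE; have : d * (8 * L1 + 1) <= 9 * Mx.
    have : d * 1 <= d * L1 by rewrite ler_pM2l// (lt_le_trans ltr01).
    lra.
  by move=> /(ler_wpM2l s0); lra.
Qed.

Theorem corollary2 (R : realType) :
  exists c1 C0 C c' c2 : R,
  [/\ 0 < c1, 0 < C0, 0 < C, 0 < c' & 0 < c2 < 1] /\
  forall (d T m : nat) (hd : (1 <= d)%N) (hT : (1 <= T)%N) (hm : (2 <= m)%N)
    (E : {set {set 'I_m}})
    (hE : simple_graph E) (hconn : connected_graph E)
    (tgt src : 'I_#|E| -> 'I_m) (horient : orientation tgt src)
    (A : 'I_m -> 'M[R]_d)
    (disp : measure_display) (Omega : measurableType disp)
    (P : probability Omega R)
    (eta x : 'I_m -> nat -> Omega -> 'cV[R]_d)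
    (heta : iid_standard_gaussian P
              (fun i : 'I_m * 'I_T.+1 => eta i.1 i.2.+1))
    (hx : linear_systems T A eta x)
    (rho_max : R) (hA : forall l, spectral_norm (A l) <= rho_max)
    (hrho : rho_max < 1)
    (delta : R) (hdelta : 0 < delta < c2) (v : R) (hv : 1 <= v),
  let D := incidence R tgt src in
  let Dt := D *t (1%:M : 'M[R]_(d * d)) in
  let mu := max_col_norm (pseudoinverse D) in
  let mu' := max_row_norm (pseudoinverse D) in
  let kappa := compatibility Dt in
  let astar := stack (fun l => vec (A l)) in
  let DeltaG := gramian_variation T A in
  let Delta := (1 - rho_max) ^+ 2 in
  let L1 := ln (d%:R * T%:R / (delta * Delta)) in
  let L2 := ln (d%:R * #|E|%:R / delta) in
  let M := Delta `^ (- (1 / 2)) * Num.max (d%:R `^ (3 / 2) * L1) (mu * L2) in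
  let lambda := c1 / m%:R * Num.sqrt (T%:R / Delta)
                * Num.max (d%:R `^ (3 / 2) * L1) (mu * L2) in
  let large_T := fun Phi : R =>
    [/\ T%:R >= C0 * (v / Delta ^+ 2) * (1 + mu' * Phi * Num.sqrt L2) ^+ 2,
        T%:R >= C0 * ((d%:R + v) ^+ 2 / (m%:R * Delta ^+ 2)),
        T%:R >= C0 * (mu ^+ 2 * Phi ^+ 2 * L2 ^+ 2 * d%:R ^+ 2
                      / (m%:R * Delta ^+ 2))
      & T%:R >= C0 * (mu / Num.sqrt m%:R) * Phi * d%:R * DeltaG] in
  let error_le := fun bound : R =>
    prob_ge P (1 - 4 * expR (- c' * Num.sqrt v) - delta) (fun w =>
      forall ahat : 'cV[R]_(m * (d * d)),
        is_minimizer (objective T (fun l t => x l t w) Dt lambda) ahat ->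
        (Num.sqrt m%:R)^-1 * l2norm (ahat - astar) <= bound) in
  [/\
    forall S : {set 'I_(#|E| * (d * d))},
      large_T (1 + Num.sqrt #|S|%:R / kappa S
               + Num.sqrt T%:R * l1norm_on (~: S)%SET (Dt *m astar)) ->
      error_le (C * (M / Num.sqrt (m%:R * T%:R)
                       * (1 + Num.sqrt #|S|%:R / kappa S)
                     + Num.sqrt (M / (m%:R * Num.sqrt T%:R)
                                 * l1norm_on (~: S)%SET (Dt *m astar)))),
    large_T (1 + Num.sqrt T%:R * l1norm (Dt *m astar)) ->
      error_le (C * (M / Num.sqrt (m%:R * T%:R)
                     + Num.sqrt (M / (m%:R * Num.sqrt T%:R)
                                 * l1norm (Dt *m astar))))
  & let S := supp (Dt *m astar) in
    let s : R := #|S|%:R in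
    large_T (1 + Num.sqrt s / kappa S) ->
      error_le (C * (M / Num.sqrt (m%:R * T%:R)) * (1 + Num.sqrt s / kappa S))].
Proof.
(* The values come from [penalty_bounds], [budget_const] and [error_rate], then from sqrt v <= v and
   from [delta_small]. *)
exists 18, (512 * (512 * (128 * (120 * 35)))), 108, 1, (expR (- 6)); split.
  split; rewrite ?mulr_gt0 ?ltr0n// ?ltr01// expR_gt0 -[ltRHS]expR0 ltr_expR.
  by rewrite oppr_lt0 ltr0n.
move=> d T m hd hT hm E hE hconn tgt src horient A disp Omega P eta x heta hx
  rho hA hrho delta /andP[d0 d6] v hv D Dt mu mu' kappa astar DeltaG Delta L1 L2
  M lambda large_T error_le.
have m0 : (0 < m)%N by exact: ltnW.
have [rho0 _] := spectral_norm_le (hA (Ordinal m0)).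
have Arho l (z : 'cV_d) : fro2 (A l *m z) <= rho ^+ 2 * fro2 z.
  by have [_] := spectral_norm_le (hA l).
pose n := #|{: 'I_m * 'I_T.+1 * 'I_d}|.
pose xi (k : 'I_n) w := eta (enum_val k).1.1 (enum_val k).1.2.+1 w (enum_val k).2 ord0.
have hxi : iid_normal P xi := iid_standard_gaussian_normal heta.
have noiseE l t w : (t <= T)%N -> noise_mx d T l t *m colv xi w = eta l t.+1 w.
  move=> tT; apply/colP => j; rewrite noise_mx_mul [LHS]mxE /xi enum_rankK /=.
  by rewrite inordK.
have stateE l t w : (t <= T.+1)%N -> x l t w = state_mx T A l t *m colv xi w.
  have [x0 xS] := hx l w; elim: t => [|t IH] tT; first by rewrite /= mul0mx.
  by rewrite xS// IH 1?ltnW//= mulmxDl -mulmxA noiseE.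
(* Both regimes are instances of this bound: the empty set, and the support, on whose complement the
   l1 norm vanishes. *)
have key (S : {set 'I_(#|E| * (d * d))}) :
  large_T (1 + Num.sqrt #|S|%:R / kappa S
               + Num.sqrt T%:R * l1norm_on (~: S)%SET (Dt *m astar)) ->
  error_le (108 * (M / Num.sqrt (m%:R * T%:R) * (1 + Num.sqrt #|S|%:R / kappa S)
     + Num.sqrt (M / (m%:R * Num.sqrt T%:R) * l1norm_on (~: S)%SET (Dt *m astar)))).
  set sg := Num.sqrt #|S|%:R / _; set b := l1norm_on _ _; set Ph := 1 + sg + _.
  move=> [c1 c2 c3 _].
  pose G := pseudoinverse D.
  have GD : G *m D = 1%:M - const_mx m%:R^-1 by exact: incidence_pinv.
  have G0 : G != 0 by exact: pseudoinverse_incidence_neq0.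
  have mu0 : 0 < mu := max_col_norm_gt0 G0.
  have mup0 : 0 < mu' := max_row_norm_gt0 G0.
  have q0 : (0 < #|E|)%N by exact: (edge_card_gt0 hconn horient hm).
  have q1 : 1 <= #|E|%:R :> R by rewrite ler1n.
  have d1 : 1 <= d%:R :> R by rewrite ler1n.
  have T1 : 1 <= T%:R :> R by rewrite ler1n.
  have Tp : 0 < T%:R :> R by rewrite ltr0n.
  have mp : 0 < m%:R :> R by rewrite ltr0n.
  have De0 : 0 < Delta by rewrite exprn_gt0// subr_gt0.
  have De1 : Delta <= 1 by rewrite expr_le1// ?subr_ge0 ?(ltW hrho)// gerBl.
  have dq1 : 1 <= d%:R * #|E|%:R :> R by rewrite -natrM ler1n muln_gt0 hd.
  have L21 : 1 <= L2 by exact: ln_ge1 dq1.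
  have L11 : 1 <= L1.
    have -> : L1 = ln (d%:R * T%:R / Delta / delta).
      by congr ln; field; rewrite !gt_eqF.
    apply: ln_ge1 => //; rewrite ler_pdivlMr// mul1r; apply: (le_trans De1).
    by rewrite -natrM ler1n muln_gt0 hd.
  have sg0 : 0 <= sg by rewrite divr_ge0 ?sqrtr_ge0 ?compatibility_ge0.
  have b0 : 0 <= b by apply: sumr_ge0.
  have Ph0 : 0 < Ph by rewrite ltr_wpDr ?ltr_wpDr// mulr_ge0 ?sqrtr_ge0.
  have v0 : 0 <= v by apply: le_trans hv.
  have W := chain_budget De0 L21 hv (ltW mup0) (ltW Ph0) (lexx _) c1.
  have B := mean_budget De0 mp d1 hv (lexx _) c2.
  have C := cross_budget De0 Tp mp d1 L21 (ltW mu0) (ltW Ph0) (lexx _) c3.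
  have [M1 lmE t1 t2] := penalty_bounds d1 mp (ltW Tp) De0 De1 mu0 L11 L21.
  have LN : 2 * (#|E| * (d * d))%:R * expR (- (2 * L2 + 1)) <= 1.
    by rewrite !natrM; exact: cover_budget.
  have := joint_deviations rho0 hrho Arho hT hxi L1 hd m0 mu0 (max_col_norm_ge G)
    mup0 (max_row_norm_ge G) Ph0 (le_trans ler01 L21) LN hv W B.
  move=> J; rewrite /error_le -addrA -opprD; apply: fails_with_prob_ge.
  apply: fails_with_le J; first exact: failure_budget.
  move=> w [n1 n2 devG devB devW] a amin.
  apply: (estimation_error GD m0 hT (y := colv xi w) (x := fun l t => x l t w)
    _ _ _ amin M1 lmE t1 _ t2 _ C n1 n2 devG devB devW).
  - by move=> k; apply: stateE; rewrite ltnS ltnW.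
  - move=> k; have [_ ->] := hx k.1 w; last by [].
    by rewrite noiseE.
  - by move=> k H; apply: state_fro2_ge; rewrite ltnW.
  - by rewrite mulr_ge0 ?sqrtr_ge0// addr_ge0// mulr_ge0// (le_trans ler01).
  - rewrite !mulr_ge0 ?invr_ge0 ?sqrtr_ge0 ?(ltW mu0)// addr_ge0// mulr_ge0//.
    by rewrite (le_trans ler01).
split.
- exact: key.
- have := key finset.set0; rewrite cards0 sqrtr0 mul0r addr0 finset.setC0.
  have -> : l1norm_on [set: 'I_(#|E| * (d * d))]%SET (Dt *m astar) = l1norm (Dt *m astar).
    by apply: eq_bigl => i; rewrite inE.
  by rewrite mulr1.
- move=> S s; have := key S.
  have -> : l1norm_on (~: S)%SET (Dt *m astar) = 0.
    by apply: big1 => i; rewrite !inE negbK => /eqP ->; rewrite normr0.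
  by rewrite !mulr0 sqrtr0 !addr0 [X in error_le X]mulrA.
Qed.
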